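(* Let $k$ be a perfect field of characteristic $p>0$ and let $\pi:Y\to X$ be an unramified Galois cover of smooth, proper, geometrically irreducible curves over $k$, with a fixed isomorphism $G=\mathrm{Gal}(Y/X)\cong\mathbb{Z}/p\mathbb{Z}$. Consider the exact sequences $$\text{(a)}\quad 0\to\mathcal{G}_{X,et}\to J_Y[p]_{et}[\delta]\to\mathbb{Z}/p\mathbb{Z}\to0\qquad\text{and}\qquad\text{(b)}\quad 0\to\mathbb{Z}/p\mathbb{Z}\to J_Y[p]_{et}/\delta\to\mathcal{G}_{X,et}\to0$$ described in the context. (1) The exact sequence (a) splits if and only if there is a ($G$-equivariant) exact sequence of $k$-group schemes $$0\to\mathbb{Z}/p\mathbb{Z}\to J_Y[p]_{et}\to\mathcal{Q}\to0$$ where $\mathcal{Q}$ is $G$-free. (2) The exact sequence (b) splits if and only if there is a ($G$-equivariant) exact sequence of $k$-group schemes $$0\to\mathcal{K}\to J_Y[p]_{et}\to\mathbb{Z}/p\mathbb{Z}\to0$$ where $\mathcal{K}$ is $G$-free. (3) The exact sequences (a) and (b) both split if and only if $J_Y[p]_{et}$ is the direct sum (as group scheme with $G$-action) of $\mathbb{Z}/p\mathbb{Z}$ and a $G$-free group scheme.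
   Context: $J_X,J_Y$ are the Jacobians of $X,Y$; $J_X[p]_{et},J_Y[p]_{et}$ are the étale parts of their $p$-torsion subgroup schemes. $\gamma\in G$ corresponds to $1\in\mathbb{Z}/p\mathbb{Z}$ and $\delta=\gamma-1\in\mathbb{F}_p[G]\cong\mathbb{F}_p[\delta]/(\delta^p)$, which acts on $J_Y[p]$. $\mathcal{G}[\delta]$ and $\mathcal{G}/\delta$ denote kernel and cokernel of $\delta$. Dieudonné theory: $\mathcal{G}\mapsto M(\mathcal{G})$ is the contravariant Dieudonné functor on finite commutative $k$-group schemes killed by $p$; $M(J_X[p])\cong H^1_{dR}(X)$. A $G$-action on such a $\mathcal{G}$ is $G$-free if $M(\mathcal{G})$ is free over $k[G]$ (equivalently $\mathcal{G}[\delta]=\delta^{p-1}\mathcal{G}$). The cover with its isomorphism $G\cong\mathbb{Z}/p\mathbb{Z}$ is a $\mathbb{Z}/p\mathbb{Z}$-torsor over $X$, giving a class in $H^1_{et}(X,\mathbb{Z}/p\mathbb{Z})$ whose image in $H^1(X,\mathcal{O}_X)$ is nonzero, Frobenius-fixed, and has a unique lift $\eta_X\in H^1_{dR}(X)$ with $F\eta_X=\eta_X$. The injection $M(\mathbb{Z}/p\mathbb{Z})=k\to H^1_{dR}(X)$, $\alpha\mapsto\alpha\eta_X$, corresponds to a canonical surjection $J_X[p]_{et}\to\mathbb{Z}/p\mathbb{Z}$, and $\mathcal{G}_{X,et}$ is its kernel. Pull back $\pi^*$ gives an isomorphism $J_X[p]_{et}\cong J_Y[p]_{et}[\delta]$;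 sequence (a) is $0\to\mathcal{G}_{X,et}\to J_X[p]_{et}\to\mathbb{Z}/p\mathbb{Z}\to0$ transported through it. The image of $\delta^{p-1}:J_Y[p]_{et}/\delta\to J_Y[p]_{et}[\delta]$ is the subgroup $\mathcal{G}_{X,et}$ and its kernel is isomorphic to $\mathbb{Z}/p\mathbb{Z}$; this gives sequence (b). *)

(* Defs.v *)
From HB Require Import structures.
From mathcomp Require Import all_boot all_algebra.
From mathcomp Require Import boolp classical_sets cardinality.

Set Implicit Arguments.
Unset Strict Implicit.
Unset Printing Implicit Defensive.

Import GRing.Theory.
Local Open Scope ring_scope.

Definition perfect_char (k : fieldType) (p : nat) : Prop :=
  forall x : k, exists y : k, y ^+ p = x.

Definition algebraic_over (k L : fieldType) (iota : {rmorphism k -> L})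
    (z : L) : Prop :=
  exists2 P : {poly k}, P != 0 & root (map_poly iota P) z.

(******************************************************************************)
(* Finite etale commutative k-group schemes killed by p, for k perfect.       *)
(* Such a group scheme A is given by the finite group A(kbar) with its        *)
(* continuous action of Gal(kbar/k); morphisms and exactness are read off     *)
(* on kbar-points.  Subgroup schemes and quotients of etale group schemes     *)
(* are again etale, so an exact sequence of k-group schemes with etale        *)
(* middle term stays inside this category.                                    *)
(******************************************************************************)
Section EtaleGroupSchemes.
Variables (k : fieldType) (kbar : closedFieldType).
Variables (iota : {rmorphism k -> kbar}) (p : nat).

(* When kbar is algebraic over k, such an endomorphism is bijective. *)
Record gal := Gal {
  gal_fun :> {rmorphism kbar -> kbar};
  gal_fix : forall c : k, gal_fun (iota c) = iota c }.

Record etGrp := EtGrp {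
  points :> finZmodType;
  act : gal -> points -> points;
  act_add : forall s e f, act s (e + f) = act s e + act s f;
  act_id : forall s : gal, s =1 id -> forall e, act s e = e;
  act_comp : forall s t u : gal, u =1 s \o t ->
    forall e, act u e = act s (act t e);
  act_cont : forall e, exists S : seq kbar,
    forall s t : gal, {in S, s =1 t} -> act s e = act t e;
  killed_by_p : forall e : points, e *+ p = 0 }.

Record etHom (A B : etGrp) := EtHom {
  et_fun :> A -> B;
  et_add : forall e f, et_fun (e + f) = et_fun e + et_fun f;
  et_act : forall s e, et_fun (act s e) = act s (et_fun e) }.

Definition is_kernel (N A B : etGrp) (i : etHom N A) (f : etHom A B) : Prop :=
  injective i /\ forall a, f a = 0 <-> exists n, i n = a.

Definition exact_seq (A B C : etGrp) (i : etHom A B) (f : etHom B C) : Prop :=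
  is_kernel i f /\ forall c, exists b, f b = c.

Definition splits (B C : etGrp) (f : etHom B C) : Prop :=
  exists t : etHom C B, forall c, f (t c) = c.

(* An action of G = Z/pZ; gam is the action of the generator gamma. *)
Record gGrp := GGrp {
  underlying :> etGrp;
  gam : etHom underlying underlying;
  gam_order : forall e, iter p gam e = e }.

Definition delta (A : gGrp) (e : A) : A := gam A e - e.

Definition gequiv (A B : gGrp) (f : etHom A B) : Prop :=
  forall e, f (gam A e) = gam B (f e).

Section ConstantGroup.
Hypothesis pk : p \in [pchar k].

Lemma Fp_killed (e : 'F_p) : e *+ p = 0.
Proof.
by rewrite -mulr_natr (pcharf0 (pchar_Fp (pcharf_prime pk))) mulr0.
Qed.

Definition Zp_et : etGrp :=
  @EtGrp 'F_p (fun _ e => e) (fun _ _ _ => erefl) (fun _ _ _ => erefl)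
    (fun _ _ _ _ _ => erefl)
    (fun _ => ex_intro _ [::] (fun _ _ _ => erefl)) Fp_killed.

Definition Zp_id : etHom Zp_et Zp_et :=
  @EtHom Zp_et Zp_et id (fun _ _ => erefl) (fun _ _ => erefl).

Lemma Zp_id_order (e : Zp_et) : iter p Zp_id e = e.
Proof. by elim: p => //= n ->. Qed.

(* A group of order p acts trivially on Z/pZ, whose automorphism group has
   order p - 1. *)
Definition Zp_G : gGrp := GGrp Zp_id_order.

End ConstantGroup.

(* On etale group schemes killed by p the contravariant Dieudonne functor is
   M(A) = Hom_k(A, G_a), i.e. the Galois-equivariant homomorphisms from
   A(kbar) to kbar, with F the p-th power map, V = 0, and G acting through
   A.  For A = Z/pZ this is k with its Frobenius. *)
Definition dieud (A : etGrp) (f : {ffun A -> kbar}) : Prop :=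
  (forall a b, f (a + b) = f a + f b) /\
  (forall (s : gal) a, f (act s a) = s (f a)).

Definition dieud_scale (A : etGrp) (c : k) (f : {ffun A -> kbar}) :=
  [ffun a => iota c * f a].

Definition dieudF (A : etGrp) (f : {ffun A -> kbar}) := [ffun a => f a ^+ p].

Definition dieud_comp (A B : etGrp) (h : etHom A B) (f : {ffun B -> kbar}) :=
  [ffun a : A => f (h a)].

(* M(A) is a free k[G]-module: b is a k[G]-basis, and c lists the
   coefficients on gamma ^ j * b i. *)
Definition gfree (A : gGrp) : Prop :=
  exists (r : nat) (b : 'I_r -> {ffun A -> kbar}),
    (forall i, dieud (b i)) /\
    (forall f : {ffun A -> kbar}, dieud f ->
       exists! c : 'M[k]_(r, p),
         forall a : A,
           f a = \sum_(i < r) \sum_(j < p)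
                   iota (c i j) * b i (iter j (gam A) a)).

End EtaleGroupSchemes.

Arguments Zp_et {k kbar} iota {p} pk.
Arguments Zp_G {k kbar} iota {p} pk.

(******************************************************************************)
(* A smooth proper geometrically irreducible curve X over a perfect field k   *)
(* is given by its function field: a function field in one variable over k,   *)
(* in which k is algebraically closed (for k perfect this is geometric        *)
(* irreducibility).  Its closed points are the places.                        *)
(******************************************************************************)
Section Curves.
Variable k : fieldType.

Definition function_field (K : fieldType) (cst : {rmorphism k -> K}) : Prop :=
  exists x : K, ~ algebraic_over cst x /\
    exists (n : nat) (b : 'I_n -> K), forall z : K,
      exists P Q : 'I_n -> {poly k},
        (forall i, (map_poly cst (Q i)).[x] != 0) /\
        z = \sum_(i < n)
              (map_poly cst (P i)).[x] / (map_poly cst (Q i)).[x] * b i.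

Definition derivation (K : fieldType) (cst : {rmorphism k -> K})
    (V : lmodType K) (D : K -> V) : Prop :=
  [/\ forall x y, D (x + y) = D x + D y,
      forall x y, D (x * y) = x *: D y + y *: D x
    & forall c, D (cst c) = 0].

(* (W, d) is the module of Kaehler differentials of K over k. *)
Definition kaehler (K : fieldType) (cst : {rmorphism k -> K})
    (W : lmodType K) (d : K -> W) : Prop :=
  derivation cst d /\
  forall (V : lmodType K) (D : K -> V), derivation cst D ->
    exists u : {linear W -> V}, (forall x, D x = u (d x)) /\
      forall v : {linear W -> V}, (forall x, D x = v (d x)) -> u =1 v.

Record curve := Curve {
  ffield :> fieldType;
  cst : {rmorphism k -> ffield};
  curve_dim1 : function_field cst;
  curve_geom_irr : forall z, algebraic_over cst z -> exists c, z = cst c;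
  Omega : lmodType ffield;
  dd : ffield -> Omega;
  curve_omega : kaehler cst dd }.

Record place (X : curve) := Place {
  vring : set X;
  vring_cst : forall c, vring (cst X c);
  vring_sub : forall x y, vring x -> vring y -> vring (x - y);
  vring_mul : forall x y, vring x -> vring y -> vring (x * y);
  vring_val : forall x, vring x \/ vring x^-1;
  vring_proper : exists x, ~ vring x }.

Definition maxid (X : curve) (P : place X) (z : X) : Prop :=
  vring P z /\ (z = 0 \/ ~ vring P z^-1).

(* The stalk at P of the sheaf of differentials, inside Omega X. *)
Definition int_diff (X : curve) (P : place X) (w : Omega X) : Prop :=
  exists (n : nat) (a b : 'I_n -> X),
    (forall i, vring P (a i) /\ vring P (b i)) /\
    w = \sum_(i < n) a i *: dd (b i).

Definition lies_over (X Y : curve) (phi : X -> Y) (Q : place Y) (P : place X)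
  : Prop := forall t, vring P t <-> vring Q (phi t).

(******************************************************************************)
(* The de Rham complex O_X -> Omega^1_X is computed by resolving both sheaves *)
(* by repartitions: H^1(X, O_X) is the quotient of the repartitions f by the  *)
(* integral ones and the constant ones g in K, and H^1_dR(X) is the group of  *)
(* pairs (w, f) with w - d f_P regular at every P, modulo the pairs           *)
(* (d g, g + h) with g in K and h integral at every P.                        *)
(******************************************************************************)
Definition cochain (X : curve) := (Omega X * (place X -> X))%type.

Definition repartition (X : curve) (f : place X -> X) : Prop :=
  finite_set [set P : place X | ~ vring P (f P)].

Definition cocycle (X : curve) (z : cochain X) : Prop :=
  repartition z.2 /\ forall P, int_diff P (z.1 - dd (z.2 P)).

Definition coboundary (X : curve) (z : cochain X) : Prop :=
  exists g : X, z.1 = dd g /\ forall P, vring P (z.2 P - g).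

Definition ch0 (X : curve) : cochain X := (0, fun=> 0).
Definition chadd (X : curve) (z z' : cochain X) : cochain X :=
  (z.1 + z'.1, fun P => z.2 P + z'.2 P).
Definition chsub (X : curve) (z z' : cochain X) : cochain X :=
  (z.1 - z'.1, fun P => z.2 P - z'.2 P).
Definition chscale (X : curve) (c : k) (z : cochain X) : cochain X :=
  (cst X c *: z.1, fun P => cst X c * z.2 P).
Definition chsum (X : curve) (n : nat) (z : nat -> cochain X) : cochain X :=
  (\sum_(i < n) (z i).1, fun P => \sum_(i < n) (z i).2 P).

(* Equality of classes in H^1_dR(X). *)
Definition cohom (X : curve) (z z' : cochain X) : Prop :=
  coboundary (chsub z z').

(* The absolute Frobenius kills differentials in characteristic p. *)
Definition frob (p : nat) (X : curve) (z : cochain X) : cochain X :=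
  (0, fun P => z.2 P ^+ p).

(* z' is the pull back of z by the morphism of curves with comorphism phi;
   for the morphisms used below z' exists and is unique, by the universal
   property of Omega X. *)
Definition pull (X Y : curve) (phi : {rmorphism X -> Y})
    (z : cochain X) (z' : cochain Y) : Prop :=
  (exists (n : nat) (a b : 'I_n -> X),
     z.1 = \sum_(i < n) a i *: dd (b i) /\
     z'.1 = \sum_(i < n) phi (a i) *: dd (phi (b i))) /\
  (forall Q P, lies_over phi Q P -> z'.2 Q = phi (z.2 P)).

(* M(J_X[p]_et) inside M(J_X[p]) = H^1_dR(X): the largest submodule on which
   F is bijective, since M is contravariant and J_X[p]_et is the largest
   etale quotient of J_X[p]. *)
Definition etale_part (p : nat) (X : curve) (z : cochain X) : Prop :=
  exists W : set (cochain X),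
    [/\ W z,
        forall x, W x -> cocycle x,
        forall x y, cocycle y -> cohom x y -> W x -> W y,
        (forall x y, W x -> W y -> W (chadd x y)) /\
        (forall c x, W x -> W (chscale c x))
      & [/\ forall x, W x -> W (frob p x),
            forall x, W x -> cohom (frob p x) (ch0 X) -> cohom x (ch0 X)
          & forall y, W y -> exists2 x, W x & cohom (frob p x) y]].

(* An unramified Galois cover Y -> X with group <cgam> identified with Z/pZ by
   cgam |-> 1.  Residue field extensions are separable for k perfect, so that
   only ramification indices matter. *)
Record galois_cover (p : nat) (X Y : curve) := GaloisCover {
  cpi : {rmorphism X -> Y};
  cpi_cst : forall c, cpi (cst X c) = cst Y c;
  cgam : {rmorphism Y -> Y};
  cgam_order : forall z, iter p cgam z = z;
  cgam_neq1 : exists z, cgam z <> z;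
  cgam_fixed : forall z, cgam z = z <-> exists t, z = cpi t;
  cover_unramified : forall (Q : place Y) z, maxid Q z ->
    exists t w, [/\ maxid Q (cpi t), vring Q w & z = cpi t * w] }.

(* Trace H^1_dR(Y) -> H^1_dR(X) on cochains: pi^* (Tr z) is the sum of the
   conjugates of z, and pi^* is injective on cochains. *)
Definition trace_of (p : nat) (X Y : curve) (pi : galois_cover p X Y)
    (z : cochain Y) (z' : cochain X) : Prop :=
  exists zs : nat -> cochain Y,
    [/\ zs 0%N = z, forall i, pull (cgam pi) (zs i) (zs i.+1)
      & pull (cpi pi) z' (chsum p zs)].

(* eta is the F-fixed lift of the class of the torsor Y -> X in H^1(X, O_X).
   The torsor under G_a deduced from Y has the generic section y and, for
   every place P, a section y - eta_P integral over P; the repartition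
   (eta_P) represents the class (up to the sign convention, which changes eta
   into - eta and neither its span nor the sequences below). *)
Definition torsor_class (p : nat) (X Y : curve) (pi : galois_cover p X Y)
    (eta : cochain X) : Prop :=
  [/\ cocycle eta, cohom (frob p eta) eta
    & exists y : Y, cgam pi y = y + 1 /\
        forall Q P, lies_over (cpi pi) Q P -> vring Q (y - cpi pi (eta.2 P))].

End Curves.

Section Jacobians.
Variables (k : fieldType) (kbar : closedFieldType).
Variables (iota : {rmorphism k -> kbar}) (p : nat).
Implicit Type X Y : curve k.

(* theta induces an isomorphism M(J) = M(J_X[p]_et), compatible with F.  As M
   is an anti-equivalence, this identifies J with J_X[p]_et. *)
Definition is_jac_et X (J : etGrp iota p)
    (theta : {ffun J -> kbar} -> cochain X) : Prop :=
  [/\ forall f, dieud f -> etale_part p (theta f),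
      (forall f g, dieud f -> dieud g ->
         cohom (theta (f + g)) (chadd (theta f) (theta g))) /\
      (forall c f, dieud f ->
         cohom (theta (dieud_scale c f)) (chscale c (theta f))),
      forall f, dieud f -> cohom (theta (dieudF f)) (frob p (theta f)),
      forall f, dieud f -> cohom (theta f) (ch0 X) -> f = 0
    & forall z, etale_part p z -> exists2 f, dieud f & cohom (theta f) z].

Definition is_jac_et_G X Y (pi : galois_cover p X Y) (J : gGrp iota p)
    (theta : {ffun J -> kbar} -> cochain Y) : Prop :=
  is_jac_et theta /\
  forall f z, dieud f -> pull (cgam pi) (theta f) z ->
    cohom (theta (dieud_comp (gam J) f)) z.

(* pb is the pull back pi^* : J_X[p]_et -> J_Y[p]_et; under
   M(J_X[p]) = H^1_dR(X), M(J_Y[p]) = H^1_dR(Y), M(pi^* ) is the trace. *)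
Definition is_pullback X Y (pi : galois_cover p X Y) (JX JY : etGrp iota p)
    (thX : {ffun JX -> kbar} -> cochain X)
    (thY : {ffun JY -> kbar} -> cochain Y) (pb : etHom JX JY) : Prop :=
  forall f z, dieud f -> trace_of pi (thY f) z ->
    cohom (thX (dieud_comp pb f)) z.

(* s is the surjection J_X[p]_et -> Z/pZ with M(s)(alpha) = alpha eta.  The
   generator 1 of M(Z/pZ) = k is the inclusion of F_p into kbar. *)
Definition is_canonical_surj (pk : p \in [pchar k]) X (eta : cochain X)
    (JX : etGrp iota p) (thX : {ffun JX -> kbar} -> cochain X)
    (s : etHom JX (Zp_et iota pk)) : Prop :=
  cohom (thX [ffun e => (nat_of_ord (s e))%:R]) eta.

Definition is_delta_kernel (N : etGrp iota p) (J : gGrp iota p)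
    (i : etHom N J) : Prop :=
  injective i /\ forall e : J, delta e = 0 <-> exists n, i n = e.

Definition is_delta_cokernel (J : gGrp iota p) (C : etGrp iota p)
    (q : etHom J C) : Prop :=
  (forall c, exists e, q e = c) /\
  forall e : J, q e = 0 <-> exists e', e = delta e'.

Definition is_direct_sum (A B S : gGrp iota p) (i : etHom A S)
    (j : etHom B S) : Prop :=
  [/\ gequiv i, gequiv j & bijective (fun ab : A * B => i ab.1 + j ab.2)].

End Jacobians.

(* Main.v *)
From HB Require Import structures.
From mathcomp Require Import all_boot all_algebra fingroup perm mxabelem.
From mathcomp Require Import boolp classical_sets functions cardinality.
From mathcomp Require Import ring zify.
Require Import Defs.

(* With |J_Y[p]_et| = p^(pr + 1), where p^r = |G_{X,et}|, everything is counting.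
   Indeed J_Y[p]_et[delta] has rank r + 1 and delta^(p-1) J_Y[p]_et has rank r,
   and a G-module A killed by p is G-free iff |delta^(p-1) A|^p = |A|, because
   M(A) becomes Hom(A, kbar) over kbar (Galois descent).

   The count holds as soon as J_Y[p]_et[delta] is not contained in
   delta J_Y[p]_et; passing to M(J_Y[p]_et), represented by repartitions of Y,
   suppose on the contrary that every invariant class there is of the form
   v = delta u.  Then delta^2 u = c + h with c in the function field, h integral
   and delta^(p-2) c constant, so that c = delta b by the additive form of
   Hilbert 90, and v - b is invariant up to integral repartitions.  Such a
   repartition comes from X, one place P at a time: if the residual
   Artin-Schreier equation of the cover has a root at P, it splits P and elements
   of the function field of X approximate those of Y; otherwise only one place
   lies above P and a generator of the cover gives an integral basis.  Hence all
   r + 1 dimensions of invariant classes come from H^1(X, O_X), which is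
   impossible as the pull back kills the class eta of the cover. *)

Set Implicit Arguments.
Unset Strict Implicit.
Unset Printing Implicit Defensive.

Import GRing.Theory.
Local Open Scope ring_scope.

(** An invariant class f on Y need not come from X: its invariance reads delta f = c + h with h
    integral, and the function c is a difference only if its trace delta^(p-1) c vanishes, while
    delta^p f = 0 shows only that this trace is constant. When f = delta u the argument starts one
    step lower: delta^(p-2) c is already constant, so the trace is zero. This is what the assumption
    to be refuted contributes. De Rham classes are compared through their repartitions. Frobenius
    kills differentials and is bijective on both modules, so nothing is lost, and taking p-th powers
    turns a repartition found by descent into a de Rham cocycle. Once the invariants are not
    contained in the differences, delta has r Jordan blocks of size p and a single block of size 1,
    whence the exponent pr + 1. Places are bare valuation rings, with no discreteness assumed. That
    the powers of an element of the maximal ideal tend to 0, on which the approximation at split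
    places rests, is extracted from transcendence degree one. *)

Lemma Zorn_above (T : Type) (P : set (set T)) (X0 : set T) :
  P X0 ->
  (forall F : set (set T), (F `<=` P)%classic -> (F !=set0)%classic ->
     total_on F subset -> P (\bigcup_(X in F) X)%classic) ->
  exists A, [/\ P A, (X0 `<=` A)%classic &
    forall B, P B -> (A `<=` B)%classic -> (B `<=` A)%classic].
Proof.
move=> P0 Pchain.
(* [Zorn_bigcup] also asks for the empty chain; adjoining [X0] inside the predicate turns its union
   into [X0]. *)
pose P' := [set X | P (X `|` X0)%classic]%classic.
have [F FP' Ftot|A [PA Amax]] := @Zorn_bigcup T P'.
  have [F0|/set0P[X1 FX1]] := eqVneq F set0.
    by rewrite /P' /= F0 bigcup_set0 set0U.
  pose F' := [set (X `|` X0)%classic | X in F]%classic.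
  rewrite /P' /=; suff -> : ((\bigcup_(X in F) X) `|` X0 = \bigcup_(X in F') X)%classic.
    apply: Pchain.
    - by move=> _ [X FX <-]; apply: FP'.
    - by exists (X1 `|` X0)%classic; exists X1.
    - move=> _ _ [X FX <-] [Z FZ <-].
      by have [XZ|ZX] := Ftot _ _ FX FZ; [left|right]; apply: setSU.
  rewrite eqEsubset; split => x.
    move=> [[X FX Xx]|X0x].
      by exists (X `|` X0)%classic; [exists X|left].
    by exists (X1 `|` X0)%classic; [exists X1|right].
  by move=> [_ [X FX <-]] [Xx|?]; [left; exists X|right].
exists (A `|` X0)%classic; split => //.
move=> B PB AB x Bx; left; apply: contrapT => nAx.
have /Amax : (A `<` B)%classic.
  by split; [move=> y Ay; apply: AB; left|move=> BA; apply: nAx; apply: BA].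
apply; rewrite /P' /=.
suff -> : (B `|` X0 = B)%classic by [].
by rewrite eqEsubset; split => y; [move=> [//|?]; apply: AB; right|left].
Qed.

Lemma chain_pair (T : Type) (F : set (set T)) a b : total_on F subset ->
  (\bigcup_(X in F) X)%classic a -> (\bigcup_(X in F) X)%classic b ->
  exists X, [/\ F X, X a & X b].
Proof.
move=> Ftot [X FX Xa] [Z FZ Zb]; have [XZ|ZX] := Ftot _ _ FX FZ.
  by exists Z; split => //; apply: XZ.
by exists X; split => //; apply: ZX.
Qed.

(** * Subrings of a field and Chevalley's extension theorem *)

Section Subrings.
Variable K : fieldType.
Implicit Types (B I : set K) (x y z : K).

Definition subring_set B :=
  [/\ B 1, forall x y, B x -> B y -> B (x - y)
    & forall x y, B x -> B y -> B (x * y)].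

Definition ideal_set B I :=
  [/\ I 0, forall x y, I x -> I y -> I (x - y),
      forall b x, B b -> I x -> I (b * x) & (I `<=` B)%classic].

Lemma subring_set0 B : subring_set B -> B 0.
Proof. by move=> [B1 BB _]; rewrite -(subrr 1); apply: BB. Qed.

Lemma subring_setN B x : subring_set B -> B x -> B (- x).
Proof.
by move=> hB Bx; rewrite -[- x]add0r; case: hB (subring_set0 hB) => _ BB _ ?; apply: BB.
Qed.

Lemma subring_setD B x y : subring_set B -> B x -> B y -> B (x + y).
Proof.
move=> hB Bx By; rewrite -[y]opprK.
by case: (hB) => _ BB _; apply: BB => //; apply: subring_setN.
Qed.

Lemma subring_setX B x n : subring_set B -> B x -> B (x ^+ n).
Proof.
move=> [B1 _ BM] Bx; elim: n => [|n IH]; first by rewrite expr0.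
by rewrite exprS; apply: BM.
Qed.

Lemma subring_set_sum B (J : Type) (r : seq J) (Q : pred J) (F : J -> K) :
  subring_set B -> (forall j, Q j -> B (F j)) -> B (\sum_(j <- r | Q j) F j).
Proof.
move=> hB BF; apply: (big_ind B) => //; first exact: subring_set0.
by move=> x y; apply: subring_setD.
Qed.

Lemma subring_set_nat B n : subring_set B -> B n%:R.
Proof.
move=> hB; elim: n => [|n IH]; first exact: subring_set0.
by rewrite -natr1; apply: subring_setD => //; case: hB.
Qed.

Lemma ideal_setD B I x y : ideal_set B I -> I x -> I y -> I (x + y).
Proof.
move=> [I0 IB _ _] Ix Iy; rewrite -[y]opprK -[- y]add0r.
by apply: (IB) => //; apply: IB.
Qed.

Lemma ideal_set_sum B I (J : Type) (r : seq J) (Q : pred J) (F : J -> K) :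
  ideal_set B I -> (forall j, Q j -> I (F j)) -> I (\sum_(j <- r | Q j) F j).
Proof.
move=> hI IF; apply: (big_ind I) => //; first by case: hI.
by move=> x y; apply: (@ideal_setD B).
Qed.

Definition adjoin B z : set K :=
  [set x | exists q : {poly K}, (forall i, B q`_i) /\ x = q.[z]]%classic.

Lemma adjoin_base B z : subring_set B -> (B `<=` adjoin B z)%classic.
Proof.
move=> hB x Bx; exists x%:P; split; last by rewrite hornerC.
by move=> i; rewrite coefC; case: eqP => // _; apply: subring_set0.
Qed.

Lemma adjoin_gen B z : subring_set B -> adjoin B z z.
Proof.
move=> hB; exists 'X; split; last by rewrite hornerX.
by move=> i; rewrite coefX; apply: subring_set_nat.
Qed.

Lemma adjoin_subring B z : subring_set B -> subring_set (adjoin B z).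
Proof.
move=> hB; case: (hB) => B1 BB BM; split.
- exact: adjoin_base.
- move=> _ _ [q [Bq ->]] [r [Br ->]]; exists (q - r); split.
    by move=> i; rewrite coefB; apply: BB.
  by rewrite hornerD hornerN.
- move=> _ _ [q [Bq ->]] [r [Br ->]]; exists (q * r); split.
    by move=> i; rewrite coefM; apply: subring_set_sum => // j _; apply: BM.
  by rewrite hornerM.
Qed.

Lemma adjoin_ideal B I z :
  subring_set B -> ideal_set B I -> ideal_set (adjoin B z) (adjoin I z).
Proof.
move=> hB hI; case: (hI) => I0 IB IM IsB; split.
- by exists 0; split; [move=> i; rewrite coef0|rewrite horner0].
- move=> _ _ [q [Bq ->]] [r [Br ->]]; exists (q - r); split.
    by move=> i; rewrite coefB; apply: IB.
  by rewrite hornerD hornerN.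
- move=> _ _ [q [Bq ->]] [r [Br ->]]; exists (q * r); split.
    by move=> i; rewrite coefM; apply: (ideal_set_sum _ hI) => // j _; apply: IM.
  by rewrite hornerM.
- by move=> _ [q [Iq ->]]; exists q; split => // i; apply: IsB.
Qed.

(** The longer of the two relations can be shortened with the help of the other, until one has
    degree 0 and puts 1 in [I]. *)
Lemma no_double_relation B I z (u w : nat -> K) n m :
  subring_set B -> ideal_set B I -> ~ I 1 -> z != 0 ->
  (forall i, I (u i)) -> (forall i, I (w i)) ->
  \sum_(i < n.+1) u i * z ^+ i = 1 -> \sum_(i < m.+1) w i * z ^- i = 1 -> False.
Proof.
move=> hB hI nI1; have [s] := ubnP (n + m)%N.
elim: s n m z u w => // s IH n m z u w nms z0 Iu Iw Hu Hw.
wlog mn : n m z u w nms z0 Iu Iw Hu Hw / (m <= n)%N.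
  move=> H; have [mn|/ltnW nm] := leqP m n; first exact: (H n m z u w).
  apply: (H m n z^-1 w u) => //; first by rewrite addnC.
  - by rewrite invr_eq0.
  - by rewrite -{}Hw; apply: eq_bigr => i _; rewrite exprVn.
  - by rewrite -{}Hu; apply: eq_bigr => i _; rewrite exprVn invrK.
case: (hB) => B1 BB BM; case: (hI) => I0 IB IM IsB.
case: n => [|n] in nms Hu mn *.
  by apply: nI1; rewrite -Hu big_ord1 expr0 mulr1.
pose w' j := if (j <= m)%N then w j else 0.
have Iw' j : I (w' j) by rewrite /w'; case: ifP.
have Hw' : \sum_(i < n.+2) w' i * z ^- i = 1.
  rewrite -Hw (big_ord_widen n.+2 (fun i => w i * z ^- i)) // [RHS]big_mkcond /=.
  by apply: eq_bigr => i _; rewrite ltnS /w'; case: ifP; rewrite ?mul0r.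
(* The first relation is multiplied by [1 - w' 0], and [(1 - w' 0) * z ^+ n.+1] is replaced by the
   lower powers that the second relation gives for it. This avoids dividing by [1 - w' 0]. *)
pose c i := w' 0%N *+ (i == 0%N) + (1 - w' 0%N) * u i + u n.+1 * w' (n.+1 - i)%N.
apply: (IH n m z c w) => //.
- move=> i; rewrite /c; apply: (ideal_setD hI); first apply: (ideal_setD hI).
  + by case: (i == 0%N); [apply: Iw'|apply: I0].
  + by apply: IM => //; apply: BB => //; apply: IsB.
  + by apply: IM => //; apply: IsB.
rewrite /c.
have -> : \sum_(i < n.+1) (w' 0%N *+ (i == 0%N :> nat) + (1 - w' 0%N) * u i
   + u n.+1 * w' (n.+1 - i)%N) * z ^+ i
   = w' 0%N + (1 - w' 0%N) * (\sum_(i < n.+1) u i * z ^+ i)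
     + u n.+1 * (\sum_(i < n.+1) w' (n.+1 - i)%N * z ^+ i).
  have E : \sum_(i < n.+1) w' 0%N *+ (i == 0%N :> nat) * z ^+ i = w' 0%N.
    rewrite big_ord_recl big1 ?addr0 /= ?mulr1n ?expr0 ?mulr1 //.
    by move=> i _; rewrite mulr0n mul0r.
  rewrite -[X in _ = X + _ + _]E !mulr_sumr -!big_split /=.
  by apply: eq_bigr => i _; ring.
have -> : \sum_(i < n.+1) u i * z ^+ i = 1 - u n.+1 * z ^+ n.+1.
  by move: Hu; rewrite big_ord_recr /= => <-; rewrite addrK.
have -> : \sum_(i < n.+1) w' (n.+1 - i)%N * z ^+ i = z ^+ n.+1 * (1 - w' 0%N).
  rewrite -[X in _ * (X - _)]Hw' [X in _ * (X - _)]big_ord_recl expr0 invr1 mulr1.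
  rewrite addrAC subrr add0r mulr_sumr.
  rewrite (reindex_inj rev_ord_inj) /=; apply: eq_bigr => i _.
  rewrite /bump /= add1n.
  have -> : (n.+1 - (n.+1 - i.+1) = i.+1)%N by have := ltn_ord i; lia.
  rewrite mulrCA; congr (_ * _).
  by rewrite expfB_cond // (negPf z0) /= add0n.
ring.
Qed.

(* Chevalley: a maximal pair (subring, proper ideal) is a valuation ring. *)
Lemma valuation_extension B0 I0 :
  subring_set B0 -> ideal_set B0 I0 -> ~ I0 1 ->
  exists B I, [/\ subring_set B, ideal_set B I, ~ I 1,
    (B0 `<=` B)%classic /\ (I0 `<=` I)%classic & forall z, B z \/ B z^-1].
Proof.
move=> hB0 hI0 nI01.
(* A pair (subring, ideal) is coded as one set of tagged elements, so that inclusion of sets is the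
   order on pairs. *)
pose br (X : set (K * bool)) : set K := [set x | X (x, true)]%classic.
pose id (X : set (K * bool)) : set K := [set x | X (x, false)]%classic.
pose mk B I : set (K * bool) := [set x | if x.2 then B x.1 else I x.1]%classic.
pose P (X : set (K * bool)) :=
  [/\ subring_set (br X), ideal_set (br X) (id X) & ~ id X 1].
have [|F FP [X1 FX1] Ftot|A [[hB hI nI1] sA Amax]] := @Zorn_above _ P (mk B0 I0).
- by split.
- have join2 a b := @chain_pair _ F a b Ftot.
  split.
  + split.
    * by exists X1 => //; case: (FP _ FX1) => [[]].
    * move=> x y Hx Hy; have [X [FX Xx Xy]] := join2 _ _ Hx Hy.
      by exists X => //; case: (FP _ FX) => [[_ BB _] _ _]; apply: BB.
    * move=> x y Hx Hy; have [X [FX Xx Xy]] := join2 _ _ Hx Hy.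
      by exists X => //; case: (FP _ FX) => [[_ _ BM] _ _]; apply: BM.
  + split.
    * by exists X1 => //; case: (FP _ FX1) => [_ [? _ _ _] _].
    * move=> x y Hx Hy; have [X [FX Xx Xy]] := join2 _ _ Hx Hy.
      by exists X => //; case: (FP _ FX) => [_ [_ IB _ _] _]; apply: IB.
    * move=> x y Hx Hy; have [X [FX Xx Xy]] := join2 _ _ Hx Hy.
      by exists X => //; case: (FP _ FX) => [_ [_ _ IM _] _]; apply: IM.
    * move=> x [X FX Xx]; exists X => //.
      by case: (FP _ FX) => [_ [_ _ _ IsB] _]; apply: IsB.
  + by move=> [X FX X1']; case: (FP _ FX).
(* For [z] outside the maximal subring, adjoining [z] must make the ideal improper. *)
have key z : ~ br A z -> exists q : {poly K}, (forall i, id A q`_i) /\ q.[z] = 1.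
  move=> nz; apply: contrapT => H; apply: nz.
  have PB : P (mk (adjoin (br A) z) (adjoin (id A) z)).
    split; [exact: adjoin_subring|exact: adjoin_ideal|].
    by move=> [q [Iq /esym q1]]; apply: H; exists q.
  apply: (Amax _ PB); last exact: adjoin_gen.
  move=> [x [|]] Ax; first exact: adjoin_base.
  exists x%:P; split; last by rewrite hornerC.
  by move=> i; rewrite coefC; case: eqP => //; case: hI.
exists (br A), (id A); split => //.
  split; first by move=> x ?; apply: (sA (x, true)).
  by move=> x ?; apply: (sA (x, false)).
move=> z; apply: contrapT => /not_orP[/key [q [Iq q1]] /[dup] nz /key [r [Ir r1]]].
have z0 : z != 0.
  by apply/eqP => z0; apply: nz; rewrite z0 invr0; apply: subring_set0.
apply: (@no_double_relation _ _ z (fun i => q`_i) (fun i => r`_i) (size q) (size r)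
  hB hI nI1 z0) => //.
  by rewrite -horner_coef_wide.
rewrite -{}r1 (horner_coef_wide _ (leqnSn _)).
by apply: eq_bigr => i _; rewrite exprVn.
Qed.

End Subrings.

(** * Places of a curve and its constants *)

Section Places.
Variables (k : fieldType) (X : curve k).
Implicit Types (P Q : place X) (x y z : X).

Lemma place_subring P : subring_set (vring P).
Proof.
split; [|exact: vring_sub|exact: vring_mul].
by rewrite -(rmorph1 (cst X)); apply: vring_cst.
Qed.

Definition vring1 P := let: And3 h _ _ := place_subring P in h.
Definition vring0 P := subring_set0 (place_subring P).
Definition vringN P x := @subring_setN _ _ x (place_subring P).
Definition vringD P x y := @subring_setD _ _ x y (place_subring P).
Definition vring_nat P n := @subring_set_nat _ _ n (place_subring P).
Definition vring_sum P J r D F := @subring_set_sum _ _ J r D F (place_subring P).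
Definition vringX P x n := @subring_setX _ _ x n (place_subring P).

Lemma place_eq P Q : (forall x, vring P x <-> vring Q x) -> P = Q.
Proof.
case: P Q => [O1 a1 b1 c1 d1 e1] [O2 a2 b2 c2 d2 e2] /= H.
have E : O1 = O2 by rewrite eqEsubset; split => x /H.
by subst O2; f_equal; apply: Prop_irrelevance.
Qed.

Lemma maxid_vring P x : maxid P x -> vring P x. Proof. by case. Qed.

Lemma maxid0 P : maxid P 0.
Proof. by split; [exact: vring0|left]. Qed.

Lemma maxid_nunit P x y : maxid P x -> vring P y -> x * y <> 1.
Proof.
move=> [Px [->|nx]] Py xy; first by move/eqP: xy; rewrite mul0r eq_sym oner_eq0.
apply: nx; suff -> : x^-1 = y by [].
by rewrite -[y]mul1r -[1](@mulVf _ x) ?mulrA -?mulrA ?xy ?mulr1 //;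
   apply/eqP => x0; move/eqP: xy; rewrite x0 mul0r eq_sym oner_eq0.
Qed.

Lemma maxid_not1 P : ~ maxid P 1.
Proof. by move=> m1; apply: (maxid_nunit m1 (vring1 P)); rewrite mulr1. Qed.

Lemma maxidP P x : vring P x -> (forall y, vring P y -> x * y <> 1) -> maxid P x.
Proof.
move=> Px H; split => //; have [->|x0] := eqVneq x 0; first by left.
by right => /H; apply; rewrite divff.
Qed.

Lemma vringV P x : vring P x -> ~ maxid P x -> vring P x^-1.
Proof.
by move=> Px nm; apply: contrapT => nx; apply: nm; split => //; right.
Qed.

Lemma nvring_maxidV P x : ~ vring P x -> maxid P x^-1.
Proof.
move=> nx; split; first by case: (vring_val P x).
by right; rewrite invrK.
Qed.

Lemma maxidM P x y : vring P x -> maxid P y -> maxid P (x * y).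
Proof.
move=> Px my; apply: maxidP; first by apply: vring_mul => //; apply: maxid_vring.
by move=> z Pz; rewrite mulrAC mulrC; apply: (maxid_nunit my); apply: vring_mul.
Qed.

Lemma maxidN P x : maxid P x -> maxid P (- x).
Proof. by move=> mx; rewrite -mulN1r; apply: maxidM => //; apply/vringN/vring1. Qed.

Lemma maxidD P x y : maxid P x -> maxid P y -> maxid P (x + y).
Proof.
wlog H : x y / vring P (x / y).
  move=> W mx my; have [|H] := vring_val P (x / y); first by move=> ?; apply: W.
  by rewrite addrC; apply: W => //; rewrite -invf_div.
move=> mx my; have [->|y0] := eqVneq y 0; first by rewrite addr0.
have -> : x + y = (x / y + 1) * y by rewrite mulrDl mul1r divfK.
by apply: maxidM => //; apply: vringD => //; apply: vring1.
Qed.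

Lemma maxidB P x y : maxid P x -> maxid P y -> maxid P (x - y).
Proof. by move=> mx my; apply: maxidD => //; apply: maxidN. Qed.

Lemma maxidX P x n : (0 < n)%N -> maxid P x -> maxid P (x ^+ n).
Proof.
case: n => // n _ mx; rewrite exprSr; apply: maxidM => //.
by apply/vringX/maxid_vring.
Qed.

Lemma maxid_prime P x y :
  vring P x -> vring P y -> maxid P (x * y) -> maxid P x \/ maxid P y.
Proof.
move=> Px Py mxy; apply: contrapT => /not_orP[nx ny].
apply: (@maxid_nunit P (x * y) (x^-1 * y^-1)) => //.
  by apply: vring_mul; apply: vringV.
rewrite mulrACA !divff ?mulr1 //; apply/eqP => E.
  by apply: ny; rewrite E; apply: maxid0.
by apply: nx; rewrite E; apply: maxid0.
Qed.

Lemma maxid_ideal P : ideal_set (vring P) (maxid P).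
Proof.
split; [exact: maxid0|exact: maxidB|by move=> *; apply: maxidM|].
by move=> x; apply: maxid_vring.
Qed.

Definition maxid_sum P J r D F := @ideal_set_sum _ _ _ J r D F (maxid_ideal P).

Lemma maxid_ex P : exists2 x, maxid P x & x != 0.
Proof.
have [x nx] := vring_proper P; exists x^-1; first exact: nvring_maxidV.
by rewrite invr_eq0; apply/eqP => x0; apply: nx; rewrite x0; apply: vring0.
Qed.

Lemma vring_unit_eq P x y : vring P x -> ~ maxid P x ->
  vring P (x * y) -> vring P y.
Proof.
move=> Px nx Pxy; have x0 : x != 0.
  by apply/eqP => x0; apply: nx; rewrite x0; apply: maxid0.
by rewrite -(mulKf x0 y); apply: vring_mul => //; apply: vringV.
Qed.

(** [x0] becomes a nonzero non-unit, and this makes the valuation ring given by Chevalley's theorem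
    proper. *)
Lemma ex_place (B I : set X) x0 :
  subring_set B -> ideal_set B I -> ~ I 1 -> (forall c, B (cst X c)) ->
  I x0 -> x0 != 0 ->
  exists P, (forall x, B x -> vring P x) /\ (forall x, I x -> maxid P x).
Proof.
move=> hB hI nI1 Bc Ix0 x00.
have [V [M [hV hM nM1 [BV IM] val]]] := valuation_extension hB hI nI1.
case: (hV) => V1 VB VM; case: (hM) => M0 MB MM MV.
have nM x : M x -> x != 0 -> ~ V x^-1.
  by move=> Mx x1 Vx; apply: nM1; rewrite -(mulVf x1); apply: MM.
have prop : exists x, ~ V x by exists x0^-1; apply: nM => //; apply: IM.
exists (@Place _ X V (fun c => BV _ (Bc c)) VB VM val prop); split => /= x.
  exact: BV.
move=> /IM Mx; split; first exact: MV.
by have [->|x1] := eqVneq x 0; [left|right; apply: nM].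
Qed.

(** A nonconstant [z] is transcendental over [k], so [z^-1] generates a proper ideal of [k[z^-1]]; a
    place above this ideal is a pole of [z]. *)
Lemma integral_const z : (forall P, vring P z) -> exists c, z = cst X c.
Proof.
move=> Pz; have [->|z0] := eqVneq z 0; first by exists 0; rewrite rmorph0.
suff : algebraic_over (cst X) z^-1.
  move=> /curve_geom_irr[c zc]; exists c^-1.
  by rewrite fmorphV -zc invrK.
apply: contrapT => nalg.
have hom q : q != 0 -> (map_poly (cst X) q).[z^-1] <> 0.
  by move=> q0 qz; apply: nalg; exists q => //; apply/eqP.
pose B := [set x | exists q : {poly k}, x = (map_poly (cst X) q).[z^-1]]%classic.
pose I := [set x | exists q : {poly k},
  q`_0 = 0 /\ x = (map_poly (cst X) q).[z^-1]]%classic.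
have [||||||P [_ mI]] := @ex_place B I z^-1.
- split.
  + by exists 1; rewrite rmorph1 hornerC.
  + by move=> _ _ [q ->] [r ->]; exists (q - r); rewrite rmorphB hornerD hornerN.
  + by move=> _ _ [q ->] [r ->]; exists (q * r); rewrite rmorphM hornerM.
- split.
  + by exists 0; rewrite coef0 rmorph0 horner0.
  + move=> _ _ [q [q0 ->]] [r [r0 ->]]; exists (q - r).
    by rewrite rmorphB hornerD hornerN coefB q0 r0 subrr.
  + move=> _ _ [q ->] [r [r0 ->]]; exists (q * r).
    by rewrite rmorphM hornerM coefM big_ord1 r0 mulr0.
  + by move=> _ [q [_ ->]]; exists q.
- move=> [q [q0 /eqP]]; rewrite eq_sym -subr_eq0 => /eqP E; apply: (hom (q - 1)).
    by apply/eqP => /polyP/(_ 0%N)/eqP; rewrite coefB q0 coef0 coef1 sub0r oppr_eq0 oner_eq0.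
  by rewrite rmorphB rmorph1 hornerD hornerN hornerC.
- by move=> c; exists c%:P; rewrite map_polyC hornerC.
- by exists 'X; rewrite map_polyX hornerX coefX.
- by rewrite invr_eq0.
have /mI : I z^-1 by exists 'X; rewrite map_polyX hornerX coefX.
by move=> /maxid_nunit/(_ (Pz P)); rewrite mulVf.
Qed.

(** Without places every element would be vacuously integral, hence constant. *)
Lemma place_exists : exists P : place X, True.
Proof.
apply: contrapT => H; have [x [nalg _]] := curve_dim1 X; apply: nalg.
have [|c ->] := @integral_const x; first by move=> P; case: H; exists P.
exists ('X - c%:P); first by rewrite polyXsubC_eq0.
by rewrite rmorphB /= map_polyX map_polyC /= root_XsubC.
Qed.

End Places.

(** * Transcendence degree one *)

Lemma size_polyM_bound (R : nzRingType) (q r : {poly R}) a b :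
  (size q <= a.+1)%N -> (size r <= b.+1)%N -> (size (q * r)%R <= (a + b).+1)%N.
Proof. by move=> qa rb; apply: leq_trans (size_polyMleq _ _) _; lia. Qed.

Lemma linear_dependence (F : fieldType) (S T : finType) (f : T -> S -> F) :
  (#|S| < #|T|)%N ->
  exists a : T -> F, (exists t, a t != 0) /\ forall s, \sum_t a t * f t s = 0.
Proof.
move=> ST; pose A := \matrix_(i < #|T|, j < #|S|) f (enum_val i) (enum_val j).
have : kermx A != 0.
  rewrite -mxrank_eq0 mxrank_ker -lt0n subn_gt0.
  exact: leq_ltn_trans (rank_leq_col _) ST.
move=> /rowV0Pn[v /sub_kermxP vA v0].
exists (fun t => v 0 (enum_rank t)); split.
  have /rV0Pn[i vi] := v0.
  by exists (enum_val i); rewrite enum_valK.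
move=> s; move/rowP: vA => /(_ (enum_rank s)); rewrite mxE [RHS]mxE.
rewrite (reindex (@enum_rank T)) /=; last exact/onW_bij/enum_rank_bij.
by move=> E; rewrite -[RHS]E; apply: eq_bigr => t _; rewrite !mxE !enum_rankK.
Qed.

Section AlgebraicDependence.
Variables (k K : fieldType) (cst : {rmorphism k -> K}).
Local Notation hx x q := (map_poly cst q).[x].

Lemma hxM x q r : hx x (q * r) = hx x q * hx x r.
Proof. by rewrite rmorphM hornerM. Qed.

(** A count of dimensions: after clearing denominators, the monomials [e ^+ i * c ^+ j] with i, j <
    N become vectors of [n] polynomials in [x] whose degrees grow linearly in N. For large N the
    number N^2 of monomials exceeds the dimension of the space of these vectors. *)
Lemma algebraic_dependence (e c : K) : function_field cst ->
  exists2 G : {poly {poly k}}, G != 0 &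
    \sum_(j < size G) hx e G`_j * c ^+ j = 0.
Proof.
move=> [x [_ [n [b gen]]]].
pose ev (v : 'rV[{poly k}]_n) := \sum_l hx x (v 0 l) * b l.
have evD u v : ev (u + v) = ev u + ev v.
  rewrite /ev -big_split; apply: eq_bigr => l _.
  by rewrite mxE rmorphD hornerD mulrDl.
have evZ a v : ev (a *: v) = hx x a * ev v.
  by rewrite /ev mulr_sumr; apply: eq_bigr => l _; rewrite mxE hxM mulrA.
have ev0 : ev 0 = 0.
  by rewrite /ev big1 // => l _; rewrite mxE rmorph0 horner0 mul0r.
have ev_sum (I : finType) (F : I -> 'rV_n) : ev (\sum_i F i) = \sum_i ev (F i).
  exact: (big_morph ev evD ev0).
have den z : exists D, exists v, hx x D != 0 /\ hx x D * z = ev v.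
  have [P [Q [Q0 ->]]] := gen z.
  exists (\prod_i Q i), (\row_i (P i * \prod_(j | j != i) Q j)); split.
    rewrite rmorph_prod horner_prod; apply/prodf_neq0 => i _; exact: Q0.
  rewrite /ev mulr_sumr; apply: eq_bigr => i _; rewrite mxE (bigD1 i) //= !hxM.
  have := Q0 i; move: (hx x (Q i)) (hx x (P i)) (hx x _) => q0 p0 r0 H.
  by field.
have cden (I : finType) (z : I -> K) : exists D (v : I -> 'rV_n),
    hx x D != 0 /\ forall i, hx x D * z i = ev (v i).
  have /choice[D /choice[v Dv]] := fun i => den (z i).
  exists (\prod_i D i), (fun i => (\prod_(j | j != i) D j) *: v i); split.
    by rewrite rmorph_prod horner_prod; apply/prodf_neq0 => i _; case: (Dv i).
  by move=> i; rewrite evZ (bigD1 i) //= hxM mulrAC mulrC (Dv i).2.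
(* [D] is a common denominator for 1 and for the products of [e] and [c] with the generators; [E]
   and [C] below then represent multiplication by [D e] and [D c]. *)
have [D [v [D0 Dv]]] := cden _ (fun i : option ('I_n + 'I_n) =>
  match i with None => 1 | Some (inl l) => e * b l | Some (inr l) => c * b l end).
pose E := \matrix_l v (Some (inl l)); pose C := \matrix_l v (Some (inr l)).
have evM z (A : 'M[{poly k}]_n) : (forall l, ev (row l A) = hx x D * (z * b l)) ->
    forall u, ev (u *m A) = hx x D * z * ev u.
  move=> H u; rewrite mulmx_sum_row ev_sum {2}/ev mulr_sumr; apply: eq_bigr => l _.
  by rewrite evZ H; ring.
have evE := evM e E; have evC := evM c C.
have {}evE u : ev (u *m E) = hx x D * e * ev u by apply: evE => l; rewrite rowK -Dv.
have {}evC u : ev (u *m C) = hx x D * c * ev u by apply: evC => l; rewrite rowK -Dv.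
pose dl := (size D + \sum_i \sum_j size (v i ord0 j))%N.
have dlv i j : (size (v i ord0 j) <= dl.+1)%N.
  rewrite /dl (bigD1 i) //= (bigD1 j) //=; lia.
have dlD : (size D <= dl.+1)%N by rewrite /dl; lia.
pose bnd s (u : 'rV[{poly k}]_n) := forall j, (size (u ord0 j) <= s.+1)%N.
have bndM s u (A : 'M[{poly k}]_n) : (forall i j, (size (A i j) <= dl.+1)%N) ->
    bnd s u -> bnd (s + dl)%N (u *m A).
  move=> HA Hu j; rewrite mxE; apply: leq_trans (size_sum _ _ _) _.
  by apply/bigmax_leqP => i _; apply: size_polyM_bound.
have bndZ s u : bnd s u -> bnd (s + dl)%N (D *: u).
  by move=> Hu j; rewrite mxE addnC; apply: size_polyM_bound.
pose w i j := iter j (mulmxr C) (iter i (mulmxr E) (v None)).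
have evw i j : ev (w i j) = hx x D ^+ (i + j).+1 * e ^+ i * c ^+ j.
  elim: j => [|j IH]; last by rewrite /w iterS evC -/(w i j) IH addnS !exprS; ring.
  elim: i => [|i IH]; first by rewrite /w /= -Dv expr1 !expr0 !mulr1.
  by move: IH; rewrite /w /= evE => ->; rewrite !addn0 !exprS; ring.
have bndw i j : bnd ((i + j).+1 * dl)%N (w i j).
  elim: j => [|j IH].
    elim: i => [|i IH]; first by move=> j; rewrite mul1n; apply: dlv.
    rewrite addn0 mulSnr; apply: bndM; last by move: IH; rewrite addn0.
    by move=> ? ?; rewrite mxE.
  by rewrite addnS mulSnr; apply: bndM IH => ? ?; rewrite mxE.
(* [s] bounds the degrees once all monomials carry the same power [(2 * N).+1] of [D], and [N] is
   chosen so that [n * s.+1 < N * N]. *)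
pose N := (n * (3 * dl + 1)).+1; pose s := ((2 * N).+1 * dl)%N.
pose u (t : 'I_N * 'I_N) := iter (2 * N - (t.1 + t.2)) ( *:%R D) (w t.1 t.2).
have tN (t : 'I_N * 'I_N) : (t.1 + t.2 <= 2 * N)%N.
  by have := ltn_ord t.1; have := ltn_ord t.2; lia.
have evu t : ev (u t) = hx x D ^+ (2 * N).+1 * e ^+ t.1 * c ^+ t.2.
  have -> : ((2 * N).+1 = (2 * N - (t.1 + t.2)) + (t.1 + t.2).+1)%N.
    by have := tN t; lia.
  rewrite /u; elim: (_ - _)%N => [|m IH]; first exact: evw.
  by rewrite iterS evZ IH addSn exprS !mulrA.
have bndu t : bnd s (u t).
  have -> : s = ((2 * N - (t.1 + t.2)) * dl + (t.1 + t.2).+1 * dl)%N.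
    by rewrite /s -mulnDl; congr (_ * _)%N; have := tN t; lia.
  rewrite /u; elim: (_ - _)%N => [|m IH]; first exact: bndw.
  by rewrite iterS mulSnr -addnA [(dl + _)%N]addnC addnA; apply: bndZ.
have [|a [[t0 at0] Ha]] := @linear_dependence k ('I_n * 'I_s.+1)%type
    ('I_N * 'I_N)%type (fun t l => (u t 0 l.1)`_l.2).
  rewrite !card_prod !card_ord.
  have H : (s.+1 <= N * (3 * dl + 1))%N by rewrite /s /N; nia.
  apply: leq_ltn_trans (leq_mul (leqnn n) H) _.
  by rewrite mulnCA ltn_pmul2l.
have sum0 : \sum_t cst (a t) * (e ^+ t.1 * c ^+ t.2) = 0.
  apply: (mulfI (expf_neq0 (2 * N).+1 D0)); rewrite mulr0 mulr_sumr.
  have E0 : \sum_t (a t)%:P *: u t = 0.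
    apply/rowP => l; rewrite summxE mxE; apply/polyP => i; rewrite coef_sum coef0.
    have [si|si] := ltnP s i.
      rewrite big1 // => t _; rewrite mxE coefCM nth_default ?mulr0 //.
      exact: leq_trans (bndu t l) si.
    rewrite -[RHS](Ha (l, Ordinal (si : (i < s.+1)%N))); apply: eq_bigr => t _.
    by rewrite mxE coefCM.
  rewrite -[RHS]ev0 -[in RHS]E0 ev_sum; apply: eq_bigr => t _.
  by rewrite evZ map_polyC hornerC evu mulrCA !mulrA.
pose b' i j := if insub i is Some i' then
  if insub j is Some j' then a (i', j') else 0 else 0 : k.
have b'E (t : 'I_N * 'I_N) : b' t.1 t.2 = a t by rewrite /b' !valK; case: t.
pose G : {poly {poly k}} := \poly_(j < N) \poly_(i < N) b' i j.
exists G.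
  apply/eqP => /polyP/(_ t0.2)/polyP/(_ t0.1); rewrite !coef0.
  by rewrite coef_poly ltn_ord coef_poly ltn_ord b'E => /eqP; rewrite (negPf at0).
rewrite -[RHS]sum0.
have sG : (size G <= N)%N by apply: size_poly.
rewrite (big_ord_widen N (fun j => hx e G`_j * c ^+ j)) // big_mkcond /=.
transitivity (\sum_(j < N) hx e G`_j * c ^+ j).
  apply: eq_bigr => j _; case: ltnP => // Gj.
  by rewrite nth_default // rmorph0 horner0 mul0r.
have Gx (j : 'I_N) : hx e G`_j = \sum_(i < N) cst (b' i j) * e ^+ i.
  rewrite /G coef_poly ltn_ord (@horner_coef_wide _ N); last first.
    by apply: leq_trans (size_poly _ _) _; apply: size_poly.
  by apply: eq_bigr => i _; rewrite coef_map coef_poly ltn_ord.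

transitivity (\sum_(j < N) \sum_(i < N) cst (b' i j) * e ^+ i * c ^+ j).
  by apply: eq_bigr => j _; rewrite -mulr_suml -Gx.
rewrite exchange_big pair_big /=; apply: eq_bigr => t _.
by rewrite b'E mulrA.
Qed.

End AlgebraicDependence.

Lemma poly_unX (R : idomainType) (p : {poly R}) : p != 0 ->
  exists m q, p = q * 'X^m /\ q`_0 != 0.
Proof.
move=> p0; have [m [q H ->]] := multiplicity_XsubC p 0.
exists m, q; rewrite subr0; split => //.
by move: H; rewrite p0 /= rootE horner_coef0.
Qed.

(** * The archimedean property of places *)

Section Archimedean.
Variables (k : fieldType) (X : curve k).

Lemma vring_horner (P : place X) (q : {poly X}) x :
  (forall i, vring P q`_i) -> vring P x -> vring P q.[x].
Proof.
move=> Pq Px; rewrite horner_coef; apply: vring_sum => i _.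
by apply: vring_mul => //; apply: vringX.
Qed.

Lemma vring_hornerX (P : place X) (q : {poly X}) x :
  (forall i, vring P q`_i) -> vring P x ->
  exists2 r, vring P r & q.[x] = q`_0 + x * r.
Proof.
move=> Pq Px; exists (\poly_(i < size q) q`_i.+1).[x].
  by apply: vring_horner => // i; rewrite coef_poly; case: ifP => // _; apply: vring0.
rewrite horner_poly (horner_coef_wide _ (leqnSn _)) big_ord_recl expr0 mulr1.
rewrite mulr_sumr; congr (_ + _); apply: eq_bigr => i _.
by rewrite exprS /=; ring.
Qed.

(** Let [c = a^-1] lie in the maximal ideal. A relation between [e] and [c] whose constant term in
    [c] is nonzero shows that [c] divides a nonzero polynomial in [e], which is a unit times a power
    of [e]. *)
Lemma place_archimedean (P : place X) e a : maxid P e -> e != 0 ->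
  exists N, forall n, (N <= n)%N -> vring P (a * e ^+ n).
Proof.
move=> me e0; have Pe := maxid_vring me.
have [Pa|na] := pselect (vring P a).
  by exists 0%N => n _; apply: vring_mul => //; apply: vringX.
have mc := nvring_maxidV na; set c := a^-1 in mc; have Pc := maxid_vring mc.
have a0 : a != 0 by apply/eqP => a0; apply: na; rewrite a0; apply: vring0.
have c0 : c != 0 by rewrite invr_eq0.
have [G G0 HG] := algebraic_dependence e c (curve_dim1 X).
pose rho : {rmorphism {poly k} -> X} := horner_eval e \o map_poly (cst X).
have {}HG : (map_poly rho G).[c] = 0.
  rewrite (@horner_coef_wide _ (size G)) ?size_poly // -[RHS]HG.
  by apply: eq_bigr => j _; rewrite coef_map.
have Prho q : vring P (rho q).
  apply: vring_horner => // i; rewrite coef_map; exact: vring_cst.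
have [m [Q [GE Q0]]] := poly_unX G0.
have {HG} HQ : (map_poly rho Q).[c] = 0.
  move/eqP: HG; rewrite GE rmorphM /= hornerM map_polyXn hornerXn mulf_eq0.
  by rewrite (negPf (expf_neq0 _ c0)) orbF => /eqP.
have [|//|r Pr] := @vring_hornerX P (map_poly rho Q) c.
  by move=> i; rewrite coef_map; apply: Prho.
rewrite HQ coef_map => /esym/eqP; rewrite addr_eq0 => /eqP HQ0.
have [s [q [QE q0]]] := poly_unX Q0.
have [|//|r' Pr'] := @vring_hornerX P (map_poly (cst X) q) e.
  by move=> i; rewrite coef_map; apply: vring_cst.
rewrite coef_map -[_.[e]]/(rho q) => rq.
have Prq : vring P (rho q)^-1.
  apply: (vringV (Prho q)) => mq. apply: (@maxid_nunit _ _ P (cst X q`_0) (cst X (q`_0)^-1)).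
  - have -> : cst X q`_0 = rho q - e * r' by rewrite rq /= addrK.
    by apply: maxidB => //; rewrite mulrC; apply: maxidM.
  - exact: vring_cst.
  - by rewrite -rmorphM divff // rmorph1.
have rq0 : rho q != 0.
  apply/eqP => E; have := Prho q; rewrite E in rq.
  move=> _; apply: (@maxid_nunit _ _ P (cst X q`_0) (cst X (q`_0)^-1)).
  - have -> : cst X q`_0 = - (e * r') by apply/eqP; rewrite -addr_eq0 -rq.
    by apply: maxidN; rewrite mulrC; apply: maxidM.
  - exact: vring_cst.
  - by rewrite -rmorphM divff // rmorph1.
exists s => n sn; rewrite -(subnK sn) exprD mulrCA; apply: vring_mul; first exact: vringX.
have -> : a * e ^+ s = - r * (rho q)^-1.
  have rX : rho 'X^s = e ^+ s.
    by rewrite -[rho _]/((map_poly (cst X) 'X^s).[e]) map_polyXn hornerXn.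
  have {}HQ0 : rho q * e ^+ s = - (c * r) by rewrite -rX -(rmorphM rho) -QE.
  apply: (mulfI c0); rewrite mulrA mulVf // mul1r mulrA mulrN -HQ0.
  by rewrite mulrAC divff // mul1r.
by apply: vring_mul => //; apply: vringN.
Qed.

End Archimedean.

(** * The difference operator of an additive map *)

Section Unipotent.
Variables (V : zmodType) (phi : V -> V).
Hypothesis phiD : forall u v, phi (u + v) = phi u + phi v.
Definition dif v := phi v - v.

Lemma phi0 : phi 0 = 0.
Proof. by apply: (addIr (phi 0)); rewrite -phiD !add0r. Qed.

Lemma phiMn v n : phi (v *+ n) = phi v *+ n.
Proof. by elim: n => [|n IH]; rewrite ?mulr0n ?phi0 // !mulrS phiD IH. Qed.

Lemma phi_sum (I : Type) (r : seq I) (P : pred I) (F : I -> V) :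
  phi (\sum_(i <- r | P i) F i) = \sum_(i <- r | P i) phi (F i).
Proof. exact: (big_morph phi phiD phi0). Qed.

Lemma phiN v : phi (- v) = - phi v.
Proof. by apply: (addIr (phi v)); rewrite -phiD !addNr phi0. Qed.

Lemma difD u v : dif (u + v) = dif u + dif v.
Proof. by rewrite /dif phiD opprD addrACA. Qed.

Lemma difN v : dif (- v) = - dif v.
Proof. by rewrite /dif phiN opprD. Qed.

Lemma dif0 : dif 0 = 0. Proof. by rewrite /dif phi0 subrr. Qed.

Lemma iter_difD n u v : iter n dif (u + v) = iter n dif u + iter n dif v.
Proof. by elim: n => // n IH; rewrite !iterS IH difD. Qed.

Lemma iter_difN n v : iter n dif (- v) = - iter n dif v.
Proof. by elim: n => // n IH; rewrite !iterS IH difN. Qed.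

Lemma iter_phi_dif n v :
  iter n phi v = \sum_(i < n.+1) iter i dif v *+ 'C(n, i).
Proof.
elim: n v => [|n IH] v; first by rewrite big_ord1 bin0.
rewrite iterS IH phi_sum big_ord_recl /= bin0 phiMn mulr1n.
under eq_bigr => i _ do rewrite /bump /= add1n phiMn.
have E i : phi (iter i dif v) = iter i dif v + iter i.+1 dif v.
  by rewrite iterS /dif addrC subrK.
rewrite (E 0%N) [RHS]big_ord_recl bin0 mulr1n /= -addrA; congr (_ + _).
rewrite -[dif v]/(iter 1 dif v).
under eq_bigr => i _ do rewrite (E i.+1) mulrnDl.
rewrite big_split /= addrCA.
under [in RHS]eq_bigr => i _ do rewrite /bump /= add1n binS mulrnDr.
rewrite [RHS]big_split /= [X in _ = X + _]big_ord_recr /= bin_small // mulr0n addr0.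
congr (_ + _); rewrite [RHS]big_ord_recl /= bin0 mulr1n; congr (_ + _).
Qed.

(** In the binomial expansion of the p-th power of phi = 1 + dif only the extreme terms survive
    modulo p. *)
Lemma iter_dif_p p : prime p -> (forall v : V, v *+ p = 0) ->
  (forall v, iter p phi v = v) -> forall v, iter p dif v = 0.
Proof.
move=> pp Vp phip v; have := phip v; rewrite iter_phi_dif.
case: p pp Vp phip => // p pp Vp _.
rewrite big_ord_recr big_ord_recl /= bin0 binn !mulr1n big1 ?addr0.
  by move=> E; apply: (addrI v); rewrite addr0.
move=> i _; rewrite /bump /= add1n.
have /dvdnP[m ->] : (p.+1 %| 'C(p.+1, i.+1))%N.
  by apply: prime_dvd_bin => //; rewrite /= ltnS ltn_ord.
by rewrite mulrnA Vp.
Qed.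

End Unipotent.

(** * Places of the cover and the action of its group *)

Section Cover.
Variables (k : fieldType) (p : nat) (pk : p \in [pchar k]).
Variables (X Y : curve k) (pi : galois_cover p X Y).
Local Notation g := (cgam pi).
Local Notation cp := (cpi pi).
Local Notation d := (dif g).

Let pp : prime p := pcharf_prime pk.
Let p0 : (0 < p)%N := prime_gt0 pp.

Let gD : forall u v : Y, g (u + v) = g u + g v := rmorphD g.

Lemma pcharX : p \in [pchar X].
Proof. by rewrite (fmorph_pchar (cst X)). Qed.
Lemma pcharY : p \in [pchar Y].
Proof. by rewrite (fmorph_pchar (cst Y)). Qed.

Lemma natY_neq0 n : (0 < n < p)%N -> n%:R != 0 :> Y.
Proof.
move=> /andP[n0 np]; rewrite -(dvdn_pcharf pcharY).
by apply/negP => /(dvdn_leq n0); rewrite leqNgt np.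
Qed.

Lemma factY_neq0 n : (n < p)%N -> n`!%:R != 0 :> Y.
Proof.
elim: n => [|n IH] np; first by rewrite oner_eq0.
by rewrite factS natrM mulf_neq0 ?IH ?natY_neq0 //= ltnW.
Qed.

Lemma cgam_cpi x : g (cp x) = cp x.
Proof. by apply/cgam_fixed; exists x. Qed.

Lemma cgam_cst c : g (cst Y c) = cst Y c.
Proof. by rewrite -(cpi_cst pi) cgam_cpi. Qed.

Lemma dif_iter_p z : iter p d z = 0.
Proof.
apply: iter_dif_p => //.
- by move=> v; rewrite -mulr_natr (pcharf0 pcharY) mulr0.
- exact: cgam_order.
Qed.

Lemma iter_cgamB n x z : iter n g (x - z) = iter n g x - iter n g z.
Proof. by elim: n => // n IH; rewrite !iterS IH rmorphB. Qed.
Lemma iter_cgamM n x z : iter n g (x * z) = iter n g x * iter n g z.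
Proof. by elim: n => // n IH; rewrite !iterS IH rmorphM. Qed.

Lemma conj_proper (Q : place Y) : exists x, ~ vring Q (g x).
Proof.
have [x nx] := vring_proper Q; exists (iter p.-1 g x).
by rewrite -iterS prednK // cgam_order.
Qed.

(** The valuation ring is the preimage of that of [Q] under [g]; the definition is transparent, so
    that [vring_conj] holds by computation. *)
Definition conj_place (Q : place Y) : place Y.
Proof.
refine (@Place _ Y (fun t => vring Q (g t)) _ _ _ _ (conj_proper Q)).
- by move=> c; rewrite cgam_cst; apply: vring_cst.
- by move=> x z; rewrite rmorphB; apply: vring_sub.
- by move=> x z; rewrite rmorphM; apply: vring_mul.
- by move=> x; rewrite fmorphV; apply: vring_val.
Defined.

Lemma vring_conj Q t : vring (conj_place Q) t = vring Q (g t).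
Proof. by []. Qed.

Lemma vring_iter_conj n Q t :
  vring (iter n conj_place Q) t <-> vring Q (iter n g t).
Proof.
elim: n t => // n IH t; rewrite iterS vring_conj IH.
by rewrite -iterSr.
Qed.

Lemma iter_conj_p Q : iter p conj_place Q = Q.
Proof. by apply: place_eq => t; rewrite vring_iter_conj cgam_order. Qed.

Lemma maxid_conj Q t : maxid (conj_place Q) t <-> maxid Q (g t).
Proof.
rewrite /maxid !vring_conj fmorphV; split=> -[Qt [H|H]]; split => //; try by right.
  by left; rewrite H rmorph0.
by left; move/eqP: H; rewrite fmorph_eq0 => /eqP.
Qed.

Lemma maxid_iter_conj n Q t :
  maxid (iter n conj_place Q) t <-> maxid Q (iter n g t).
Proof.
elim: n t => // n IH t; rewrite iterS maxid_conj IH.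
by rewrite -iterSr.
Qed.

Lemma lies_over_cgam (Q P : place Y) : lies_over g Q P <-> P = conj_place Q.
Proof.
split; first by move=> H; apply: place_eq => t; rewrite H.
by move=> -> t.
Qed.

Lemma lies_over_conj (Q : place Y) (P : place X) : lies_over cp (conj_place Q) P <-> lies_over cp Q P.
Proof. by split=> H t; rewrite H vring_conj cgam_cpi. Qed.

Lemma lies_over_iter n (Q : place Y) (P : place X) : lies_over cp Q P ->
  lies_over cp (iter n conj_place Q) P.
Proof. by move=> H; elim: n => // n IH; rewrite iterS lies_over_conj. Qed.

Lemma lies_over_uniq (Q : place Y) (P P' : place X) : lies_over cp Q P -> lies_over cp Q P' -> P = P'.
Proof. by move=> H H'; apply: place_eq => t; rewrite H H'. Qed.

Lemma lies_over_maxid (Q : place Y) (P : place X) t : lies_over cp Q P -> maxid P t <-> maxid Q (cp t).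
Proof.
move=> H; rewrite /maxid -fmorphV; split=> -[Pt [H'|H']].
- by split; [rewrite -H|left; rewrite H' rmorph0].
- by split; [rewrite -H|right; rewrite -H].
- split; [by rewrite H|left; move/eqP: H'; rewrite fmorph_eq0 => /eqP //].
- by split; [rewrite H|right; rewrite H].
Qed.

(** Chevalley's theorem is applied to the images in Y of the valuation ring and the maximal ideal of
    [P]. An element outside the ring of [P] has its inverse in that ideal, so it cannot become
    integral. *)
Lemma lying_over (P : place X) : exists Q : place Y, lies_over cp Q P.
Proof.
have [x mx x0] := maxid_ex P.
pose B := [set z | exists2 t, vring P t & z = cp t]%classic.
pose I := [set z | exists2 t, maxid P t & z = cp t]%classic.
have [||||||Q [BQ IQ]] := @ex_place _ Y B I (cp x).
- split.
  + by exists 1; [exact: vring1|rewrite rmorph1].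
  + by move=> _ _ [t Pt ->] [s Ps ->]; exists (t - s); [exact: vring_sub|rewrite rmorphB].
  + by move=> _ _ [t Pt ->] [s Ps ->]; exists (t * s); [exact: vring_mul|rewrite rmorphM].
- split.
  + by exists 0; [exact: maxid0|rewrite rmorph0].
  + by move=> _ _ [t Pt ->] [s Ps ->]; exists (t - s); [exact: maxidB|rewrite rmorphB].
  + by move=> _ _ [t Pt ->] [s Ps ->]; exists (t * s); [exact: maxidM|rewrite rmorphM].
  + by move=> _ [t Pt ->]; exists t => //; apply: maxid_vring.
- move=> [t mt /eqP]; rewrite -(rmorph1 cp) (inj_eq (fmorph_inj _)) => /eqP t1.
  by rewrite -t1 in mt; apply: maxid_not1 mt.
- by move=> c; exists (cst X c); [exact: vring_cst|rewrite cpi_cst].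
- by exists x.
- by rewrite fmorph_eq0.
exists Q => t; split => [Pt|Qt]; first by apply: BQ; exists t.
apply: contrapT => nt; have mt := nvring_maxidV nt.
have t0 : t != 0 by apply/eqP => t0; apply: nt; rewrite t0; apply: vring0.
have : maxid Q (cp t^-1) by apply: IQ; exists t^-1.
by move=> /maxid_nunit/(_ Qt); rewrite -rmorphM mulVf // rmorph1.
Qed.

(** * Artin-Schreier generators and falling factorials *)

Section Generator.
Variable e : Y.
Hypothesis ge : g e = e + 1.

Lemma iter_ge n : iter n g e = e + n%:R.
Proof.
elim: n => [|n IH]; first by rewrite addr0.
by rewrite iterS IH rmorphD ge rmorph_nat -addrA -(natrD _ 1 n).
Qed.

Lemma AS_const : exists A, e ^+ p - e = cp A.
Proof.
have /cgam_fixed[A E] : g (e ^+ p - e) = e ^+ p - e.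
  rewrite rmorphB rmorphXn /= ge -!(pFrobenius_autE pcharY).
  by rewrite pFrobenius_autD_comm ?pFrobenius_aut1; [ring|apply: mulrC].
by exists A.
Qed.

(** Falling factorials of [e] replace its powers because [d] acts on them as d/de acts on powers;
    see [dif_falling]. *)
Definition falling n := \prod_(l < n) (e - l%:R).

Lemma fallingS n : falling n.+1 = falling n * (e - n%:R). Proof. by rewrite /falling big_ord_recr. Qed.

Lemma dif_falling n : d (falling n.+1) = n.+1%:R * falling n.
Proof.
rewrite /dif; suff -> : g (falling n.+1) = (e + 1) * falling n by rewrite fallingS; ring.
elim: n => [|n IH]; first by rewrite fallingS /falling !big_ord0 rmorphM rmorph1 rmorphB ge rmorph_nat; ring.
rewrite fallingS rmorphM IH rmorphB ge rmorph_nat fallingS; ring.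
Qed.

Lemma dif_cpiM x z : d (cp x * z) = cp x * d z.
Proof. by rewrite /dif rmorphM cgam_cpi mulrBr. Qed.

Lemma iter_dif_cpiM n x z : iter n d (cp x * z) = cp x * iter n d z.
Proof. by elim: n => // n IH; rewrite !iterS IH dif_cpiM. Qed.

Lemma dif_falling0 : d (falling 0) = 0.
Proof. by rewrite /dif /falling big_ord0 rmorph1 subrr. Qed.

Lemma iter_dif_falling n : iter n d (falling n) = n`!%:R.
Proof.
elim: n => [|n IH]; first by rewrite /falling big_ord0.
rewrite iterSr dif_falling -[n.+1%:R](rmorph_nat cp) iter_dif_cpiM IH rmorph_nat.
by rewrite -natrM factS.
Qed.

Lemma vring_falling_iter Q n m : vring Q e -> vring Q (iter m g (falling n)).
Proof.
move=> Qe; have natQ l : vring Q l%:R.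
  exact: vring_nat.
elim: n m => [|n IH] m.
  suff -> : iter m g (falling 0) = 1 by apply: vring1.
  by rewrite /falling big_ord0; elim: m => // m IH; rewrite iterS IH rmorph1.
rewrite fallingS iter_cgamM iter_cgamB iter_ge; apply: vring_mul => //.
have -> : iter m g n%:R = n%:R by elim: m => // m IHm; rewrite iterS IHm rmorph_nat.
by apply: vring_sub => //; apply: vringD.
Qed.

Lemma vring_iter_dif Q n m z : (forall l, vring Q (iter l g z)) ->
  vring Q (iter m g (iter n d z)).
Proof.
move=> Hz; elim: n m => // n IH m.
by rewrite iterS /dif iter_cgamB -iterSr; apply: vring_sub.
Qed.

(** Newton's interpolation: the top coefficient is the (n-1)-st difference of [z] divided by (n-1)!.
    This difference is invariant under [g], hence comes from X, and the factorial is invertible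
    because [n <= p]. *)
Lemma falling_expansion n z : (n <= p)%N -> iter n d z = 0 ->
  exists2 a : nat -> X, z = \sum_(i < n) cp (a i) * falling i &
    forall Q : place Y, vring Q e -> (forall m, vring Q (iter m g z)) ->
      forall i, (i < n)%N -> vring Q (cp (a i)).
Proof.
elim: n z => [|n IH] z np; first by move=> /= ->; exists (fun=> 0); rewrite ?big_ord0.
rewrite iterS => /eqP; rewrite subr_eq0 => /eqP/cgam_fixed[a Ea].
have [|b Eb Qb] := IH (z - cp (a / n`!%:R) * falling n) (ltnW np).
  rewrite (iter_difD gD) (iter_difN gD) iter_dif_cpiM iter_dif_falling Ea.
  rewrite rmorphM fmorphV rmorph_nat divfK ?subrr //.
  exact: factY_neq0.
have cpn x m : iter m g (cp x) = cp x.
  by elim: m => // m IHm; rewrite iterS IHm cgam_cpi.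
exists (fun i => if i == n then a / n`!%:R else b i).
  rewrite big_ord_recr /= eqxx.
  rewrite (eq_bigr (fun i : 'I_n => cp (b i) * falling i)).
    by rewrite -Eb subrK.
  by move=> i _; rewrite ltn_eqF.
move=> Q Qe Qz.
have Qa : vring Q (cp (a / n`!%:R)).
  rewrite rmorphM -Ea; apply: vring_mul; first exact: (vring_iter_dif n 0 Qz).
  have -> : cp (n`!%:R^-1) = cst Y n`!%:R^-1 by rewrite !fmorphV !rmorph_nat.
  exact: vring_cst.
move=> i; rewrite ltnS leq_eqVlt; case: eqP => //= _ ilt.
apply: Qb => // m; rewrite iter_cgamB iter_cgamM cpn.
by apply: vring_sub => //; apply: vring_mul => //; apply: vring_falling_iter.
Qed.

(* The additive form of Hilbert 90, with control of the poles. *)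
Lemma dif_surj z : iter p.-1 d z = 0 -> exists2 b, z = d b &
  forall Q : place Y, vring Q e -> (forall m, vring Q (iter m g z)) -> vring Q b.
Proof.
move=> /(falling_expansion (leq_pred p))[a za Qa].
(* A primitive is taken term by term; [i.+1] is invertible, being less than [p]. *)
exists (\sum_(i < p.-1) cp (a i / i.+1%:R) * falling i.+1).
    rewrite za (big_morph d (difD gD) (dif0 gD)); apply: eq_bigr => i _.
  rewrite dif_cpiM dif_falling rmorphM fmorphV rmorph_nat -mulrA mulKf //.
  by apply: natY_neq0; have := ltn_ord i; lia.
move=> Q Qe Qz; apply: vring_sum => i _.
apply: vring_mul; last exact: (vring_falling_iter i.+1 0 Qe).
rewrite rmorphM; apply: vring_mul; first exact: Qa.
have -> : cp (i.+1%:R^-1) = cst Y i.+1%:R^-1 by rewrite !fmorphV !rmorph_nat.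
exact: vring_cst.
Qed.

Lemma falling_expansionT z : exists a : nat -> X, z = \sum_(i < p) cp (a i) * falling i.
Proof.
by have [//||a za _] := @falling_expansion p z; [apply: dif_iter_p|exists a].
Qed.

(** If [e] had a pole, dividing e^p - e = A by e^p would write 1 as a sum of two elements of the
    maximal ideal. *)
Lemma vring_AS Q A : e ^+ p - e = cp A -> vring Q (cp A) -> vring Q e.
Proof.
move=> EA QA; apply: contrapT => ne; have me := nvring_maxidV ne.
have e0 : e != 0 by apply/eqP => e0; apply: ne; rewrite e0; apply: vring0.
apply: (@maxid_not1 _ _ Q).
have -> : 1 = e^-1 ^+ p.-1 + cp A * e^-1 ^+ p.
  have E : e * e^-1 ^+ p = e^-1 ^+ p.-1.
    by rewrite -{1}(prednK p0) exprS mulrA divff // mul1r.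
  by rewrite -EA mulrBl -exprMn divff // expr1n E; ring.
have mX n : maxid Q (e^-1 ^+ n.+1).
  by rewrite exprSr; apply: maxidM => //; apply/vringX/maxid_vring.
apply: maxidD; last by apply: maxidM => //; rewrite -(prednK p0).
by have := prime_gt1 pp; case: (p) => [|[|n]] //= _.
Qed.

Lemma vring_falling Q n : vring Q e -> vring Q (falling n).
Proof.
move=> Qe; apply: (big_ind (vring Q)); [exact: vring1|exact: vring_mul|].
by move=> i _; apply: vring_sub => //; apply: vring_nat.
Qed.

(** The point is properness. If all of X were integral at [Q], so would be [e] by [vring_AS], and
    then all of Y by the falling expansion. *)
Lemma restrict_place (Q : place Y) : exists P : place X, lies_over cp Q P.
Proof.
have prop : exists x, ~ vring Q (cp x).
  apply: contrapT => H.
  have {}H x : vring Q (cp x) by apply: contrapT => nx; apply: H; exists x.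
  have [A EA] := AS_const; have Qe := vring_AS EA (H A).
  have [z []] := vring_proper Q; have [a ->] := falling_expansionT z.
  apply: vring_sum => i _.
  by apply: vring_mul => //; apply: vring_falling.
pose O := [set x | vring Q (cp x)]%classic.
have Oc c : O (cst X c) by rewrite /O /= cpi_cst; apply: vring_cst.
have OB x z : O x -> O z -> O (x - z).
  by rewrite /O /= rmorphB; apply: vring_sub.
have OM x z : O x -> O z -> O (x * z).
  by rewrite /O /= rmorphM; apply: vring_mul.
have OV x : O x \/ O x^-1 by rewrite /O /= fmorphV; apply: vring_val.
by exists (Place Oc OB OM OV prop).
Qed.

End Generator.
End Cover.

(** * Shifts and division of polynomials *)

Section PolyShift.
Variable R : comNzRingType.
Implicit Types (f : {poly R}) (c : R).

Lemma coef_XaddC_exp c i :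
  [/\ (size (('X + c%:P) ^+ i)%R <= i.+1)%N, (('X + c%:P) ^+ i)`_i = 1
    & (('X + c%:P) ^+ i.+1)`_i = i.+1%:R * c].
Proof.
have H j : (size (('X + c%:P) ^+ j)%R <= j.+1)%N.
  have -> : 'X + c%:P = 'X - (- c)%:P by rewrite polyCN opprK.
  by rewrite size_exp_XsubC.
have H1 j : (('X + c%:P) ^+ j)`_j = 1.
  elim: j => [|j IH]; first by rewrite coef1.
  by rewrite exprSr mulrDr coefD coefMX coefMC /= IH (nth_default _ (H j)) mul0r addr0.
split => //; elim: i => [|i IH].
  by rewrite expr1 coefD coefX coefC add0r mul1r.
rewrite exprSr mulrDr coefD coefMX coefMC /= IH H1.
ring.
Qed.

(** Serves to lower the degree of a polynomial relation and to compute iterated finite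
    differences. *)
Lemma shift_coef f c n : (size f <= n.+2)%N ->
  (size (f \Po ('X + c%:P) - f)%R <= n.+1)%N /\
  (f \Po ('X + c%:P) - f)`_n = n.+1%:R * c * f`_n.+1.
Proof.
move=> sf; set q := 'X + c%:P.
have E m : (f \Po q)`_m = \sum_(i < n.+2) f`_i * (q ^+ i)`_m.
  rewrite /comp_poly (@horner_coef_wide _ n.+2); last exact: leq_trans (size_poly _ _) sf.
  by rewrite coef_sum; apply: eq_bigr => i _; rewrite coef_map mul_polyC coefZ.
have small i m : (i < m)%N -> (q ^+ i)`_m = 0.
  by move=> im; apply: nth_default; have [H _ _] := coef_XaddC_exp c i; apply: leq_trans H im.
split.
  apply/leq_sizeP => m nm; rewrite coefB E.
  have [->|nm'] := eqVneq m n.+1.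
    rewrite big_ord_recr big1 /= ?add0r => [|i _]; last by rewrite small ?mulr0.
    by have [_ -> _] := coef_XaddC_exp c n.+1; rewrite mulr1 subrr.
  have {}nm : (n.+2 <= m)%N by lia.
  rewrite big1 ?add0r ?nth_default ?oppr0 //; first exact: leq_trans sf nm.
  by move=> i _; rewrite small ?mulr0 //; have := ltn_ord i; lia.
rewrite coefB E big_ord_recr big_ord_recr big1 /= ?add0r => [|i _]; last by rewrite small ?mulr0.
have [_ -> ->] := coef_XaddC_exp c n; ring.
Qed.

Lemma monic_sizeP f n : size f = n.+1 -> f \is monic -> f`_n = 1.
Proof. by move=> sf /monicP; rewrite lead_coefE sf. Qed.

(** Division by a monic polynomial stays inside a subring; it will be used for the valuation ring of
    a place, which is only a subset of the field. *)
Lemma monic_division (S : set R) (h : {poly R}) : S 0 ->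
  (forall x y, S x -> S y -> S (x - y)) -> (forall x y, S x -> S y -> S (x * y)) ->
  h \is monic -> (forall i, S h`_i) ->
  forall f, (forall i, S f`_i) ->
  exists q r : {poly R}, [/\ forall i, S q`_i, forall i, S r`_i, f = q * h + r
    & (size r < size h)%N].
Proof.
move=> S0 SB SM hm Sh f; have [n] := ubnP (size f); elim: n f => // n IH f fn Sf.
have [fh|hf] := ltnP (size f) (size h).
  by exists 0, f; rewrite mul0r add0r; split => // i; rewrite coef0.
have f0 : f != 0.
  rewrite -size_poly_gt0; apply: leq_trans hf.
  by rewrite size_poly_gt0 monic_neq0.
pose t := lead_coef f *: 'X^(size f - size h).
have St i : S t`_i.
  by rewrite coefZ coefXn lead_coefE; case: eqP => _; rewrite ?mulr1 ?mulr0.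
have [|i|q [r [Sq Sr E rh]]] := IH (f - t * h).
- have sh : (0 < size h)%N by rewrite size_poly_gt0 monic_neq0.
  apply: leq_trans (_ : size f <= n)%N; last by rewrite -ltnS.
  have sf : (0 < size f)%N by rewrite size_poly_gt0.
  rewrite -[X in (_ < X)%N](prednK sf) ltnS; apply/leq_sizeP => i fi.
  rewrite coefB -scalerAl coefZ coefXnM.
  have -> : (i < size f - size h)%N = false by lia.
  have [->|ni] := eqVneq i (size f).-1.
    have -> : ((size f).-1 - (size f - size h) = (size h).-1)%N by lia.
    by rewrite -!lead_coefE (monicP hm) mulr1 subrr.
  have {}fi : (size f <= i)%N by rewrite -(prednK sf) ltn_neqAle eq_sym ni fi.
  rewrite !nth_default ?mulr0 ?subrr //.
  by move: fi hf; clear; move: (size f) (size h) => a b; lia.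
- rewrite coefB coefM; apply: (SB) => //; apply: (big_ind S) => //.
    by move=> x y Sx Sy; rewrite -[y]opprK -[- y]add0r; apply: (SB) => //; apply: (SB).
  by move=> j _; apply: SM.
exists (q + t), r; split => //.
  move=> i; rewrite coefD -[t`_i]opprK -[- t`_i]add0r.
  by apply: (SB) => //; apply: (SB).
by rewrite mulrDl addrAC -E subrK.
Qed.

End PolyShift.

Lemma prod_Fp (F : fieldType) (p : nat) (x : F) : p \in [pchar F] ->
  x ^+ p - x = \prod_(l < p) (x - l%:R).
Proof.
move=> pF; have pp := pcharf_prime pF; have p1 := prime_gt1 pp.
pose rs : seq F := [seq l%:R | l <- iota 0 p].
have szq : size ('X^p - 'X : {poly F}) = p.+1.
  by rewrite size_polyDl ?size_polyN ?size_polyX ?size_polyXn // ltnS.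
have E : 'X^p - 'X = \prod_(z <- rs) ('X - z%:P).
  have -> : 'X^p - 'X = lead_coef ('X^p - 'X : {poly F}) *: \prod_(z <- rs) ('X - z%:P).
    apply: all_roots_prod_XsubC.
    - by rewrite szq size_map size_iota.
    - apply/allP => _ /mapP[l _ ->].
      by rewrite rootE !hornerE -(pFrobenius_autE pF) pFrobenius_aut_nat subrr.
    - rewrite uniq_rootsE map_inj_in_uniq ?iota_uniq // => i j.
      rewrite !mem_iota !add0n /= => ip jp.
      wlog ij : i j ip jp / (i <= j)%N.
        by move=> W; have [/W|/ltnW/W H /esym/H] := leqP i j; [apply|move=> ->].
      move/eqP; rewrite eq_sym -subr_eq0 -natrB // -(dvdn_pcharf pF).
      have [->//|ne] := eqVneq i j.
      by move=> /dvdn_leq; lia.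
  rewrite lead_coefE szq /= coefB coefXn eqxx coefX; case: eqP => [p1'|_].
    by rewrite p1' in p1.
  by rewrite subr0 scale1r.
have := congr1 (fun q => q.[x]) E; rewrite !hornerE horner_prod => ->.
rewrite big_map -(big_mkord xpredT (fun l => x - l%:R)) /index_iota subn0.
by apply: eq_bigr => l _; rewrite !hornerE.
Qed.

(** * The cover above one place of X *)

Section LocalDescent.
Variables (k : fieldType) (p : nat) (pk : p \in [pchar k]).
Variables (X Y : curve k) (pi : galois_cover p X Y).
Local Notation g := (cgam pi).
Local Notation cp := (cpi pi).
Local Notation d := (dif g).

Let pp : prime p := pcharf_prime pk.
Let p0 : (0 < p)%N := prime_gt0 pp.

Lemma maxid_nat_unit (Q : place Y) n : (0 < n < p)%N -> ~ maxid Q n%:R.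
Proof.
move=> np /maxid_nunit/(_ (@vring_cst _ _ Q (n%:R)^-1)); apply.
have n0 : n%:R != 0 :> k.
  rewrite -(dvdn_pcharf pk); case/andP: np => n0 np.
  by apply/negP => /(dvdn_leq n0); rewrite leqNgt np.
by rewrite -(rmorph_nat (cst Y)) -rmorphM divff ?rmorph1.
Qed.

Lemma maxid_fact_unit (Q : place Y) n : (n < p)%N -> ~ maxid Q n`!%:R.
Proof.
elim: n => [|n IH] np; first exact: maxid_not1.
rewrite factS natrM => /(maxid_prime (vring_nat _ _) (vring_nat _ _)) [].
  by apply: maxid_nat_unit.
by apply: IH; apply: ltnW.
Qed.

Lemma maxid_natM (Q : place Y) n z : (0 < n < p)%N ->
  vring Q z -> maxid Q (n%:R * z) -> maxid Q z.
Proof.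
by move=> np Qz /(maxid_prime (vring_nat _ _) Qz) [/(maxid_nat_unit np)|].
Qed.

Section AtPlace.
Variable (P : place X).

Lemma vring_cp_horner Q (f : {poly X}) x : lies_over cp Q P ->
  (forall i, vring P f`_i) -> vring Q x -> vring Q (map_poly cp f).[x].
Proof.
move=> QP Pf Qx; apply: vring_horner => // i.
by rewrite coef_map -(QP f`_i).
Qed.

Lemma maxid_cp_horner Q (f : {poly X}) x : lies_over cp Q P ->
  (forall i, maxid P f`_i) -> vring Q x -> maxid Q (map_poly cp f).[x].
Proof.
move=> QP Pf Qx; rewrite horner_coef.
apply: maxid_sum => i _.
by rewrite coef_map mulrC; apply: maxidM; [apply: vringX|apply/(lies_over_maxid _ QP)].
Qed.

Section Root.
Variables (e : Y) (A : X).
Hypotheses (ge : g e = e + 1) (EA : e ^+ p - e = cp A).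

(* e = e^(p^n) + (an element of X), and e^(p^n) tends to 0 at Q. *)
Lemma approximation z : exists x : nat -> X, forall Q : place Y,
  lies_over cp Q P -> maxid Q e ->
  exists N, forall n, (N <= n)%N -> maxid Q (z - cp (x n)).
Proof.
have [a za] := falling_expansionT pk ge z.
pose Z : {poly X} := \sum_(i < p) a i *: \prod_(l < i) ('X - (l%:R)%:P).
have {za} zZ : z = (map_poly cp Z).[e].
  rewrite za rmorph_sum horner_sum; apply: eq_bigr => i _.
  rewrite /= map_polyZ hornerZ rmorph_prod horner_prod; congr (_ * _).
  by apply: eq_bigr => l _; rewrite rmorphB /= map_polyX map_polyC !hornerE /= rmorph_nat.
(* Iterated p-th powers are additive, so [g] also moves [e ^+ (p ^ n)] by 1 and the difference is
   invariant. *)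
have /choice[B HB] : forall n, exists B, e - e ^+ (p ^ n) = cp B.
  move=> n.
  suff /cgam_fixed : g (e - e ^+ (p ^ n)) = e - e ^+ (p ^ n) by [].
  rewrite rmorphB rmorphXn /= ge exprDn_pchar ?expr1n; first by ring.
  by rewrite (eq_pnat _ (pcharf_eq (pcharY pk Y))) pnatX pnat_id.
exists (fun n => Z.[B n]) => Q QP me.
have e0 : e != 0.
  by apply/eqP => e0; move: ge; rewrite e0 rmorph0 add0r => /esym/eqP; rewrite oner_eq0.
have Qe := maxid_vring me.
have /choice[N HN] i := place_archimedean (cp Z`_i) me e0.
exists (\max_(i < size Z) N i)%N.+1 => n Nn.
have -> : z - cp Z.[B n] =
    \sum_(i < size Z) cp Z`_i * (e ^+ i - (e - e ^+ (p ^ n)) ^+ i).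
  rewrite -horner_map -HB zZ !(@horner_coef_wide _ (size Z)) ?size_poly //.
  by rewrite -sumrB; apply: eq_bigr => i _; rewrite coef_map -mulrBr.
apply: maxid_sum => i _.
(* The difference of the i-th powers is divisible by [e ^+ (p ^ n)]. One factor [e] is set apart to
   land in the maximal ideal; the others absorb the coefficient. *)
rewrite subrXX opprB addrC subrK mulrA mulrC; apply: maxidM.
  apply: vring_sum => j _.
  apply: vring_mul; apply: vringX => //.
  by apply: vring_sub => //; apply: vringX.
have pn : (n < p ^ n)%N by apply: ltn_expl; apply: prime_gt1.
rewrite -(prednK (leq_ltn_trans (leq0n n) pn)) exprSr mulrA; apply: maxidM => //.
have Ni : (N i <= \max_(j < size Z) N j)%N by apply: (leq_bigmax i).
apply: HN; apply: leq_trans Ni _; move: Nn pn; clear.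
by move: (\max_(j < _) _)%N (p ^ n)%N => s t; lia.
Qed.

(** One element of X approximates [z] at both places, and its integrality is decided at [P]. *)
Lemma place_uniq (Q Q' : place Y) : lies_over cp Q P -> lies_over cp Q' P ->
  maxid Q e -> maxid Q' e -> Q = Q'.
Proof.
move=> QP QP' me me'; apply: place_eq => z.
have [x Hx] := approximation z.
have [N HN] := Hx _ QP me; have [N' HN'] := Hx _ QP' me'.
have /maxid_vring H := HN _ (leq_maxl N N').
have /maxid_vring H' := HN' _ (leq_maxr N N').
set c := x _ in H H'.
have tr (R : place Y) : vring R (z - cp c) -> vring R z <-> vring R (cp c).
  move=> HR; split=> Hz; last by rewrite -(subrK (cp c) z); apply: vringD.
  by rewrite -(subKr z (cp c)); apply: vring_sub.
by rewrite (tr _ H) (tr _ H') -QP -QP'.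
Qed.

(** The image of [A] is the product of the [e - l], and the maximal ideal at [Q] is prime. *)
Lemma conj_zero (Q : place Y) : maxid P A -> lies_over cp Q P ->
  exists l : nat, (l < p)%N /\ maxid Q (e - l%:R).
Proof.
move=> mA QP; have Qe : vring Q e.
  by apply: (vring_AS pk EA); apply/QP/maxid_vring.
have : maxid Q (\prod_(l < p) (e - l%:R)).
  by rewrite -prod_Fp ?EA; [apply/(lies_over_maxid _ QP)|apply: pcharY].
suff H n : (n <= p)%N -> maxid Q (\prod_(l < n) (e - l%:R)) ->
    exists l : nat, (l < p)%N /\ maxid Q (e - l%:R) by apply: H.
elim: n => [|n IH] np; first by rewrite big_ord0 => /maxid_not1.
rewrite big_ord_recr /= => /maxid_prime [||/(IH (ltnW np)) //|H].
- apply: (big_ind (vring Q)); [exact: vring1|exact: vring_mul|].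
  by move=> i _; apply: vring_sub => //; apply: vring_nat.
- by apply: vring_sub => //; apply: vring_nat.
by exists n.
Qed.

Section Relation.
Variable Q : place Y.
Hypotheses (QP : lies_over cp Q P) (PA : vring P A).
Hypothesis noroot : forall a, vring P a -> ~ maxid P (a ^+ p - a - A).

Let Qe : vring Q e.
Proof. by apply: (vring_AS pk EA); apply/QP. Qed.

(** An equation of degree [n] for the residue of [e] over the residue field of [P], lifted to the
    valuation ring. *)
Definition relation n := exists h : {poly X},
  [/\ h \is monic, size h = n.+1, forall i, vring P h`_i
    & maxid Q (map_poly cp h).[e]].

Lemma normalize_relation n (f : {poly X}) : (size f <= n.+1)%N ->
  (forall i, vring P f`_i) -> ~ maxid P f`_n -> maxid Q (map_poly cp f).[e] ->
  relation n.
Proof.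
move=> sf Pf nf mf; have f0 : f`_n != 0.
  by apply/eqP => E; apply: nf; rewrite E; apply: maxid0.
have szf : size f = n.+1.
  by apply/eqP; rewrite eqn_leq sf ltnNge; apply/negP => H; rewrite nth_default ?eqxx in f0.
have PV := vringV (Pf n) nf.
exists ((f`_n)^-1 *: f); split.
- by rewrite monicE lead_coefZ lead_coefE szf mulVf.
- by rewrite size_scale ?invr_eq0.
- by move=> i; rewrite coefZ; apply: vring_mul.
- by rewrite /= map_polyZ hornerZ; apply: maxidM => //; apply/QP.
Qed.

(** In terms of residue fields: in the absence of equations of degree less than [n], the first [n]
    powers of the residue of [e] are linearly independent. *)
Lemma no_relation_coef n (f : {poly X}) : (forall m, (m < n)%N -> ~ relation m) ->
  (size f <= n)%N -> (forall i, vring P f`_i) -> maxid Q (map_poly cp f).[e] ->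
  forall i, maxid P f`_i.
Proof.
move=> nrel; elim: n f nrel => [|n IH] f nrel sf Pf mf.
  move=> i; rewrite nth_default; first exact: maxid0.
  exact: leq_trans sf _.
have mn : maxid P f`_n.
  apply: contrapT => nf; apply: (nrel n) => //.
  exact: normalize_relation mf.
pose f' := f - f`_n *: 'X^n.
have cf' i : f'`_i = if i == n then 0 else f`_i.
  rewrite coefB coefZ coefXn; case: eqP => [->|_]; first by rewrite mulr1 subrr.
  by rewrite mulr0 subr0.
have H : forall i, maxid P f'`_i.
  apply: IH.
  - by move=> m mn'; apply: nrel; apply: ltnW.
  - apply/leq_sizeP => i ni; rewrite cf'; case: eqP => // ne.
    by rewrite nth_default //; apply: leq_trans sf _; rewrite ltn_neqAle ni andbT; apply/eqP => E; apply: ne.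
  - by move=> i; rewrite cf'; case: eqP => // _; apply: vring0.
  - rewrite rmorphB hornerD hornerN; apply: maxidB => //.
    rewrite /= map_polyZ map_polyXn hornerZ hornerXn mulrC; apply: maxidM.
      exact: vringX.
    by apply/(lies_over_maxid _ QP).
by move=> i; have := H i; rewrite cf'; case: eqP => // ->.
Qed.

(** The n-th finite difference of a polynomial of degree at most n is n! times its coefficient of
    degree n, and it is an integral combination of the values at x, ..., x + n. *)
Lemma finite_difference n (f : {poly X}) x : (size f <= n.+1)%N ->
  (forall j, (j <= n)%N -> maxid Q (map_poly cp f).[x + j%:R]) ->
  maxid Q (n`!%:R * cp f`_n).
Proof.
elim: n f => [|n IH] f sf Hf.
  have := Hf 0%N isT; rewrite (@horner_coef_wide _ 1) ?size_map_poly //.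
  by rewrite big_ord1 expr0 mulr1 coef_map mul1r.
have [sD cD] := shift_coef 1 sf.
have := IH _ sD; rewrite cD mulr1 !rmorphM rmorph_nat factS natrM.
rewrite [_.+1%:R * n`!%:R]mulrC mulrA; apply => j jn.
rewrite rmorphB /= map_comp_poly hornerD hornerN horner_comp.
rewrite rmorphD /= map_polyX map_polyC /= rmorph1 !hornerE.
apply: maxidB; last by apply: Hf; apply: leqW.
by rewrite -addrA natr1; apply: Hf.
Qed.

(* Let h be a monic relation of minimal degree n. The cofactor q of h in the
   Artin-Schreier polynomial 'X^p - 'X - A vanishes modulo Q at e + i for
   0 < i < p, because there h does not; as q is monic of degree p - n, this is
   possible only if n <= 1. *)
Lemma relation_root n : (n < p)%N -> ~ relation n.
Proof.
have [m] := ubnP n; elim: m n => // m IH [|[|n]] nm np.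
- move=> [h [hm sh Ph mh]]; have h1 : h = 1 by rewrite (size1_polyC (eq_leq sh)) (monic_sizeP sh hm).
  by move: mh; rewrite h1 rmorph1 hornerC; apply: maxid_not1.
(* In a relation of degree 1, minus the constant term is a root of the residual Artin-Schreier
   equation. *)
- move=> [h [hm sh Ph mh]]; apply: (noroot (vringN (Ph 0%N))).
  apply/(lies_over_maxid _ QP).
  have := mh; rewrite (@horner_coef_wide _ 2); last by rewrite size_map_poly sh.
  rewrite big_ord_recr big_ord1 /= !coef_map /= expr0 expr1 mulr1.
  rewrite (monic_sizeP sh hm) rmorph1 mul1r; set b := h`_0 => mb.
  rewrite !rmorphB rmorphXn rmorphN /= -EA.
  have -> : (- cp b) ^+ p - - cp b - (e ^+ p - e)
     = - ((cp b + e) ^+ p - (cp b + e)).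
    rewrite -!(pFrobenius_autE (pcharY pk Y)) pFrobenius_autN.
    rewrite pFrobenius_autD_comm; [ring|exact: mulrC].
  by apply: maxidN; apply: maxidB => //; apply: maxidX.
have nrel j : (j < n.+2)%N -> ~ relation j by move=> jn; apply: IH; lia.
move=> [h [hm sh Ph mh]].
(* Otherwise [h(X + i) - h(X)] would also vanish at [e]; its degree is one less than that of [h],
   and its leading coefficient (n + 2)i is a unit. *)
have h_shift i : (0 < i < p)%N -> ~ maxid Q (map_poly cp h).[e + i%:R].
  move=> ip mi; apply: (nrel n.+1) => //.
  have sh' : (size h <= n.+3)%N by rewrite sh.
  have [sD cD] := shift_coef i%:R sh'.
  apply: (normalize_relation sD).
  - move=> j; rewrite coefB; apply: vring_sub => //.
    rewrite coef_comp_poly; apply: vring_sum => l _.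
    apply: vring_mul => //.
    elim: (nat_of_ord l) j => [|s IHs] j.
      by rewrite expr0 coef1; apply: vring_nat.
    rewrite exprSr mulrDr coefD coefMX coefMC; apply: vringD.
      by case: ifP => // _; apply: vring0.
    by apply: vring_mul => //; apply: vring_nat.
  - rewrite cD (monic_sizeP sh hm) mulr1 -natrM => /(lies_over_maxid _ QP).
    rewrite rmorph_nat natrM => /maxid_natM H.
    by apply: (maxid_nat_unit ip); apply: H => //; apply: vring_nat.
  - rewrite rmorphB /= map_comp_poly hornerD hornerN horner_comp.
    rewrite rmorphD /= map_polyX map_polyC /= rmorph_nat !hornerE.
    by apply: maxidB.
pose AS : {poly X} := 'X^p - 'X - A%:P.
have p1 := prime_gt1 pp.
have szAS : size AS = p.+1.
  rewrite /AS -addrA size_polyDl ?size_polyXn // ltnS -opprD size_polyN.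
  by rewrite size_XaddC.
have PAS i : vring P AS`_i.
  rewrite /AS !coefB coefXn coefX coefC.
  apply: vring_sub; first by apply: vring_sub; apply: vring_nat.
  by case: eqP => // _; apply: vring0.
have AS_root i : (map_poly cp AS).[e + i%:R] = 0.
  rewrite /AS !rmorphB /= map_polyXn map_polyX map_polyC !hornerE /=.
  rewrite -(pFrobenius_autE (pcharY pk Y)) pFrobenius_autD_comm; last exact: mulrC.
  by rewrite pFrobenius_aut_nat pFrobenius_autE -EA; ring.
have [q [r [Pq Pr ASE sr]]] := monic_division (vring0 P) (@vring_sub _ _ P)
  (@vring_mul _ _ P) hm Ph PAS.
have Qi i : vring Q (e + i%:R) by apply: vringD => //; apply: vring_nat.
have evAS i : (map_poly cp q).[e + i%:R] * (map_poly cp h).[e + i%:R]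
    = - (map_poly cp r).[e + i%:R].
  by apply/eqP; rewrite -addr_eq0 -hornerM -hornerD -rmorphM -rmorphD -ASE AS_root.
(* [r] vanishes at [e] modulo [Q], and its degree is below the minimal one. *)
have mr : forall i, maxid P r`_i.
  apply: (no_relation_coef nrel) => //; first by rewrite sh in sr.
  have := evAS 0%N; rewrite !addr0 => /eqP; rewrite eq_sym eqr_oppLR => /eqP ->.
  by apply: maxidN; apply: maxidM => //; apply: vring_cp_horner.
have mq i : (0 < i < p)%N -> maxid Q (map_poly cp q).[e + i%:R].
  move=> ip; have : maxid Q ((map_poly cp q).[e + i%:R] * (map_poly cp h).[e + i%:R]).
    by rewrite evAS; apply: maxidN; apply: maxid_cp_horner.
  by move=> /maxid_prime [||//|/(h_shift _ ip)//]; apply: vring_cp_horner.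
have q0 : q != 0.
  apply/eqP => q0; move: ASE; rewrite q0 mul0r add0r => E.
  by move: sr; rewrite -E szAS sh; lia.
have szqh : size (q * h) = p.+1.
  have -> : q * h = AS - r by rewrite ASE addrK.
  by rewrite size_polyDl ?size_polyN szAS //; apply: leq_trans sr _; rewrite sh; lia.
have szq : size q = (p - n.+2).+1.
  by move: szqh; rewrite size_Mmonic // sh; lia.
have lq : q`_(p - n.+2) = 1.
  have : lead_coef (q * h) = 1.
    have -> : q * h = AS - r by rewrite ASE addrK.
    rewrite lead_coefDl; last by rewrite size_polyN szAS; apply: leq_trans sr _; rewrite sh; lia.
    rewrite lead_coefE szAS /= /AS !coefB coefXn eqxx coefX coefC.
    by case: (p) p1 => [|[|s]] //= _; rewrite !subr0.
  by rewrite lead_coef_Mmonic // lead_coefE szq.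
have sq' : (size q <= (p - n.+2).+1)%N by rewrite szq.
(* [q] has degree [p - n.+2], so its values at e + 1, ..., e + (p - n - 1) suffice; [mq] covers all
   these points. *)
have [|] := @finite_difference _ q (e + 1) sq' _.
  by move=> j jn; rewrite -addrA nat1r; apply: mq; lia.
rewrite lq rmorph1 mulr1 => m1 m2.
by apply: (@maxid_fact_unit Q (p - n.+2)); [lia|split].
Qed.

(** Provides a coefficient of largest absolute value at [P]. *)
Lemma max_coef n (a : nat -> X) i : (i < n)%N -> a i != 0 ->
  exists m, [/\ (m < n)%N, a m != 0 & forall j, (j < n)%N -> vring P (a j / a m)].
Proof.
elim: n i => // n IH i; rewrite ltnS leq_eqVlt.
have base : a n != 0 -> (forall j, (j < n)%N -> a j = 0) ->
    exists m, [/\ (m < n.+1)%N, a m != 0 & forall j, (j < n.+1)%N -> vring P (a j / a m)].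
  move=> an H; exists n; split => // j; rewrite ltnS leq_eqVlt => /orP[/eqP->|/H->].
    by rewrite divff //; apply: vring1.
  by rewrite mul0r; apply: vring0.
have [[l ln al] _ _|none] := pselect (exists2 l, (l < n)%N & a l != 0); last first.
  have H j : (j < n)%N -> a j = 0.
    by move=> jn; apply/eqP; apply: contrapT => /negP aj; apply: none; exists j.
  by move=> /orP[/eqP ->|/H ->]; [move=> an; apply: base|rewrite eqxx].
have [m [mn am Hm]] := IH _ ln al.
have [E|an] := eqVneq (a n) 0.
  exists m; split => //; first exact: ltnW.
  move=> j; rewrite ltnS leq_eqVlt => /orP[/eqP->|/Hm//].
  by rewrite E mul0r; apply: vring0.
have [H|H] := vring_val P (a n / a m).
  by exists m; split => //; [exact: ltnW|move=> j; rewrite ltnS leq_eqVlt => /orP[/eqP->|/Hm]].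
exists n; split => // j; rewrite ltnS leq_eqVlt => /orP[/eqP->|/Hm Hj].
  by rewrite divff //; apply: vring1.
have -> : a j / a n = (a j / a m) * (a n / a m)^-1 by field; rewrite an am.
exact: vring_mul.
Qed.

(** If some coefficient had a pole, dividing by one of largest absolute value would give a
    polynomial of degree less than [p] that vanishes at [e] modulo [Q], though one of its
    coefficients in the falling basis is 1. The powers of the residue of [e] being independent, this
    is absurd. *)
Lemma integral_coef (a : nat -> X) :
  vring Q (\sum_(i < p) cp (a i) * falling e i) -> forall i, (i < p)%N -> vring P (a i).
Proof.
move=> Hz i ip; apply: contrapT => nai.
have ai0 : a i != 0 by apply/eqP => E; apply: nai; rewrite E; apply: vring0.
have [m [mp am Hm]] := max_coef ip ai0.
have nam : ~ vring P (a m).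
  by move=> Pam; apply: nai; rewrite -(divfK am (a i)); apply: vring_mul => //; apply: Hm.
have mam := nvring_maxidV nam.
pose F n : {poly X} := \prod_(l < n) ('X - (l%:R)%:P).
have FS n : F n.+1 = F n * ('X - (n%:R)%:P) by rewrite /F big_ord_recr.
have sF n : size (F n) = n.+1 by rewrite /F -(big_mkord xpredT (fun l => 'X - (l%:R)%:P)) size_prod_XsubC size_iota subn0.
have mF n : F n \is monic by apply: monic_prod => l _; apply: monicXsubC.
have PF n l : vring P (F n)`_l.
  elim: n l => [|n IH] l; first by rewrite /F big_ord0 coef1; apply: vring_nat.
  rewrite FS mulrBr coefB coefMX coefMC; apply: vring_sub.
    by case: ifP => // _; apply: vring0.
  by apply: vring_mul => //; apply: vring_nat.
have eF n : (map_poly cp (F n)).[e] = falling e n.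
  rewrite /F rmorph_prod horner_prod; apply: eq_bigr => l _.
  by rewrite rmorphB /= map_polyX map_polyC !hornerE /= rmorph_nat.
pose b j := a j / a m.
pose f := \sum_(j < p) b j *: F j.
have mf : maxid Q (map_poly cp f).[e].
  have -> : (map_poly cp f).[e] = (\sum_(i < p) cp (a i) * falling e i) * cp (a m)^-1.
    rewrite /f rmorph_sum horner_sum mulr_suml; apply: eq_bigr => j _.
    by rewrite /= map_polyZ hornerZ eF rmorphM mulrAC.
  by apply: maxidM => //; apply/(lies_over_maxid _ QP).
have sf : (size f <= p)%N.
  apply: leq_trans (size_sum _ _ _) _; apply/bigmax_leqP => j _.
  by apply: leq_trans (size_scale_leq _ _) _; rewrite sF.
have Pf l : vring P f`_l.
  rewrite coef_sum; apply: vring_sum => j _.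
  by rewrite coefZ; apply: vring_mul => //; apply: Hm.
have mall := no_relation_coef relation_root sf Pf mf.
(* Descending induction from the top degree: [F j] is monic of degree [j], so the passage between
   falling factorials and powers is triangular. *)
have mb s j : (j < p)%N -> (p - s <= j)%N -> maxid P (b j).
  elim: s j => [|s IH] j jp; first by rewrite subn0 leqNgt jp.
  rewrite leq_eqVlt => /orP[/eqP E|H]; last by apply: IH => //; lia.
  have := mall j; rewrite coef_sum (bigD1 (Ordinal jp)) //= coefZ => H.
  have -> : b j = (b j * (F j)`_j + \sum_(l < p | l != Ordinal jp) (b l *: F l)`_j)
     - \sum_(l < p | l != Ordinal jp) (b l *: F l)`_j.
    by rewrite addrK (monic_sizeP (sF j) (mF j)) mulr1.
  apply: maxidB => //; apply: maxid_sum => l lj.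
  rewrite coefZ; have [lj'|jl] := ltnP l j.
    by rewrite nth_default ?mulr0 ?sF //; apply: maxid0.
  rewrite mulrC; apply: maxidM => //; apply: IH => //.
  have : (nat_of_ord l != j) by apply: contra lj => /eqP E'; apply/eqP/val_inj.
  by move: jl E; lia.
have := @mb p m mp; rewrite subnn /b divff // => /(_ isT).
exact: maxid_not1.
Qed.

End Relation.
End Root.
End AtPlace.
End LocalDescent.

(** For repartitions, equality of classes in H^1(Z, O_Z). *)
Definition coh (k : fieldType) (Z : curve k) (a b : place Z -> Z) :=
  exists h, forall P, vring P (a P - b P - h).

(** * Descent of invariant repartitions from Y to X *)

Section Descent.
Variables (k : fieldType) (p : nat) (pk : p \in [pchar k]).
Variables (X Y : curve k) (pi : galois_cover p X Y).
Local Notation g := (cgam pi).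
Local Notation cp := (cpi pi).
Local Notation d := (dif g).
Local Notation cj := (conj_place pk pi).
Variables (eta : place X -> X) (y : Y).
Hypotheses (gy : g y = y + 1).
Hypothesis feta : repartition eta.
Hypothesis eta_y : forall Q P, lies_over cp Q P -> vring Q (y - cp (eta P)).

Let pp : prime p := pcharf_prime pk.
Let p0 : (0 < p)%N := prime_gt0 pp.
Let gD : forall u v : Y, g (u + v) = g u + g v. Proof. exact: rmorphD. Qed.

(** The pull back of a family by the automorphism of Y with comorphism [g]: the place at which [v]
    is read moves as well. *)
Definition conj_fam (v : place Y -> Y) : place Y -> Y :=
  fun Q => g (v (cj Q)).

Lemma conj_fam_iter (w : place Y -> Y) n Q :
  (forall Q, vring Q (conj_fam w Q - w Q)) ->
  vring Q (iter n g (w (iter n cj Q)) - w Q).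
Proof.
move=> Hw; elim: n => [|n IH]; first by rewrite subrr; apply: vring0.
rewrite -(subrK (iter n g (w (iter n cj Q)))
  (iter n.+1 g (w (iter n.+1 cj Q)))) -addrA; apply: vringD => //.
rewrite iterSr -iter_cgamB -(vring_iter_conj pk); exact: Hw.
Qed.

(* The residual Artin-Schreier equation of the cover at P either has a root,
   and then P splits, or is irreducible. *)
Lemma fibre_cases (P : place X) :
  (exists e A, [/\ g e = e + 1, e ^+ p - e = cp A & maxid P A]) \/
  (exists e, [/\ g e = e + 1, forall Q, lies_over cp Q P -> vring Q e,
    (forall (Q : place Y) (a : nat -> X), lies_over cp Q P ->
      vring Q (\sum_(i < p) cp (a i) * falling e i) <->
      forall i, (i < p)%N -> vring P (a i))
    & forall Q Q', lies_over cp Q P -> lies_over cp Q' P -> Q = Q']).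
Proof.
have [Q0 QP0] := lying_over pi P.
pose e := y - cp (eta P).
have ge : g e = e + 1 by rewrite rmorphB gy cgam_cpi /e; ring.
have [A EA] := AS_const pk ge.
have Qe Q : lies_over cp Q P -> vring Q e by apply: eta_y.
have PA : vring P A.
  apply/QP0; rewrite -EA; have := Qe _ QP0 => Qe0.
  by apply: vring_sub => //; apply: vringX.
have [[a Pa ma]|noroot'] := pselect (exists2 a, vring P a & maxid P (a ^+ p - a - A)).
  (* Subtracting the root [a] from [e] leads to a residual equation with root 0. *)
  left; exists (e - cp a), (A - (a ^+ p - a)); split.
  - by rewrite rmorphB ge cgam_cpi; ring.
  - rewrite !rmorphB rmorphXn /= -EA -!(pFrobenius_autE (pcharY pk Y)).
    by rewrite pFrobenius_autB_comm; [ring|exact: mulrC].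
  - by rewrite -opprB; apply: maxidN.
right; exists e.
have noroot a : vring P a -> ~ maxid P (a ^+ p - a - A).
  by move=> Pa ma; apply: noroot'; exists a.
have intP (Q : place Y) (a : nat -> X) : lies_over cp Q P ->
    vring Q (\sum_(i < p) cp (a i) * falling e i) <-> forall i, (i < p)%N -> vring P (a i).
  move=> QP; split; first exact: (integral_coef pk EA QP PA noroot).
  move=> Pa; apply: vring_sum => i _.
  apply: vring_mul; first by apply/QP; apply: Pa.
  by apply: vring_falling; apply: Qe.
split => // Q Q' QP QP'; apply: place_eq => z; have [a ->] := falling_expansionT pk ge z.
by rewrite (intP _ _ QP) (intP _ _ QP').
Qed.

(** If [e] reduces to [j] at [Q], then [p - j] conjugations bring it to 0. *)
Lemma conj_to_zero (P : place X) e A (Q : place Y) : g e = e + 1 ->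
  e ^+ p - e = cp A -> maxid P A -> lies_over cp Q P ->
  exists n, maxid (iter n cj Q) e.
Proof.
move=> ge EA mA QP; have [j [jp mj]] := conj_zero pk EA mA QP.
exists (p - j)%N; rewrite (maxid_iter_conj pk) (iter_ge ge) natrB ?(ltnW jp) //.
by rewrite (pcharf0 (pcharY pk Y)) sub0r.
Qed.

Lemma fibre_transitive (P : place X) (Q Q' : place Y) :
  lies_over cp Q P -> lies_over cp Q' P ->
  exists n, iter n cj Q = Q'.
Proof.
move=> QP QP'; have [[e [A [ge EA mA]]]|[e [_ _ _ H]]] := fibre_cases P; last first.
  by exists 0%N; apply: H.
have [n mn] := conj_to_zero ge EA mA QP; have [n' mn'] := conj_to_zero ge EA mA QP'.
have E := place_uniq pk ge (lies_over_iter pk n QP) (lies_over_iter pk n' QP') mn mn'.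
(* Conjugating [n' * p.-1] more times undoes [n'] conjugations, because [iter p cj] is the
   identity. *)
exists (n' * p.-1 + n)%N; rewrite iterD E -iterD.
rewrite -[X in (_ + X)%N]muln1 -mulnDr addn1 prednK //.
by elim: n' {E mn'} => // m IH; rewrite mulSn iterD IH iter_conj_p.
Qed.

Lemma orbit_finite (B : set (place Y)) : finite_set B ->
  finite_set [set Q | exists n, B (iter n cj Q)].
Proof.
move=> fB.
apply: sub_finite_set (bigcup_finite (finite_II p)
  (fun m _ => finite_image (iter m cj) fB)) => Q /= [n Bn].
have iterM q m R : iter (m + q * p) cj R = iter m cj R.
  by elim: q => [|q IH]; rewrite ?addn0 // mulSn addnCA iterD iter_conj_p.
(* Here too [n * p.-1] stands for minus [n] modulo [p]. *)
exists ((n * p.-1) %% p)%N => /=; first by rewrite ltn_mod.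
exists (iter n cj Q) => //.
rewrite -(iterM ((n * p.-1) %/ p)%N) addnC -divn_eq -iterD.
rewrite -[X in (_ + X)%N]muln1 -mulnDr addn1 prednK //.
by rewrite -[(n * p)%N]add0n iterM.
Qed.

Lemma local_descent (w : place Y -> Y) (P : place X) :
  (forall Q, vring Q (conj_fam w Q - w Q)) ->
  exists x, forall Q, lies_over cp Q P -> vring Q (w Q - cp x).
Proof.
move=> Hw; have [Q1 QP1] := lying_over pi P.
have [[e [A [ge EA mA]]]|[e [ge Qe intP uniq]]] := fibre_cases P.
  have [n1 m0] := conj_to_zero ge EA mA QP1.
  set Q0 := iter _ _ _ in m0; have QP0 : lies_over cp Q0 P by apply: lies_over_iter.
  have [x Hx] := approximation pk P ge (w Q0).
  have [N HN] := Hx _ QP0 m0; exists (x N) => Q QP.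
  have [n mQ'] := conj_to_zero ge EA mA QP.
  set Q' := iter _ _ _ in mQ'; have QP' : lies_over cp Q' P by apply: lies_over_iter.
  have E : Q' = Q0 by apply: (place_uniq pk ge QP' QP0).
  (* [x N] is invariant and [w] is invariant up to integral elements, so the estimate at [Q0] is
     carried to [Q] by conjugation. *)
  have -> : w Q - cp (x N) = iter n g (w Q0 - cp (x N)) - (iter n g (w Q0) - w Q).
    rewrite iter_cgamB.
    have -> : iter n g (cp (x N)) = cp (x N).
      by elim: n {Q' QP' mQ' E} => // n IH; rewrite iterS IH cgam_cpi.
    ring.
  apply: vring_sub; last by rewrite -E; apply: conj_fam_iter.
  rewrite -(vring_iter_conj pk) -/Q' E; apply: maxid_vring; exact: HN.
have [a wa] := falling_expansionT pk ge (w Q1).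
exists (a 0%N) => Q QP; rewrite (uniq _ _ QP QP1).
have EQ1 : cj Q1 = Q1 by apply: uniq => //; apply/lies_over_conj.
have dw : vring Q1 (d (w Q1)) by have := Hw Q1; rewrite /conj_fam EQ1.
(* The coefficients of [d (w Q1)]: a difference shifts the indices down by one, hence the 0 in the
   top place. *)
pose b i := if (i < p.-1)%N then a i.+1 * i.+1%:R else 0.
have Ep : p = p.-1.+1 by rewrite prednK.
have L (F : nat -> Y) : \sum_(i < p) F i = F 0%N + \sum_(i < p.-1) F i.+1.
  by rewrite [in LHS]Ep big_ord_recl.
have R (F : nat -> Y) : \sum_(i < p) F i = \sum_(i < p.-1) F i + F p.-1.
  by rewrite [in LHS]Ep big_ord_recr.
have Edw : d (w Q1) = \sum_(i < p) cp (b i) * falling e i.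
  rewrite wa (big_morph d (difD gD) (dif0 gD)).
  rewrite (L (fun i => d (cp (a i) * falling e i))) (R (fun i => cp (b i) * falling e i)).
  rewrite dif_cpiM dif_falling0 mulr0 add0r /b ltnn rmorph0 mul0r addr0.
  apply: eq_bigr => i _; rewrite dif_cpiM (dif_falling ge) ltn_ord rmorphM rmorph_nat.
  by rewrite mulrA.
have Pa i : (0 < i < p)%N -> vring P (a i).
  case: i => // i /andP[_ ip].
  have := dw; rewrite Edw (intP _ _ QP1) => /(_ i (ltnW ip)).
  rewrite /b; have -> : (i < p.-1)%N by lia.
  rewrite mulrC => H; apply: (vring_unit_eq _ _ H); first exact: vring_nat.
  move=> m; have := maxid_nat_unit pk (Q := Q1) (n := i.+1); apply; first by rewrite ip.
  by rewrite -(rmorph_nat cp); apply/(lies_over_maxid _ QP1).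
have -> : w Q1 - cp (a 0%N) = \sum_(i < p) cp (if (i == 0 :> nat)%N then 0 else a i) * falling e i.
  rewrite wa (L (fun i => cp (a i) * falling e i)).
  rewrite (L (fun i => cp (if (i == 0)%N then 0 else a i) * falling e i)).
  by rewrite /= rmorph0 mul0r add0r /falling big_ord0 mulr1 addrAC subrr add0r.
apply/(intP _ (fun i => if (i == 0)%N then 0 else a i) QP1) => -[|i] ip /=.
  exact: vring0.
by apply: Pa.
Qed.

(** [x] can have a pole at [P] only if [w] has one at the places above [P], so the finiteness of the
    set of poles is inherited. *)
Lemma descent (w : place Y -> Y) : repartition w ->
  (forall Q, vring Q (conj_fam w Q - w Q)) ->
  exists2 x : place X -> X, repartition x &
    forall Q P, lies_over cp Q P -> vring Q (w Q - cp (x P)).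
Proof.
move=> fw Hw; have /choice[x Hx] := fun P => @local_descent w P Hw.
exists x; last by move=> Q P; apply: Hx.
have /choice[r Hr] := fun Q => restrict_place pk gy Q.
apply: sub_finite_set (finite_image r fw) => P /= nP.
have [Q QP] := lying_over pi P; exists Q; last exact: (lies_over_uniq (Hr Q) QP).
move=> /= Qw; apply: nP; apply/QP; rewrite -(subKr (w Q) (cp (x P))).
by apply: vring_sub => //; apply: Hx.
Qed.

(** The difference of [h] has no poles, so it is a constant [c], and [h - c y] comes from X. Thus
    only multiples of [eta] in H^1(X, O_X) can vanish on Y. *)
Lemma pullback_kernel (x : place X -> X) h :
  (forall Q P, lies_over cp Q P -> vring Q (cp (x P) - h)) ->
  exists c, coh x (fun P => cst X c * eta P).
Proof.
move=> Hx; have /integral_const[c Ec] (Q : place Y) : vring Q (d h).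
  have [P QP] := restrict_place pk gy Q.
  have H1 := Hx _ _ QP; have := Hx (cj Q) P.
  rewrite lies_over_conj => /(_ QP); rewrite vring_conj rmorphB cgam_cpi => H2.
  have -> : d h = (cp (x P) - h) - (cp (x P) - g h) by rewrite /dif; ring.
  exact: vring_sub.
exists c; have /cgam_fixed[b Eb] : g (h - cst Y c * y) = h - cst Y c * y.
  rewrite rmorphB rmorphM cgam_cst gy; move/eqP: Ec; rewrite subr_eq => /eqP ->; ring.
exists b => P; have [Q QP] := lying_over pi P; apply/QP.
rewrite !rmorphB rmorphM cpi_cst -Eb.
have -> : cp (x P) - cst Y c * cp (eta P) - (h - cst Y c * y)
  = (cp (x P) - h) + cst Y c * (y - cp (eta P)) by ring.
apply: vringD; first exact: Hx.
by apply: vring_mul; [exact: vring_cst|exact: eta_y].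
Qed.

(* If the second difference of v is the constant c up to integral elements,
   then the (p - 2)-nd difference of c has no poles, and so c itself is a
   difference, by which v can be corrected. *)
Lemma dif_descent (v : place Y -> Y) : repartition v ->
  coh (dif conj_fam (dif conj_fam v)) 0 ->
  exists2 x : place X -> X, repartition x &
    exists b, forall Q P, lies_over cp Q P ->
      vring Q (dif conj_fam v Q - cp (x P) - b).
Proof.
move=> fv [c Hc].
have cD (u u' : place Y -> Y) : conj_fam (u + u') = conj_fam u + conj_fam u'.
  by apply/funext => Q; rewrite /conj_fam /= rmorphD.
have iter_conj n u Q : iter n conj_fam u Q = iter n g (u (iter n cj Q)).
  by elim: n Q => // n IH Q; rewrite iterS /conj_fam IH -iterSr.
have dp u : iter p (dif conj_fam) u = 0.
  apply: (iter_dif_p cD) => //.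
    move=> v'; apply/funext => Q; rewrite natmulfctE.
    by rewrite -mulr_natr (pcharf0 (pcharY pk Y)) mulr0.
  by move=> v'; apply/funext => Q; rewrite iter_conj cgam_order iter_conj_p.
have dint n u : (forall Q, vring Q (u Q)) -> forall Q, vring Q (iter n (dif conj_fam) u Q).
  move=> Hu; elim: n => // n IH Q; rewrite iterS; apply: vring_sub => //.
  rewrite -(vring_conj pk); exact: IH.
have dconst n (z : Y) : iter n (dif conj_fam) (fun=> z) = fun=> iter n d z.
  by elim: n => // n IH; rewrite iterS IH; apply/funext.
pose h := dif conj_fam (dif conj_fam v) - (fun=> c).
have Hh Q : vring Q (h Q) by have := Hc Q; rewrite subr0.
have p2 : (p.-2.+2 = p)%N by have := prime_gt1 pp; case: (p) => [|[]].
(* The vanishing of the p-th difference of [v] is split along [h] and [c]. *)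
have E0 : iter p.-2 (dif conj_fam) h + iter p.-2 (dif conj_fam) (fun=> c) = 0.
  by rewrite -(iter_difD cD) subrK -!iterSr p2 dp.
have /integral_const[c' Ec'] (Q : place Y) : vring Q (iter p.-2 d c).
  have := congr1 (fun u => u Q) E0; rewrite dconst => /eqP.
  rewrite addrfctE addr_eq0 eq_sym eqr_oppLR => /eqP ->.
  by apply: vringN; apply: dint.
(* [c'] is a constant, so one more difference of [c] is zero and Hilbert 90 applies. *)
have [|b Eb Qb] := dif_surj pk gy (z := c).
  have -> : p.-1 = p.-2.+1 by rewrite -[in LHS]p2.
  by rewrite iterS Ec' /dif cgam_cst subrr.
have [|Q|x rx Hx] := @descent (dif conj_fam v - (fun=> b)).
(* Poles occur only in the orbits of the poles of [v] and of one place above each pole of [eta]: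
   elsewhere [y] and all conjugates of [c] are integral, hence so is [b]. *)
- pose bad : set (place Y) := [set Q | ~ vring Q (v Q)]%classic.
  have /choice[r Hr] := fun Q => restrict_place pk gy Q.
  have /choice[s Hs] := fun P => lying_over pi P.
  pose bad' : set (place Y) := [set s P | P in [set P | ~ vring P (eta P)]]%classic.
  have f1 : finite_set bad' by apply: finite_image.
  have f2 : finite_set (bad `|` bad')%classic by rewrite finite_setU.
  apply: sub_finite_set (orbit_finite f2) => Q /= nQ; apply: contrapT => H; apply: nQ.
  have vn n : vring (iter n cj Q) (v (iter n cj Q)).
    by apply: contrapT => nv; apply: H; exists n; left.
  have Qy : vring Q y.
    rewrite -(subrK (cp (eta (r Q))) y); apply: vringD; first exact: eta_y.
    apply/(Hr Q); apply: contrapT => ne; apply: H.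
    have [n En] := fibre_transitive (Hr Q) (Hs (r Q)).
    by exists n; right; exists (r Q).
  have dv m n : vring (iter n cj Q)
      (iter m (dif conj_fam) v (iter n cj Q)).
    elim: m n => // m IH n; rewrite iterS; apply: vring_sub => //.
    rewrite /conj_fam -(vring_conj pk) -iterS; exact: IH.
  apply: vring_sub; first exact: (dv 1%N 0%N).
  apply: Qb => // n; rewrite -(vring_iter_conj pk).
  rewrite -(subKr (dif conj_fam (dif conj_fam v) (iter n cj Q)) c).
  by apply: vring_sub; [exact: (dv 2%N n)|exact: Hh].
- have -> : conj_fam (dif conj_fam v - (fun=> b)) Q - (dif conj_fam v - (fun=> b)) Q = h Q.
    rewrite /h Eb -[_ - _ in LHS]/(dif conj_fam (dif conj_fam v - (fun=> b)) Q).
    by rewrite (difD cD) (difN cD).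
  exact: Hh.
exists x => //; exists b => Q P QP.
by have := Hx _ _ QP; rewrite -addrA [- b + _]addrC addrA.
Qed.

End Descent.

(** * p-th powers and classes of cochains *)

Section Frobenius.
Variables (R : comNzRingType) (p : nat) (pR : p \in [pchar R]).
Lemma pexpD (x y : R) : (x + y) ^+ p = x ^+ p + y ^+ p.
Proof. by rewrite exprDn_pchar // pnatE ?(pcharf_prime pR). Qed.
Lemma pexpN (x : R) : (- x) ^+ p = - x ^+ p.
Proof. by rewrite -!(pFrobenius_autE pR) pFrobenius_autN. Qed.
Lemma pexpB (x y : R) : (x - y) ^+ p = x ^+ p - y ^+ p.
Proof. by rewrite pexpD pexpN. Qed.
End Frobenius.

Lemma pexp_inj (F : fieldType) (p : nat) : p \in [pchar F] ->
  injective (fun x : F => x ^+ p).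
Proof.
move=> pF x y /= /eqP; rewrite -subr_eq0 -(pexpB pF) expf_eq0 subr_eq0.
by move=> /andP[_ /eqP].
Qed.

Section Cochains.
Variables (k : fieldType) (p : nat) (pk : p \in [pchar k]) (Z : curve k).
Implicit Types (a b c : place Z -> Z) (z : cochain Z).

Let pZ : p \in [pchar Z]. Proof. by rewrite (fmorph_pchar (cst Z)). Qed.

Lemma coh_refl a : coh a a.
Proof. by exists 0 => P; rewrite subrr subr0; apply: vring0. Qed.

Lemma coh_sym a b : coh a b -> coh b a.
Proof.
move=> [h H]; exists (- h) => P.
have -> : b P - a P - - h = - (a P - b P - h) by ring.
exact: vringN.
Qed.

Lemma coh_trans b a c : coh a b -> coh b c -> coh a c.
Proof.
move=> [h H] [h' H']; exists (h + h') => P.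
have -> : a P - c P - (h + h') = (a P - b P - h) + (b P - c P - h') by ring.
exact: vringD.
Qed.

Lemma coh_add a a' b b' : coh a a' -> coh b b' ->
  coh (fun P => a P + b P) (fun P => a' P + b' P).
Proof.
move=> [h H] [h' H']; exists (h + h') => P.
have -> : a P + b P - (a' P + b' P) - (h + h')
  = (a P - a' P - h) + (b P - b' P - h') by ring.
exact: vringD.
Qed.

Lemma coh_scale u a b : coh a b ->
  coh (fun P => cst Z u * a P) (fun P => cst Z u * b P).
Proof.
move=> [h H]; exists (cst Z u * h) => P.
rewrite -!mulrBr; apply: vring_mul => //; exact: vring_cst.
Qed.

Lemma coh_pow a b : coh a b -> coh (fun P => a P ^+ p) (fun P => b P ^+ p).
Proof.
by move=> [h H]; exists (h ^+ p) => P; rewrite -!(pexpB pZ); apply: vringX.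
Qed.

Lemma coh0 a : (forall P, a P = 0) -> coh a (fun=> 0).
Proof. by move=> H; exists 0 => P; rewrite H !subr0; apply: vring0. Qed.

Lemma cohom_coh z z' : cohom z z' -> coh z.2 z'.2.
Proof. by move=> [h [_ H]]; exists h. Qed.

Let D := (curve_omega Z).1.

Lemma ddD (x y : Z) : dd (x + y) = dd x + dd y. Proof. by case: D. Qed.
Lemma ddM (x y : Z) : dd (x * y) = x *: dd y + y *: dd x. Proof. by case: D. Qed.
Lemma dd_cst u : dd (cst Z u) = 0. Proof. by case: D. Qed.
Lemma dd0 : dd (0 : Z) = 0. Proof. by rewrite -(rmorph0 (cst Z)) dd_cst. Qed.
Lemma ddN (x : Z) : dd (- x) = - dd x.
Proof. by apply: (addIr (dd x)); rewrite -ddD !addNr dd0. Qed.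
Lemma ddZ u (x : Z) : dd (cst Z u * x) = cst Z u *: dd x.
Proof. by rewrite ddM dd_cst scaler0 addr0. Qed.

Lemma dd_pow (x : Z) : dd (x ^+ p) = 0.
Proof.
have H n : dd (x ^+ n.+1) = (n.+1%:R * x ^+ n) *: dd x.
  elim: n => [|n IH]; first by rewrite expr1 expr0 mulr1 scale1r.
  rewrite exprS ddM IH scalerA -scalerDl; congr (_ *: _).
  by rewrite exprS; ring.
have := prime_gt0 (pcharf_prime pZ); have := pcharf0 pZ.
by case: (p) => // n E _; rewrite H E mul0r scale0r.
Qed.

Lemma cohom_sym z z' : cohom z z' -> cohom z' z.
Proof.
move=> [h [E H]]; exists (- h); split.
  by rewrite ddN -E /= opprB.
move=> P /=; have -> : z'.2 P - z.2 P - - h = - (z.2 P - z'.2 P - h) by ring.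
exact: vringN.
Qed.

Lemma cohom_trans z' z z'' : cohom z z' -> cohom z' z'' -> cohom z z''.
Proof.
move=> [h [E H]] [h' [E' H']]; exists (h + h'); split.
  by rewrite ddD -E -E' /= addrA subrK.
move=> P /=; have -> : z.2 P - z''.2 P - (h + h')
  = (z.2 P - z'.2 P - h) + (z'.2 P - z''.2 P - h') by ring.
exact: vringD.
Qed.

(** [frob p z] is [frob_chain z.2]: the Frobenius of a cochain depends on its repartition only. *)
Definition frob_chain a : cochain Z := (0, fun P => a P ^+ p).

(** The Frobenius of H^1_dR factors through H^1(Z, O_Z), because d(h^p) = 0. *)
Lemma cohom_frob a b : coh a b -> cohom (frob_chain a) (frob_chain b).
Proof.
move=> [h H]; exists (h ^+ p); split; first by rewrite dd_pow /= subr0.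
by move=> P /=; rewrite -!(pexpB pZ); apply: vringX.
Qed.

Lemma cohom_frob0 a : coh a (fun=> 0) -> cohom (frob_chain a) (ch0 Z).
Proof.
move=> /cohom_frob; congr (cohom _ _); congr (_, _); apply/funext => P.
by rewrite expr0n; case: p (prime_gt0 (pcharf_prime pZ)).
Qed.

Lemma cohom_add z1 z1' z2 z2' : cohom z1 z1' -> cohom z2 z2' ->
  cohom (chadd z1 z2) (chadd z1' z2').
Proof.
move=> [h [E H]] [h' [E' H']]; exists (h + h'); split.
  by rewrite ddD -E -E' /= opprD addrACA.
move=> P /=; have -> : z1.2 P + z2.2 P - (z1'.2 P + z2'.2 P) - (h + h')
  = (z1.2 P - z1'.2 P - h) + (z2.2 P - z2'.2 P - h') by ring.
exact: vringD.
Qed.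

Lemma cohom_scale u z z' : cohom z z' -> cohom (chscale u z) (chscale u z').
Proof.
move=> [h [E H]]; exists (cst Z u * h); split.
  by rewrite ddZ -E /= scalerBr.
by move=> P /=; rewrite -!mulrBr; apply: vring_mul => //; apply: vring_cst.
Qed.

Lemma int_diff0 (P : place Z) : int_diff P 0.
Proof. by exists 0%N, (fun=> 0), (fun=> 0); split => [[]//|]; rewrite big_ord0. Qed.

Lemma int_diffD (P : place Z) w w' : int_diff P w -> int_diff P w' -> int_diff P (w + w').
Proof.
move=> [n [a [b [H ->]]]] [n' [a' [b' [H' ->]]]].
pose f T (u : 'I_n -> T) (u' : 'I_n' -> T) i :=
  match fintype.split i with inl j => u j | inr j => u' j end.
exists (n + n')%N, (f _ a a'), (f _ b b'); split.
  by move=> i; rewrite /f; case: fintype.split.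
rewrite big_split_ord /=; congr (_ + _); apply: eq_bigr => i _.
  by rewrite /f (unsplitK (inl i)).
by rewrite /f (unsplitK (inr i)).
Qed.

Lemma int_diffZ (P : place Z) x w : vring P x -> int_diff P w -> int_diff P (x *: w).
Proof.
move=> Px [n [a [b [H ->]]]]; exists n, (fun i => x * a i), b; split.
  by move=> i; have [Pa Pb] := H i; split => //; apply: vring_mul.
by rewrite scaler_sumr; apply: eq_bigr => i _; rewrite scalerA.
Qed.

Lemma repartition_add a b : repartition a -> repartition b ->
  repartition (fun P => a P + b P).
Proof.
move=> fa fb; apply: sub_finite_set (_ : finite_set (_ `|` _)); last first.
  by rewrite finite_setU; split; [exact: fa|exact: fb].
move=> P /= nP; apply: contrapT => /not_orP[/contrapT Pa /contrapT Pb].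
by apply: nP; apply: vringD.
Qed.

Lemma repartition_scale u a : repartition a -> repartition (fun P => cst Z u * a P).
Proof.
move=> fa; apply: sub_finite_set fa => P /= nP Pa; apply: nP.
by apply: vring_mul => //; apply: vring_cst.
Qed.

Lemma repartition_pow a n : repartition a -> repartition (fun P => a P ^+ n).
Proof.
by move=> fa; apply: sub_finite_set fa => P /= nP Pa; apply: nP; apply: vringX.
Qed.

Lemma cocycle_add z z' : cocycle z -> cocycle z' -> cocycle (chadd z z').
Proof.
move=> [fz iz] [fz' iz']; split; first exact: repartition_add.
by move=> P /=; rewrite ddD opprD addrACA; apply: int_diffD.
Qed.

Lemma cocycle_scale u z : cocycle z -> cocycle (chscale u z).
Proof.
move=> [fz iz]; split; first exact: repartition_scale.
by move=> P /=; rewrite ddZ -scalerBr; apply: int_diffZ => //; apply: vring_cst.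
Qed.

Lemma cocycle_frob a : repartition a -> cocycle (frob_chain a).
Proof.
move=> fa; split; first exact: repartition_pow.
by move=> P /=; rewrite dd_pow subr0; apply: int_diff0.
Qed.

(** Supplies the explicit form of the differential that [pull] asks for, read off from the stalk at
    any one place. *)
Lemma cocycle_differential z : cocycle z ->
  exists (n : nat) (a b : 'I_n -> Z), z.1 = \sum_(i < n) a i *: dd (b i).
Proof.
move=> [_ iz]; have [P _] := place_exists Z.
have [n [a [b [_ E]]]] := iz P.
exists n.+1, (fun i => oapp a 1 (unlift ord0 i)), (fun i => oapp b (z.2 P) (unlift ord0 i)).
rewrite big_ord_recl unlift_none /= scale1r -[z.1](subrK (dd (z.2 P))) E addrC.
by congr (_ + _); apply: eq_bigr => i _; rewrite liftK.
Qed.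

End Cochains.

(** * Dieudonne modules and H^1 of the structure sheaf *)

Section Dieudonne.
Variables (k : fieldType) (kbar : closedFieldType).
Variables (iota : {rmorphism k -> kbar}) (p : nat) (pk : p \in [pchar k]).
Implicit Types A B : etGrp iota p.

Lemma pcharkbar : p \in [pchar kbar].
Proof. by rewrite (fmorph_pchar iota). Qed.

Lemma dieud0 A : dieud (0 : {ffun A -> kbar}).
Proof. by split=> *; rewrite !ffunE ?addr0 ?rmorph0. Qed.

Lemma dieudD A (f h : {ffun A -> kbar}) : dieud f -> dieud h -> dieud (f + h).
Proof.
move=> [fD fs] [hD hs]; split=> *; rewrite !ffunE ?fD ?hD ?fs ?hs ?rmorphD //.
by rewrite addrACA.
Qed.

Lemma dieudZ A c (f : {ffun A -> kbar}) : dieud f -> dieud (dieud_scale c f).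
Proof.
move=> [fD fs]; split=> *; rewrite !ffunE ?fD ?mulrDr //.
by rewrite fs rmorphM gal_fix.
Qed.

Lemma dieud_sum A (I : finType) (F : I -> {ffun A -> kbar}) :
  (forall i, dieud (F i)) -> dieud (\sum_i F i).
Proof. by move=> H; apply: (big_ind (@dieud _ _ _ _ A)) => //; [exact: dieud0|exact: dieudD]. Qed.

Lemma dieud_F A (f : {ffun A -> kbar}) : dieud f -> dieud (dieudF f).
Proof.
move=> [fD fs]; split=> *; rewrite !ffunE ?fD ?(pexpD pcharkbar) //.
by rewrite fs rmorphXn.
Qed.

Lemma dieudF_eq0 A (f : {ffun A -> kbar}) : dieudF f = 0 -> f = 0.
Proof.
move=> H; apply/ffunP => a; rewrite ffunE; apply: (pexp_inj pcharkbar).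
move/ffunP: H => /(_ a); rewrite !ffunE => ->; rewrite expr0n.
by case: p (prime_gt0 (pcharf_prime pk)).
Qed.

Lemma proot_exists (z : kbar) : exists w, w ^+ p = z.
Proof.
have := solve_monicpoly (fun i => if i == 0%N then z else 0)
  (prime_gt0 (pcharf_prime pk)).
move=> [w E]; exists w; rewrite {}E.
have := prime_gt0 (pcharf_prime pk); case: (p) => // n _.
by rewrite big_ord_recl expr0 mulr1 big1 ?addr0 // => i _; rewrite mul0r.
Qed.

(** p-th roots in [kbar] are unique, so taking them pointwise keeps additivity and Galois
    equivariance. *)
Lemma dieud_root A (f : {ffun A -> kbar}) : dieud f ->
  exists2 h, dieud h & dieudF h = f.
Proof.
move=> [fD fs]; have /choice[r Hr] := proot_exists.
exists [ffun a => r (f a)]; last by apply/ffunP => a; rewrite !ffunE Hr.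
split=> *; rewrite !ffunE; apply: (pexp_inj pcharkbar) => /=.
  by rewrite (pexpD pcharkbar) !Hr fD.
by rewrite Hr fs -rmorphXn Hr.
Qed.

Section JacobianClasses.
Variables (Z : curve k) (J : etGrp iota p) (th : {ffun J -> kbar} -> cochain Z).
Hypothesis hJ : is_jac_et th.
Local Notation tau f := (th f).2.

Lemma jac_cocycle f : dieud f -> cocycle (th f).
Proof. by case: hJ => H _ _ _ _ /H[W [Wf Wc _ _ _]]; apply: Wc. Qed.

Lemma tau_repartition f : dieud f -> repartition (tau f).
Proof. by move=> /jac_cocycle[]. Qed.

Lemma tauD f h : dieud f -> dieud h -> coh (tau (f + h)) (fun P => tau f P + tau h P).
Proof.
by case: hJ => _ [H _] _ _ _ df dh; have := cohom_coh (H _ _ df dh).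
Qed.

Lemma tauZ c f : dieud f -> coh (tau (dieud_scale c f)) (fun P => cst Z c * tau f P).
Proof. by case: hJ => _ [_ H] _ _ _ df; have := cohom_coh (H c _ df). Qed.

Lemma tauF f : dieud f -> coh (tau (dieudF f)) (fun P => tau f P ^+ p).
Proof. by case: hJ => _ _ H _ _ df; have := cohom_coh (H _ df). Qed.

Lemma tau0 : coh (tau 0) (fun=> 0).
Proof.
have := tauZ 0 (dieud0 J).
have -> : dieud_scale 0 (0 : {ffun J -> kbar}) = 0.
  by apply/ffunP => a; rewrite !ffunE mulr0.
move=> H; apply: coh_trans H _; apply: coh0 => P.
by rewrite rmorph0 mul0r.
Qed.

(** The differential part of a class can be forgotten: if the repartition is trivial, so is the
    Frobenius of the class, and F is injective on the Dieudonne module. *)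
Lemma tau_inj f : dieud f -> coh (tau f) (fun=> 0) -> f = 0.
Proof.
move=> df H; apply: dieudF_eq0; case: hJ => _ _ HF Hinj _.
apply: Hinj; first exact: dieud_F.
apply: (cohom_trans (HF _ df)); exact: (cohom_frob0 pk H).
Qed.

Lemma tau_sum (I : Type) (r : seq I) (F : I -> {ffun J -> kbar}) :
  (forall i, dieud (F i)) ->
  coh (tau (\sum_(i <- r) F i)) (fun P => \sum_(i <- r) tau (F i) P).
Proof.
move=> dF; elim: r => [|i r IH].
  rewrite big_nil; apply: coh_trans tau0 _; apply: coh_sym; apply: coh0 => P.
  by rewrite big_nil.
rewrite big_cons; apply: coh_trans (tauD _ _) _ => //.
  by elim: r {IH} => [|j r IH]; rewrite ?big_nil ?big_cons;
     [exact: dieud0|apply: dieudD].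
have := coh_add (coh_refl (tau (F i))) IH.
by congr coh; apply/funext => P; rewrite big_cons.
Qed.

End JacobianClasses.

Section JacobianAction.
Variables (X Y : curve k) (pi : galois_cover p X Y).
Variables (J : gGrp iota p) (th : {ffun J -> kbar} -> cochain Y).
Hypothesis hJ : is_jac_et_G pi th.

(** The compatibility of [th] with the action is stated for a given pull back, so a pull back is
    built. *)
Lemma tau_gam f : dieud f ->
  coh (th (dieud_comp (gam J) f)).2 (conj_fam pk pi (th f).2).
Proof.
move=> df; have [n [a [b E]]] := cocycle_differential (jac_cocycle hJ.1 df).
pose z : cochain Y := (\sum_(i < n) cgam pi (a i) *: dd (cgam pi (b i)),
  conj_fam pk pi (th f).2).
have zp : pull (cgam pi) (th f) z.
  split; first by exists n, a, b.
  by move=> Q P /(lies_over_cgam pk) ->.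
exact: (cohom_coh (hJ.2 _ _ df zp)).
Qed.

End JacobianAction.
End Dieudonne.

(** * Invariant classes on Y and the etale part of H^1_dR(X) *)

Section TorsorDescent.
Variables (k : fieldType) (p : nat) (pk : p \in [pchar k]) (hk : perfect_char k p).
Variables (kbar : closedFieldType) (iota : {rmorphism k -> kbar}).
Variables (X Y : curve k) (pi : galois_cover p X Y).
Variables (eta : cochain X) (heta : torsor_class pi eta).
Variables (JX : etGrp iota p) (thX : {ffun JX -> kbar} -> cochain X).
Hypothesis hJX : is_jac_et thX.
Variables (JY : gGrp iota p) (thY : {ffun JY -> kbar} -> cochain Y).
Hypothesis hJY : is_jac_et_G pi thY.
Local Notation cp := (cpi pi).
Local Notation tauY f := (thY f).2.
Local Notation gst f := (dieud_comp (gam JY) f).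
Local Notation conj_fam := (conj_fam pk pi).

Let p0 : (0 < p)%N := prime_gt0 (pcharf_prime pk).

Lemma coh_sub (Z : curve k) (a a' b b' : place Z -> Z) : coh a a' -> coh b b' ->
  coh (fun P => a P - b P) (fun P => a' P - b' P).
Proof.
move=> ha [h H]; apply: coh_add ha _; exists (- h) => P.
have -> : - b P - - b' P - - h = - (b P - b' P - h) by ring.
exact: vringN.
Qed.

Lemma coh_conj (a b : place Y -> Y) : coh a b -> coh (conj_fam a) (conj_fam b).
Proof.
move=> [h H]; exists (cgam pi h) => Q.
by rewrite -!rmorphB -(vring_conj pk); apply: H.
Qed.

Definition pullf (r : place Y -> place X) (x : place X -> X) : place Y -> Y :=
  fun Q => cp (x (r Q)).

Section WithRestriction.
Variable r : place Y -> place X.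
Hypothesis Hr : forall Q, lies_over cp Q (r Q).
Local Notation pull x := (pullf r x).

Lemma coh_pull (a b : place X -> X) : coh a b -> coh (pull a) (pull b).
Proof.
move=> [h H]; exists (cp h) => Q.
by rewrite -!rmorphB; apply/(Hr Q).
Qed.

(** The section [y] trivialises the torsor over Y. *)
Lemma pull_eta : coh (pull eta.2) (fun=> 0).
Proof.
case: heta => _ _ [y [_ Hy]]; apply: coh_sym; exists (- y) => Q.
by rewrite sub0r opprK addrC; apply: Hy.
Qed.

Lemma pull_kernel (x : place X -> X) : coh (pull x) (fun=> 0) ->
  exists c, coh x (fun P => cst X c * eta.2 P).
Proof.
case: heta => _ _ [y [gy Hy]] [h H].
apply: (pullback_kernel pk gy Hy (h := h)) => Q P QP.
by have := H Q; rewrite subr0 /pullf (lies_over_uniq (Hr Q) QP).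
Qed.

Lemma eta_repartition : repartition eta.2.
Proof. by case: heta => [[]]. Qed.

Lemma eta_frob : coh (fun P => eta.2 P ^+ p) eta.2.
Proof. by case: heta => _ /cohom_coh. Qed.

(** [f] is invariant and is the difference of [u], so the second difference of the repartition of
    [u] is a coboundary, as [dif_descent] requires. *)
Lemma invariant_descent f u : dieud f -> dieud u -> gst f = f -> f + u = gst u ->
  exists2 x, repartition x & coh (tauY f) (pull x).
Proof.
move=> df du ff fu; pose v := tauY u.
have Dv : coh (dif conj_fam v) (tauY f).
  have H1 := tau_gam pk hJY du; rewrite -fu in H1.
  have H2 := tauD hJY.1 df du.
  have H3 := coh_sub (coh_trans (coh_sym H1) H2) (coh_refl v).
  apply: coh_trans H3 _; exists 0 => Q.
  by rewrite /v addrK subrr subr0; apply: vring0.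
have DDv : coh (dif conj_fam (dif conj_fam v)) 0.
  have H1 := coh_sub (coh_conj Dv) Dv; apply: coh_trans H1 _.
  have H2 := tau_gam pk hJY df; rewrite ff in H2.
  apply: coh_trans (coh_sub (coh_sym H2) (coh_refl _)) _.
  by apply: coh0 => Q; rewrite subrr.
case: heta => _ _ [y [gy Hy]].
have [x rx [b Hb]] := dif_descent gy eta_repartition Hy
  (tau_repartition hJY.1 du) DDv.
exists x => //; apply: coh_trans (coh_sym Dv) _; exists b => Q.
exact: Hb.
Qed.

(** [invariant_descent] provides this when every invariant class is a difference, the assumption
    that [invariant_not_dif] refutes. *)
Hypothesis Hd : forall f, dieud f -> gst f = f ->
  exists2 x, repartition x & coh (tauY f) (pull x).

Lemma gst_root f h : dieudF h = f -> gst f = f -> gst h = h.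
Proof.
move=> <- /ffunP H; apply/ffunP => a; have := H a; rewrite !ffunE => E.
exact: (pexp_inj (pcharkbar iota pk)).
Qed.

Lemma gst_F f : gst f = f -> gst (dieudF f) = dieudF f.
Proof.
by move=> /ffunP H; apply/ffunP => a; have := H a; rewrite !ffunE => ->.
Qed.

Lemma pull_pow (x : place X -> X) n :
  pull (fun P => x P ^+ n) = fun Q => pull x Q ^+ n.
Proof. by apply/funext => Q; rewrite /pullf rmorphXn. Qed.

Lemma pull_add (x x' : place X -> X) :
  pull (fun P => x P + x' P) = fun Q => pull x Q + pull x' Q.
Proof. by apply/funext => Q; rewrite /pullf rmorphD. Qed.

Lemma pull_sub (x x' : place X -> X) :
  pull (fun P => x P - x' P) = fun Q => pull x Q - pull x' Q.
Proof. by apply/funext => Q; rewrite /pullf rmorphB. Qed.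

Lemma pull_scale c (x : place X -> X) :
  pull (fun P => cst X c * x P) = fun Q => cst Y c * pull x Q.
Proof. by apply/funext => Q; rewrite /pullf rmorphM cpi_cst. Qed.

Lemma cst_eta_frob c :
  coh (fun P => (cst X c * eta.2 P) ^+ p) (fun P => cst X (c ^+ p) * eta.2 P).
Proof.
have := coh_scale (c ^+ p) eta_frob; congr coh; apply/funext => P.
by rewrite exprMn rmorphXn.
Qed.

(* Frobenius is bijective on M(J_Y[p]_et) and kills differentials, so classes
   may be compared through their repartitions alone. *)
Lemma descended_etale f x : dieud f -> gst f = f -> repartition x ->
  coh (tauY f) (pull x) -> etale_part p (frob_chain p x).
Proof.
move=> df ff rx fx.
(* The stable submodule consists of the Frobenius images of descended repartitions; p-th powers are
   what makes de Rham cocycles out of them. *)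
exists [set z | cocycle z /\ exists f x, [/\ dieud f, gst f = f, repartition x,
  coh (tauY f) (pull x) & cohom z (frob_chain p x)]]%classic.
split; [|by move=> z []| | |].
- split; first exact: cocycle_frob.
  by exists f, x; split => //; apply: cohom_frob => //; apply: coh_refl.
- move=> z z' cz' zz' [_ [f' [x' [df' ff' rx' fx' zx']]]]; split => //.
  by exists f', x'; split => //; apply: cohom_trans zx'; apply: cohom_sym.
- split.
    move=> z1 z2 [c1 [f1 [x1 [df1 ff1 rx1 fx1 zx1]]]] [c2 [f2 [x2 [df2 ff2 rx2 fx2 zx2]]]].
    split; first exact: cocycle_add.
    exists (f1 + f2), (fun P => x1 P + x2 P); split.
    + exact: dieudD.
    + by apply/ffunP => a; move/ffunP: ff1 => /(_ a); move/ffunP: ff2 => /(_ a);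
        rewrite !ffunE => -> ->.
    + exact: repartition_add.
    + rewrite pull_add; apply: coh_trans (tauD hJY.1 df1 df2) _; exact: coh_add.
    + have := cohom_add zx1 zx2; congr cohom; rewrite /chadd /frob_chain /= addr0.
      by congr (_, _); apply/funext => P; rewrite (pexpD (pcharX pk X)).
  move=> c z [cz [f1 [x1 [df1 ff1 rx1 fx1 zx1]]]].
  have [c1 Ec] := hk c; split; first exact: cocycle_scale.
  exists (dieud_scale c1 f1), (fun P => cst X c1 * x1 P); split.
  + exact: dieudZ.
  + by apply/ffunP => a; move/ffunP: ff1 => /(_ a); rewrite !ffunE => ->.
  + exact: repartition_scale.
  + rewrite pull_scale; apply: coh_trans (tauZ hJY.1 c1 df1) _; exact: coh_scale.
  + have := cohom_scale c zx1; congr cohom; rewrite /chscale /frob_chain /= scaler0.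
    by congr (_, _); apply/funext => P; rewrite exprMn -rmorphXn Ec.
- split.
  + move=> z [cz [f1 [x1 [df1 ff1 rx1 fx1 zx1]]]]; split.
      by have := cocycle_frob pk (a := z.2); apply; case: cz.
    exists (dieudF f1), (fun P => x1 P ^+ p); split.
    * exact: dieud_F.
    * exact: gst_F.
    * exact: repartition_pow.
    * rewrite pull_pow; apply: coh_trans (tauF hJY.1 df1) _; exact: coh_pow.
    * exact: (cohom_frob pk (cohom_coh zx1)).
  (* Injectivity of F: F^2 kills [f1], so [f1 = 0] and [x1] is [c] times [eta]. As [eta] is fixed by
     F, the triviality of F^2 of this multiple gives that of the multiple itself. *)
  + move=> z [cz [f1 [x1 [df1 ff1 rx1 fx1 zx1]]]] z0.
    suff H : coh x1 (fun=> 0).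
      by apply: cohom_trans zx1 _; apply: cohom_frob0.
    have H0 : coh (fun P => (x1 P ^+ p) ^+ p) (fun=> 0).
      apply: coh_trans (cohom_coh z0).
      exact: coh_sym (coh_pow pk (cohom_coh zx1)).
    have f10 : f1 = 0.
      apply/dieudF_eq0/dieudF_eq0 => //; apply: (tau_inj pk hJY.1).
        exact: (dieud_F pk (dieud_F pk df1)).
      apply: coh_trans (tauF hJY.1 (dieud_F pk df1)) _.
      apply: coh_trans (coh_pow pk (tauF hJY.1 df1)) _.
      apply: coh_trans (coh_pow pk (coh_pow pk fx1)) _.
      have := coh_pull H0; congr coh; apply/funext => Q.
        by rewrite /pullf !rmorphXn.
      by rewrite /pullf rmorph0.
    have [|c Hc] := @pull_kernel x1.
      apply: coh_trans (coh_sym fx1) _; rewrite f10; exact: (tau0 hJY.1).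
    have [c0|c0] := eqVneq c 0.
      apply: coh_trans Hc _; apply: coh0 => P; by rewrite c0 rmorph0 mul0r.
    have H1 : coh (fun P => cst X ((c ^+ p) ^+ p) * eta.2 P) (fun=> 0).
      apply: coh_trans H0; apply: coh_sym.
      apply: coh_trans (coh_pow pk (coh_pow pk Hc)) _.
      apply: coh_trans (coh_pow pk (cst_eta_frob c)) _; exact: cst_eta_frob.
    apply: coh_trans Hc _; have := coh_scale (c / (c ^+ p) ^+ p) H1.
    congr coh; apply/funext => P; last by rewrite mulr0.
    by rewrite mulrA -rmorphM divfK // !expf_neq0.
  (* Surjectivity of F: for a Frobenius root [h] of [f1], descended to [x2], the p-th power of [x2]
     differs from [x1] by [c] times [eta]. Subtracting [c1] times [eta], where [c1] is the p-th root
     of [c], corrects this without changing the pull back. *)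
  + move=> z [cz [f1 [x1 [df1 ff1 rx1 fx1 zx1]]]].
    have [h dh Eh] := dieud_root pk df1.
    have hh := gst_root Eh ff1; have [x2 rx2 hx2] := Hd dh hh.
    have [|c Hc] := @pull_kernel (fun P => x2 P ^+ p - x1 P).
      rewrite pull_sub pull_pow.
      apply: coh_trans (coh_sub (coh_pow pk (coh_sym hx2)) (coh_sym fx1)) _.
      rewrite -Eh; apply: coh_trans (coh_sub (coh_sym (tauF hJY.1 dh)) (coh_refl _)) _.
      by apply: coh0 => Q; rewrite subrr.
    have [c1 Ec] := hk c.
    pose x3 P := x2 P - cst X c1 * eta.2 P.
    have rx3 : repartition x3.
      have := repartition_add rx2 (repartition_scale (- c1) eta_repartition).
      by congr repartition; apply/funext => P; rewrite /x3 rmorphN mulNr.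
    exists (frob_chain p x3).
      split; first exact: cocycle_frob.
      exists h, x3; split => //; last by apply: cohom_frob => //; apply: coh_refl.
      rewrite pull_sub pull_scale; apply: coh_trans hx2 _.
      have := coh_sub (coh_refl (pull x2)) (coh_scale c1 (coh_sym pull_eta)).
      by congr coh; apply/funext => Q; rewrite mulr0 subr0.
    apply: cohom_trans (cohom_sym zx1); apply: cohom_frob => //.
    have H1 : coh (fun P => x3 P ^+ p) (fun P => x2 P ^+ p - cst X c * eta.2 P).
      have := coh_sub (coh_refl (fun P => x2 P ^+ p)) (cst_eta_frob c1).
      by congr coh; apply/funext => P; rewrite ?(pexpB (pcharX pk X)) ?Ec.
    apply: coh_trans H1 _.
    have := coh_sub (coh_refl (fun P => x2 P ^+ p)) (coh_sym Hc).
    by congr coh; apply/funext => P; ring.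
Qed.

(** [descended_etale] concerns p-th powers, hence it is applied to a Frobenius root of [f]. *)
Lemma invariant_lift f : dieud f -> gst f = f ->
  exists2 h, dieud h & coh (tauY f) (pull (thX h).2).
Proof.
move=> df ff; have [f1 df1 E1] := dieud_root pk df.
have ff1 := gst_root E1 ff; have [x rx fx] := Hd df1 ff1.
have et := descended_etale df1 ff1 rx fx.
case: hJX => _ _ _ _ /(_ _ et)[h dh Hh]; exists h => //.
rewrite -E1; apply: coh_trans (tauF hJY.1 df1) _.
apply: coh_trans (coh_pow pk fx) _; rewrite -pull_pow; apply: coh_pull.
exact: coh_sym (cohom_coh Hh).
Qed.

End WithRestriction.
End TorsorDescent.

(** * Galois theory of [kbar] over [k] *)

Lemma least_nat (R : nat -> Prop) : (exists n, R n) ->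
  exists n, R n /\ forall m, (m < n)%N -> ~ R m.
Proof.
move=> [n0 Rn0]; have Rex : exists n, `[<R n>] by exists n0; apply/asboolP.
exists (ex_minn Rex); case: ex_minnP => n /asboolP Rn H; split => // m mn Rm.
by have := H m (asboolT Rm); rewrite leqNgt mn.
Qed.

Section GaloisExtension.
Variables (k : fieldType) (kbar : closedFieldType) (iota : {rmorphism k -> kbar}).
Hypothesis hbar : forall z : kbar, algebraic_over iota z.
Implicit Types G : set (kbar * kbar).

(** The graph of a morphism of k-algebras from a subring of [kbar] to [kbar]; graphs are ordered by
    inclusion, which suits Zorn's lemma. *)
Record partial_morphism G : Prop := PartialMorphism {
  pm_cst : forall c, G (iota c, iota c);
  pm_sub : forall u v, G u -> G v -> G (u.1 - v.1, u.2 - v.2);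
  pm_mul : forall u v, G u -> G v -> G (u.1 * v.1, u.2 * v.2);
  pm_fun : forall b, G (0, b) -> b = 0 }.

Definition poly_pair G (h h' : {poly kbar}) := forall i, G (h`_i, h'`_i).

Section Extend.
Variables (G : set (kbar * kbar)) (hG : partial_morphism G).

Lemma pm0 : G (0, 0).
Proof. by have := pm_cst hG 0; rewrite rmorph0. Qed.

Lemma pm_add u v : G u -> G v -> G (u.1 + v.1, u.2 + v.2).
Proof.
move=> Gu Gv; have := pm_sub hG Gu (pm_sub hG pm0 Gv).
by rewrite /= !sub0r !opprK.
Qed.

Lemma pm_exp u n : G u -> G (u.1 ^+ n, u.2 ^+ n).
Proof.
move=> Gu; elim: n => [|n IH]; first by have := pm_cst hG 1; rewrite rmorph1 !expr0.
by rewrite !exprS; apply: (pm_mul hG Gu IH).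
Qed.

Lemma pm_sum (J : Type) (r : seq J) (F F' : J -> kbar) :
  (forall j, G (F j, F' j)) -> G (\sum_(j <- r) F j, \sum_(j <- r) F' j).
Proof.
move=> H; elim: r => [|j r IH]; first by rewrite !big_nil; apply: pm0.
by rewrite !big_cons; apply: (pm_add (H j) IH).
Qed.

Lemma pm_horner h h' a b : poly_pair G h h' -> G (a, b) -> G (h.[a], h'.[b]).
Proof.
move=> Gh Gab; pose n := maxn (size h) (size h').
rewrite (@horner_coef_wide _ n) ?leq_maxl // (@horner_coef_wide _ n) ?leq_maxr //.
by apply: pm_sum => i; apply: (pm_mul hG (Gh i) (pm_exp i Gab)).
Qed.

Lemma poly_pair_map (q : {poly k}) : poly_pair G (map_poly iota q) (map_poly iota q).
Proof. by move=> i; rewrite coef_map; apply: pm_cst. Qed.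

Lemma poly_pair_sub h h' l l' : poly_pair G h h' -> poly_pair G l l' ->
  poly_pair G (h - l) (h' - l').
Proof. by move=> H1 H2 i; rewrite !coefB; apply: (pm_sub hG (H1 i) (H2 i)). Qed.

Lemma poly_pair_mul h h' l l' : poly_pair G h h' -> poly_pair G l l' ->
  poly_pair G (h * l) (h' * l').
Proof.
move=> H1 H2 i; rewrite !coefM; apply: pm_sum => j.
exact: (pm_mul hG (H1 _) (H2 _)).
Qed.

Lemma poly_pairC c c' : G (c, c') -> poly_pair G c%:P c'%:P.
Proof. by move=> Gc i; rewrite !coefC; case: eqP => // _; apply: pm0. Qed.

Lemma poly_pairXn n : poly_pair G 'X^n 'X^n.
Proof. by move=> i; rewrite !coefXn; have := pm_cst hG (i == n)%:R; rewrite rmorph_nat. Qed.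

(** A nonzero algebraic [x] satisfies an equation over [k] with nonzero constant term, which rules
    out 0 as its image. *)
Lemma pm_inj x : G (x, 0) -> x = 0.
Proof.
move=> Gx; apply/eqP; apply: contrapT => /negP x0.
have [P P0 rP] := hbar x; have [m [Q [PE Q0]]] := poly_unX P0.
have Qx : (map_poly iota Q).[x] = 0.
  move: rP; rewrite rootE PE rmorphM /= hornerM map_polyXn hornerXn mulf_eq0.
  by rewrite (negPf (expf_neq0 _ x0)) orbF => /eqP.
have := pm_horner (poly_pair_map Q) Gx; rewrite Qx horner_coef0 coef_map /= => /(pm_fun hG)/eqP.
by rewrite fmorph_eq0 (negPf Q0).
Qed.

(** As for a simple extension of fields, [a] is sent to a root of the image [q'] of an equation [q]
    of least degree. *)
Lemma extend_pm a : exists b G', [/\ partial_morphism G', (G `<=` G')%classic & G' (a, b)].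
Proof.
pose R n := exists q q', [/\ poly_pair G q q', size q = n, q != 0 & q.[a] = 0].
have [|n [Rn Rmin]] := @least_nat R.
  have [P P0 rP] := hbar a; exists (size (map_poly iota P)).
  exists (map_poly iota P), (map_poly iota P); split => //.
  - exact: poly_pair_map.
  - by rewrite map_poly_eq0.
  - by apply/eqP.
have [q [q' [Gq sq q0 qa]]] := Rn.
have n1 : (1 < n)%N.
  rewrite ltnNge -sq; apply/negP => /size1_polyC E.
  by move: q0 qa; rewrite E hornerC polyC_eq0 => /negPf q0 /eqP; rewrite q0.
have lq' : q'`_n.-1 != 0.
  apply/eqP => E; have := Gq n.-1; rewrite E => /pm_inj/eqP.
  by rewrite -sq -lead_coefE lead_coef_eq0 (negPf q0).
have [b rb] : exists b, root q' b.
  apply/closed_rootP; apply/eqP => s1; move: lq'.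
  by rewrite nth_default ?eqxx // s1; lia.
(* The coefficients lie in a ring, not in a field, so [h] is reduced by pseudo-division; the leading
   coefficient of [q'] is nonzero and is cancelled at the end. *)
have key h h' : poly_pair G h h' -> h.[a] = 0 -> h'.[b] = 0.
  have [m] := ubnP (size h); elim: m h h' => // m IH h h' hm Gh ha.
  have [hn|nh] := ltnP (size h) n.
    have h0 : h = 0.
      by apply/eqP; apply: contrapT => /negP h0; apply: (Rmin _ hn); exists h, h'.
    suff -> : h' = 0 by rewrite horner0.
    by apply/polyP => i; have := Gh i; rewrite h0 !coef0 => /(pm_fun hG).
  have h0 : (0 < size h)%N by lia.
  have := IH (q`_n.-1 *: h - h`_(size h).-1 *: ('X^(size h - n) * q))
     (q'`_n.-1 *: h' - h'`_(size h).-1 *: ('X^(size h - n) * q')).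
  rewrite !hornerE /= qa (eqP rb) ha !mulr0 !subr0.
  move=> H; have /eqP : q'`_n.-1 * h'.[b] = 0.
    apply: H => //.
    - rewrite -ltnS; apply: leq_trans hm; rewrite ltnS -[X in (_ < X)%N](prednK h0) ltnS.
      apply/leq_sizeP => i hi; rewrite coefB !coefZ coefXnM.
      have -> : (i < size h - n)%N = false by lia.
      have [->|ni] := eqVneq i (size h).-1.
        have -> : ((size h).-1 - (size h - n) = n.-1)%N by lia.
        by rewrite mulrC subrr.
      have hi' : (size h <= i)%N by rewrite -(prednK h0) ltn_neqAle eq_sym ni hi.
      rewrite [h`_i]nth_default // [q`_(i - _)]nth_default ?mulr0 ?subr0 //.
      by rewrite sq; move: nh hi'; clear; move: (size h) => t; lia.
    - rewrite -!mul_polyC; apply: poly_pair_sub; apply: poly_pair_mul => //.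
      + exact/poly_pairC/Gq.
      + exact/poly_pairC/Gh.
      + by apply: poly_pair_mul => //; apply: poly_pairXn.
  by rewrite mulf_eq0 (negPf lq') => /eqP.
exists b, [set u | exists h h', poly_pair G h h' /\ u = (h.[a], h'.[b])]%classic.
split.
- split.
  + move=> c; exists (iota c)%:P, (iota c)%:P; rewrite !hornerC; split => //.
    by apply: poly_pairC; apply: (pm_cst hG).
  + move=> _ _ [h [h' [H ->]]] [l [l' [L ->]]]; exists (h - l), (h' - l').
    by rewrite !hornerE; split => //; apply: poly_pair_sub.
  + move=> _ _ [h [h' [H ->]]] [l [l' [L ->]]]; exists (h * l), (h' * l').
    by rewrite !hornerE; split => //; apply: poly_pair_mul.
  + by move=> c [h [h' [H [ha ->]]]]; apply: (key h).
- move=> [c c'] Gc; exists c%:P, c'%:P; rewrite !hornerC; split => //.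
  exact: poly_pairC.
- by exists 'X, 'X; rewrite !hornerX; split => //; apply: (poly_pairXn 1).
Qed.

End Extend.

Lemma total_extension G : partial_morphism G ->
  exists s : gal iota, forall u, G u -> s u.1 = u.2.
Proof.
move=> hG.
have [//|F FP [G1 FG1] Ftot|A [hA GA Amax]] := @Zorn_above _ partial_morphism G.
  have join2 a b := @chain_pair _ F a b Ftot.
  split.
  - by move=> c; exists G1 => //; apply: (pm_cst (FP _ FG1)).
  - move=> u v Hu Hv; have [X [FX Xu Xv]] := join2 _ _ Hu Hv.
    by exists X => //; apply: (pm_sub (FP _ FX)).
  - move=> u v Hu Hv; have [X [FX Xu Xv]] := join2 _ _ Hu Hv.
    by exists X => //; apply: (pm_mul (FP _ FX)).
  - by move=> b [X FX Xb]; apply: (pm_fun (FP _ FX)).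
have /choice[s Hs] : forall a, exists b, A (a, b).
  move=> a; have [b [G' [hG' AG' G'ab]]] := extend_pm hA a.
  by exists b; apply: (Amax _ hG' AG').
have uniq a b : A (a, b) -> b = s a.
  move=> Aab; apply/eqP; rewrite -subr_eq0; apply/eqP; apply: (pm_fun hA).
  by have := pm_sub hA Aab (Hs a); rewrite /= subrr.
have sB : zmod_morphism s.
  by move=> x y; apply/esym/uniq; apply: (pm_sub hA (Hs x) (Hs y)).
have sM : monoid_morphism s.
  split; first by apply/esym/uniq; have := pm_cst hA 1; rewrite rmorph1.
  by move=> x y; apply/esym/uniq; apply: (pm_mul hA (Hs x) (Hs y)).
pose sr : {rmorphism kbar -> kbar} := HB.pack s
  (GRing.isZmodMorphism.Build _ _ s sB) (GRing.isMonoidMorphism.Build _ _ s sM).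
have sfix c : sr (iota c) = iota c by apply/esym/uniq/(pm_cst hA).
by exists (Gal sfix) => -[a b] /= /GA/uniq.
Qed.

(** Every root of an equation [q] of least degree is a conjugate of [z], hence [z] itself, so [q] is
    a multiple of a power of X - z. With exponent p^e m, m prime to p, it is a polynomial in X^(p^e)
    whose second coefficient puts z^(p^e) in [k], and [k] is perfect. *)
Lemma gal_fixed p (z : kbar) : p \in [pchar k] -> perfect_char k p ->
  (forall s : gal iota, s z = z) -> exists c, z = iota c.
Proof.
move=> pk hk fixz.
pose R n := exists q : {poly k}, [/\ q != 0, size q = n & root (map_poly iota q) z].
have [|n [[q [q0 sq rq]] Rmin]] := @least_nat R.
  by have [P P0 rP] := hbar z; exists (size P), P.
have qdvd f : root (map_poly iota f) z -> q %| f.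
  move=> rf; apply/modp_eq0P/eqP; apply: contrapT => /negP r0.
  apply: (Rmin (size (f %% q))); first by rewrite -sq ltn_modp.
  exists (f %% q); split => //; move: rf; rewrite {1}(divp_eq f q) !rootE.
  by rewrite rmorphD rmorphM /= hornerD hornerM (eqP rq) mulr0 add0r.
have allz z' : root (map_poly iota q) z' -> z' = z.
  move=> rz'; pose G : set (kbar * kbar) :=
    [set u | exists f : {poly k}, u = ((map_poly iota f).[z], (map_poly iota f).[z'])]%classic.
  have hG : partial_morphism G.
    split.
    - by move=> c; exists c%:P; rewrite map_polyC !hornerC.
    - by move=> _ _ [f ->] [h ->]; exists (f - h); rewrite rmorphB !hornerE.
    - by move=> _ _ [f ->] [h ->]; exists (f * h); rewrite rmorphM !hornerE.
    - move=> b [f [/esym/eqP/qdvd/dvdpP[h ->] ->]].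
      by rewrite rmorphM hornerM (eqP rz') mulr0.
  have [s Hs] := total_extension hG.
  have /Hs /= : G (z, z') by exists 'X; rewrite map_polyX !hornerX.
  by rewrite fixz.
have [rs Ers] := closed_field_poly_normal (map_poly iota q).
have lq0 : lead_coef (map_poly iota q) != 0 by rewrite lead_coef_eq0 map_poly_eq0.
have rsz : rs = nseq (size rs) z.
  apply/all_pred1P/allP => z' z'rs; apply/eqP/allz; rewrite Ers rootE hornerZ mulf_eq0.
  by apply/orP; right; rewrite -rootE root_prod_XsubC.
have szq : size q = (size rs).+1.
  by rewrite -(size_map_poly iota) Ers size_scale // size_prod_XsubC.
have rs0 : (0 < size rs)%N.
  rewrite lt0n; apply/eqP => s0; move: rq; rewrite Ers (size0nil s0) big_nil.
  by rewrite rootE hornerZ hornerC mulr1 (negPf lq0).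
have [m pm Em] := pfactor_coprime (pcharf_prime pk) rs0.
set e := logn p (size rs) in Em.
have pkb : p \in [pchar kbar] by rewrite (fmorph_pchar iota).
have pkp : p \in [pchar {poly kbar}] by rewrite pchar_poly.
pose w := z ^+ (p ^ e).
have pnat : [pchar {poly kbar}].-nat (p ^ e)%N.
  by rewrite (eq_pnat _ (pcharf_eq pkp)) pnatX pnat_id ?(pcharf_prime pk).
have Eq : map_poly iota q = lead_coef (map_poly iota q) *: (('X + (- w)%:P) ^+ m \Po 'X^(p ^ e)).
  rewrite {1}Ers {1}rsz big_nseq; congr (_ *: _).
  have -> : iter (size rs) ( *%R ('X - z%:P)) 1 = ('X - z%:P) ^+ (p ^ e * m).
    by rewrite mulnC -Em; elim: (size rs) => [|i IH]; rewrite ?expr0 // iterS IH exprS.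
  rewrite exprM rmorphXn /=; congr (_ ^+ m).
  rewrite exprDn_pchar // exprNn_pchar // -polyC_exp.
  by rewrite comp_polyD comp_polyX comp_polyC polyCN.
have pe0 : (0 < p ^ e)%N by rewrite expn_gt0 prime_gt0 ?(pcharf_prime pk).
have m0 : (0 < m)%N by move: rs0; rewrite Em; case: (m).
have /(congr1 (fun f : {poly kbar} => f`_(p ^ e * m.-1))) := Eq.
rewrite coef_map coefZ coef_comp_poly_Xn // dvdn_mulr // mulKn //=.
have [_ _] := coef_XaddC_exp (- w) m.-1; rewrite prednK // => ->.
rewrite lead_coef_map => Ew.
have mk : m%:R != 0 :> k.
  rewrite -(dvdn_pcharf pk); move: pm; rewrite prime_coprime //.
  exact: pcharf_prime pk.
have lk : lead_coef q != 0 by rewrite lead_coef_eq0.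
have {Ew} [c Ew] : exists c, w = iota c.
  exists (- (q`_(p ^ e * m.-1) / lead_coef q / m%:R)).
  rewrite rmorphN !rmorphM !fmorphV Ew rmorph_nat.
  have lk' : iota (lead_coef q) != 0 by rewrite fmorph_eq0.
  have mk' : m%:R != 0 :> kbar by rewrite -(rmorph_nat iota) fmorph_eq0.
  by field; rewrite lk' mk'.
clear Em pnat Eq pe0; subst w; elim: e c Ew => [|e IH] c Ew.
  by exists c; rewrite -Ew expn0 expr1.
have [c1 E1] := hk c; apply: (IH c1); apply: (pexp_inj pkb) => /=.
by rewrite -exprM -expnSr Ew -E1 rmorphXn.
Qed.

End GaloisExtension.

(** * Bases over the prime field *)

Section FpBasis.
Variables (A : finZmodType) (p : nat) (pp : prime p).
Hypothesis killed : forall a : A, a *+ p = 0.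

Lemma mulrn_mod (a : A) n : a *+ (n %% p) = a *+ n.
Proof. by rewrite {2}(divn_eq n p) mulrnDr mulnC mulrnA killed mul0rn add0r. Qed.

Definition FpZ (x : 'F_p) (a : A) := a *+ x.

Lemma FpZ_nat n a : FpZ n%:R a = a *+ n.
Proof. by rewrite /FpZ val_Fp_nat // mulrn_mod. Qed.

Lemma FpZDl x y a : FpZ (x + y) a = FpZ x a + FpZ y a.
Proof. by rewrite -[x]natr_Zp -[y]natr_Zp -natrD !FpZ_nat mulrnDr. Qed.

Lemma FpZDr x a b : FpZ x (a + b) = FpZ x a + FpZ x b.
Proof. by rewrite /FpZ mulrnDl. Qed.

Lemma FpZA x y a : FpZ x (FpZ y a) = FpZ (x * y) a.
Proof. by rewrite -[x]natr_Zp -[y]natr_Zp -natrM !FpZ_nat -mulrnA mulnC. Qed.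

Lemma FpZ1 a : FpZ 1 a = a. Proof. by rewrite -[1]/(1%:R) FpZ_nat. Qed.
Lemma FpZ0 a : FpZ 0 a = 0. Proof. by rewrite -[0]/(0%:R) FpZ_nat. Qed.
Lemma FpZN x a : FpZ (- x) a = - FpZ x a.
Proof. by apply: (addIr (FpZ x a)); rewrite -FpZDl !addNr FpZ0. Qed.

Definition comb d (a : 'I_d -> A) (v : 'rV['F_p]_d) := \sum_i FpZ (v 0 i) (a i).

Lemma combD d (a : 'I_d -> A) u v : comb a (u + v) = comb a u + comb a v.
Proof. by rewrite -big_split; apply: eq_bigr => i _; rewrite mxE FpZDl. Qed.

Lemma combZ d (a : 'I_d -> A) c v : comb a (c *: v) = FpZ c (comb a v).
Proof.
rewrite /comb (big_morph (FpZ c) (FpZDr c) (mul0rn _ _)).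
by apply: eq_bigr => i _; rewrite mxE FpZA.
Qed.

Lemma comb0 d (a : 'I_d -> A) : comb a 0 = 0.
Proof. by rewrite -(scale0r 0) combZ FpZ0. Qed.

Lemma combB d (a : 'I_d -> A) u v : comb a (u - v) = comb a u - comb a v.
Proof. by rewrite combD -scaleN1r combZ FpZN FpZ1. Qed.

(** Independent families are enlarged until they span; one of length [#|A|] would have [p ^ #|A|]
    distinct combinations, more than there are elements. *)
Lemma Fp_basis : exists d (a : 'I_d -> A), bijective (comb a).
Proof.
suff H n : (exists d (a : 'I_d -> A), bijective (comb a)) \/
    exists a : 'I_n -> A, injective (comb a).
  have [//|[a /leq_card]] := H #|A|.
  rewrite card_mx card_Fp // mul1n leqNgt ltn_expl //; exact: prime_gt1.
elim: n => [|n [|[a ainj]]]; [|by left|].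
  right; exists (fun i : 'I_0 => match i with Ordinal _ lt => False_rect _ (notF lt) end).
  by move=> u v _; apply/rowP => -[].
have [asurj|] := pselect (forall x, exists v, comb a v = x).
  left; exists n, a; have /choice[b bK] := asurj.
  by exists b => // v; apply: ainj; rewrite bK.
move=> /existsNP[x nx]; right.
exists (fun i => oapp a x (unlift ord0 i)).
have E v : comb (fun i => oapp a x (unlift ord0 i)) v =
    FpZ (v 0 0) x + comb a (\row_i v 0 (lift ord0 i)).
  rewrite /comb big_ord_recl unlift_none /=; congr (_ + _).
  by apply: eq_bigr => i _; rewrite liftK mxE.
move=> u v /eqP; rewrite -subr_eq0 -combB E; set w := u - v => /eqP E0.
suff w0 : w = 0 by apply/eqP; rewrite -subr_eq0 -/w w0.
have w00 : w 0 0 = 0.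
  apply/eqP; apply: contrapT => /negP w0; apply: nx.
  exists (- (w 0 0)^-1 *: \row_i w 0 (lift ord0 i)); rewrite combZ.
  move/eqP: E0; rewrite addrC addr_eq0 => /eqP ->.
  by rewrite -FpZN FpZA mulrNN mulVf // FpZ1.
rewrite w00 FpZ0 add0r -(comb0 a) in E0; move/ainj/rowP: E0 => E0.
apply/rowP => i; rewrite [RHS]mxE; have [j ->|->//] := unliftP ord0 i.
by have := E0 j; rewrite !mxE.
Qed.

End FpBasis.

Section EtHomTheory.
Variables (k : fieldType) (kbar : closedFieldType) (iota : {rmorphism k -> kbar}).
Variable p : nat.
Implicit Types A B : etGrp iota p.

Lemma et0 A B (f : etHom A B) : f 0 = 0.
Proof. by apply: (addIr (f 0)); rewrite -et_add !add0r. Qed.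

Lemma etN A B (f : etHom A B) x : f (- x) = - f x.
Proof. by apply: (addIr (f x)); rewrite -et_add !addNr et0. Qed.

Lemma etB A B (f : etHom A B) x y : f (x - y) = f x - f y.
Proof. by rewrite et_add etN. Qed.

Lemma actN A s (x : A) : act s (- x) = - act s x.
Proof.
have act0 : act s (0 : A) = 0 by apply: (addIr (act s 0)); rewrite -act_add !add0r.
by apply: (addIr (act s x)); rewrite -act_add !addNr act0.
Qed.

End EtHomTheory.

(** [S] need not be a subspace. As long as the rows found do not span, they kill some nonzero [u],
    and a member of [S] that does not kill [u] is a new independent row. *)
Lemma full_row_basis (F : fieldType) d (S : 'rV[F]_d -> Prop) :
  (forall u : 'cV[F]_d, (forall f, S f -> f *m u = 0) -> u = 0) ->
  exists B : 'M[F]_d, (forall i, S (row i B)) /\ B \in unitmx.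
Proof.
move=> full.
have H r : (r <= d)%N -> exists B : 'M[F]_(r, d), (forall i, S (row i B)) /\ row_free B.
  elim: r => [|r IH] rd; first by exists 0; split => [[]//|]; rewrite -row_leq_rank.
  have [B [SB fB]] := IH (ltnW rd).
  have [u u0 Bu] : exists2 u : 'cV_d, u != 0 & B *m u = 0.
    have : cokermx B != 0.
      by rewrite -mxrank_eq0 mxrank_coker -lt0n subn_gt0 (eqP fB).
    move=> /matrix0Pn[i [j Hij]]; exists (col j (cokermx B)).
      by apply/matrix0Pn; exists i, 0; rewrite mxE.
    by rewrite colE mulmxA mulmx_coker mul0mx.
  have [f Sf fu] : exists2 f, S f & f *m u != 0.
    apply: contrapT => H; move/eqP: u0; apply; apply: full => f Sf.
    by apply/eqP; apply: contrapT => /negP fu; apply: H; exists f.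
  exists (col_mx f B : 'M_(1 + r, d)); split.
    move=> i; rewrite -(splitK (i : 'I_(1 + r))).
    case: fintype.split => j.
      suff : S (row (lshift r j) (col_mx f B)) by [].
      by rewrite rowKu (_ : row j f = f) //; apply/rowP => l; rewrite mxE !ord1.
    suff : S (row (rshift 1 j) (col_mx f B)) by [].
    by rewrite rowKd.
  suff H : row_free (col_mx f B) by [].
  apply: inj_row_free => v; rewrite -[v]hsubmxK mul_row_col => E.
  have E2 : lsubmx v *m (f *m u) = 0.
    have := congr1 (fun w => w *m u) E.
    by rewrite mulmxDl -!mulmxA Bu mulmx0 addr0 mul0mx.
  have r0 : lsubmx v = 0.
    move: E2 fu; rewrite [f *m u]mx11_scalar [lsubmx _]mx11_scalar -scalar_mxM.
    move=> /matrixP/(_ 0 0); rewrite !mxE eqxx mulr1n => /eqP; rewrite mulf_eq0.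
    by move=> /orP[/eqP ->|/eqP ->]; rewrite ?raddf0 ?eqxx.
  move: E; rewrite r0 mul0mx add0r => E.
  by rewrite (row_free_inj fB (_ : rsubmx _ *m B = 0 *m B)) ?mul0mx // row_mx0.
have [B [SB fB]] := H d (leqnn d).
by exists B; split => //; rewrite -row_free_unit.
Qed.

(** * Galois descent by averaging *)

Section GaloisAction.
Variables (k : fieldType) (kbar : closedFieldType) (iota : {rmorphism k -> kbar}).
Hypothesis hbar : forall z : kbar, algebraic_over iota z.
Variable p : nat.
Local Notation gal := (gal iota).

Definition gal_id : gal := @Gal _ _ iota idfun (fun=> erefl).

Definition gal_comp (s t : gal) : gal.
Proof.
refine (@Gal _ _ iota (s \o t) _).
by move=> c /=; rewrite !gal_fix.
Defined.

(** Each element is joined by all the roots of an equation that it satisfies over [k]. *)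
Lemma gal_stable_seq (S : seq kbar) : exists T : seq kbar,
  {subset S <= T} /\ forall (s : gal) t, t \in T -> s t \in T.
Proof.
elim: S => [|x S [T [ST sT]]]; first by exists [::].
have [P P0 rP] := hbar x.
have [rs Ers] := closed_field_poly_normal (map_poly iota P).
have mP0 : map_poly iota P != 0 by rewrite map_poly_eq0.
have rsE t : (t \in rs) = root (map_poly iota P) t.
  by rewrite Ers rootZ ?lead_coef_eq0 // root_prod_XsubC.
exists (rs ++ T); split.
  move=> y; rewrite inE mem_cat => /predU1P[->|/ST ->]; rewrite ?orbT //.
  by rewrite rsE rP.
move=> s t; rewrite !mem_cat => /orP[|/sT ->]; rewrite ?orbT // !rsE => rt.
suff -> : map_poly iota P = map_poly s (map_poly iota P) by rewrite rmorph_root.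
by apply/polyP => i; rewrite !coef_map /= gal_fix.
Qed.

Variable A : etGrp iota p.

Lemma act_stable_seq : exists T : seq kbar,
  (forall (s : gal) t, t \in T -> s t \in T) /\
  forall s t : gal, {in T, s =1 t} -> forall e : A, act s e = act t e.
Proof.
have /choice[S HS] := @act_cont _ _ _ _ A.
have [T [ST sT]] := gal_stable_seq (flatten [seq S e | e <- enum A]).
exists T; split => // s t st e; apply: HS => x xS; apply/st/ST/flattenP.
by exists (S e) => //; apply: map_f; rewrite mem_enum.
Qed.

Section Averaging.
Variable T : seq kbar.
Hypothesis sT : forall (s : gal) t, t \in T -> s t \in T.
Hypothesis actT : forall s t : gal, {in T, s =1 t} -> forall e : A, act s e = act t e.

(** The image of [s] in a finite quotient, namely its action on the stable finite set [T]. *)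
Definition restr (s : gal) : {ffun seq_sub T -> seq_sub T} :=
  [ffun t => SeqSub (sT s (valP t))].

Lemma restrP s t : restr s = restr t <-> {in T, s =1 t}.
Proof.
split=> [/ffunP H x xT|H].
  by have := H (SeqSub xT); rewrite !ffunE => /(congr1 val).
by apply/ffunP => x; rewrite !ffunE; apply/val_inj/H/(valP x).
Qed.

Lemma act_restr s t : restr s = restr t -> forall e : A, act s e = act t e.
Proof. by move=> /restrP; apply: actT. Qed.

Lemma restr_comp s t x : restr (gal_comp s t) x = restr s (restr t x).
Proof. by apply: val_inj; rewrite !ffunE. Qed.

Lemma act_gal_comp s t (e : A) : act (gal_comp s t) e = act s (act t e).
Proof. exact: act_comp. Qed.

Lemma act_gal_id (e : A) : act gal_id e = e.
Proof. exact: act_id. Qed.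

(** Inverses matter only on [T], where [s] induces a permutation of finite order; a power of [s] is
    an inverse there. *)
Lemma gal_inverse s : exists s', restr (gal_comp s' s) = restr gal_id /\
  restr (gal_comp s s') = restr gal_id.
Proof.
have inj : injective (restr s).
  move=> x y /(congr1 val); rewrite !ffunE /= => /fmorph_inj; exact: val_inj.
pose u := perm inj.
pose it n := iter n (gal_comp s) gal_id.
have itE n x : restr (it n) x = (u ^+ n)%g x.
  rewrite permX; elim: n => [|n IH]; first by apply: val_inj; rewrite !ffunE.
  by rewrite /it iterS restr_comp -/(it n) IH iterS permE.
have id1 x : restr gal_id x = x by apply: val_inj; rewrite !ffunE.
exists (it #[u]%g.-1); split; apply/ffunP => x; rewrite restr_comp id1 itE.
  by rewrite -[restr s x](permE inj) -permM -expgS prednK ?order_gt0 // expg_order perm1.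
by rewrite -[LHS](permE inj) -permM -expgSr prednK ?order_gt0 // expg_order perm1.
Qed.

(** Plays the part of the finite extension generated by [T], on which [restr] determines the
    action. *)
Definition in_core c := forall s t : gal, restr s = restr t -> s c = t c.

Lemma core1 : in_core 1. Proof. by move=> s t _; rewrite !rmorph1. Qed.
Lemma coreM c c' : in_core c -> in_core c' -> in_core (c * c').
Proof. by move=> H H' s t st; rewrite !rmorphM (H _ _ st) (H' _ _ st). Qed.
Lemma core_mem c : c \in T -> in_core c.
Proof. by move=> cT s t /restrP; apply. Qed.

(** Dedekind's independence of characters on the monoid [in_core]: the relation at [c * t] minus
    [sg i t] times the relation at [c] has one term less. *)
Lemma dedekind (I : eqType) (sg : I -> gal) (i0 : I) (l : seq I) (x : I -> kbar) :
  (forall i, i \in l -> restr (sg i) != restr (sg i0)) ->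
  (forall c, in_core c -> x i0 * sg i0 c + \sum_(i <- l) x i * sg i c = 0) -> x i0 = 0.
Proof.
elim: l x => [|i l IH] x ne Hx.
  by have := Hx 1 core1; rewrite big_nil addr0 rmorph1 mulr1.
have [t tT nt] : exists2 t, t \in T & sg i t != sg i0 t.
  have := ne i (mem_head _ _); apply: contraNP => H; apply/eqP/restrP => t tT.
  by apply/eqP; apply: contrapT => /negP nt; apply: H; exists t.
have := IH (fun j => x j * (sg j t - sg i t)).
move=> H; have /eqP : x i0 * (sg i0 t - sg i t) = 0.
  apply: H; first by move=> j jl; apply: ne; rewrite inE jl orbT.
  move=> c cc.
  have := Hx (c * t) (coreM cc (core_mem tT)); have := Hx c cc.
  rewrite !big_cons => E1 E2.
  have -> : \sum_(j <- l) x j * (sg j t - sg i t) * sg j c =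
      \sum_(j <- l) x j * sg j (c * t) - sg i t * \sum_(j <- l) x j * sg j c.
    by rewrite mulr_sumr -sumrB; apply: eq_bigr => j _; rewrite rmorphM; ring.
  move: E1 E2; set s1 := \sum_(j <- l) _; set s2 := \sum_(j <- l) _.
  rewrite !rmorphM => E1 E2.
  by rewrite -[RHS](subr0 0) -{1}E2 -[X in _ = _ - X](mulr0 (sg i t)) -{1}E1; ring.
by rewrite mulf_eq0 subr_eq0 [_ == sg i t]eq_sym (negPf nt) orbF => /eqP.
Qed.

(** For every [c] the average of [u] weighted by the conjugates of [c] is Galois equivariant, so it
    satisfies the relation [lam]. By independence of characters the term of the identity vanishes,
    and this is the relation for [u]. *)
Lemma averaging (I : finType) (lam : I -> kbar) (a : I -> A) (u : A -> kbar) :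
  (forall e f, u (e + f) = u e + u f) -> (forall (s : gal) e, s (u e) = u e) ->
  (forall f, dieud f -> \sum_j lam j * f (a j) = 0) ->
  \sum_j lam j * u (a j) = 0.
Proof.
move=> uD us Hlam.
pose R := {ffun seq_sub T -> seq_sub T}.
(* An element of the Galois group is chosen for each restriction that occurs, with the identity as
   default. *)
have /choice[sg Hsg] (phi : R) : exists s, (exists s', restr s' = phi) -> restr s = phi.
  have [[s Hs]|n] := pselect (exists s', restr s' = phi); first by exists s.
  by exists gal_id => /n.
have /choice[inv Hinv] := gal_inverse.
pose P (phi : R) := `[<exists s', restr s' = phi>].
have sgP phi : P phi -> restr (sg phi) = phi by move=> /asboolP/Hsg.
pose tr c : {ffun A -> kbar} :=
  [ffun e => \sum_(phi | P phi) sg phi c * u (act (inv (sg phi)) e)].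
have actinv s (e : A) : act (inv s) (act s e) = e.
  by rewrite -act_gal_comp (act_restr (Hinv s).1) act_gal_id.
have actinv' s (e : A) : act s (act (inv s) e) = e.
  by rewrite -act_gal_comp (act_restr (Hinv s).2) act_gal_id.
have tr_dieud c : in_core c -> dieud (tr c).
  move=> cc; split.
    move=> e f; rewrite !ffunE -big_split; apply: eq_bigr => phi _.
    by rewrite act_add uD mulrDr.
  move=> s e; rewrite !ffunE rmorph_sum /=.
  pose h (phi : R) : R := [ffun x => restr s (phi x)].
  have hinj : injective h.
    move=> phi psi /ffunP H; apply/ffunP => x; have := H x; rewrite !ffunE.
    by move/(congr1 val) => /= E; apply/val_inj/(fmorph_inj s).
  rewrite (reindex_inj hinj) /=.
  have Ph phi : P (h phi) = P phi.
    apply/asboolP/asboolP => -[t Ht]; last first.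
      by exists (gal_comp s t); apply/ffunP => x; rewrite restr_comp Ht [in RHS]ffunE.
    exists (gal_comp (inv s) t); apply/ffunP => x; rewrite restr_comp Ht [h phi x]ffunE.
    rewrite -restr_comp (Hinv s).1; apply: val_inj; by rewrite !ffunE.
  apply: eq_big => // phi; rewrite Ph => Pphi; rewrite rmorphM us.
  have E : restr (sg (h phi)) = restr (gal_comp s (sg phi)).
    by rewrite sgP ?Ph //; apply/ffunP => x; rewrite restr_comp [h phi x]ffunE sgP.
  rewrite (cc _ _ E); congr (_ * u _).
  rewrite -[RHS](actinv (sg (h phi))); congr (act _ _).
  by rewrite (act_restr E) act_gal_comp actinv'.
pose x phi := \sum_j lam j * u (act (inv (sg phi)) (a j)).
have P1 : P (restr gal_id) by apply/asboolP; exists gal_id.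
have : x (restr gal_id) = 0.
  apply: (@dedekind _ sg _ [seq phi <- enum R | P phi && (phi != restr gal_id)]).
    move=> phi; rewrite mem_filter => /andP[/andP[Pphi ne] _].
    by rewrite !sgP.
  move=> c cc; rewrite big_filter big_enum_cond /=.
  rewrite (eq_bigl (fun phi => P phi && (phi != restr gal_id))); last first.
    by [].
  rewrite -(bigD1 (restr gal_id) (F := fun phi => x phi * sg phi c)) //=.
  rewrite -[RHS](Hlam _ (tr_dieud c cc)).
  under [RHS]eq_bigr => j _ do rewrite ffunE mulr_sumr.
  rewrite exchange_big /=; apply: eq_bigr => phi _.
  by rewrite /x mulr_suml; apply: eq_bigr => j _; ring.
move=> x0; rewrite -[RHS]x0; apply: eq_bigr => j _; congr (_ * u _).
by rewrite -[LHS](actinv (sg (restr gal_id))) (act_restr (sgP _ P1)) act_gal_id.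
Qed.

End Averaging.
End GaloisAction.

(** * Bases of the Dieudonne module and matrices of endomorphisms *)

Section DieudonneBasis.
Variables (k : fieldType) (kbar : closedFieldType) (iota : {rmorphism k -> kbar}).
Variables (p : nat) (pk : p \in [pchar k]) (hk : perfect_char k p).
Hypothesis hbar : forall z : kbar, algebraic_over iota z.
Let pp : prime p := pcharf_prime pk.
Let pkb : p \in [pchar kbar] := pcharkbar iota pk.

Lemma Fp_natr_mod n : (n %% p)%:R = n%:R :> kbar.
Proof. by rewrite {2}(divn_eq n p) natrD natrM (pcharf0 pkb) mulr0 add0r. Qed.

Lemma Fp_natrD (x y : 'F_p) : (nat_of_ord (x + y))%:R = (nat_of_ord x)%:R + (nat_of_ord y)%:R :> kbar.
Proof.
have -> : x + y = (nat_of_ord x + nat_of_ord y)%:R by rewrite natrD !natr_Zp.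
by rewrite val_Fp_nat // Fp_natr_mod natrD.
Qed.

Section Basis.
Variable A : etGrp iota p.

(** M(A) spans all additive maps to [kbar]: a vector [u] orthogonal to it is, by [averaging],
    orthogonal to each coordinate function of the F_p-basis, hence zero. *)
Lemma dieudonne_basis : exists d (a : 'I_d -> A) (b : 'I_d -> {ffun A -> kbar}),
  [/\ bijective (comb (p := p) a), forall i, dieud (b i)
    & (\matrix_(i, j) b i (a j)) \in unitmx].
Proof.
have [d [a bija]] := Fp_basis pp (@killed_by_p _ _ _ _ A).
have [T [sT actT]] := act_stable_seq hbar A.
pose S (f : 'rV[kbar]_d) := exists2 h : {ffun A -> kbar}, dieud h & f = \row_j h (a j).
have [u Hu|B [SB uB]] := @full_row_basis kbar d S.
  apply/colP => i; rewrite mxE.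
  have [ainv aK Ka] := bija.
  pose v (e : A) : kbar := (nat_of_ord (ainv e 0 i))%:R.
  have := averaging sT actT (lam := fun j => u j 0) (a := a) (u := v).
  have ainvD e f : ainv (e + f) = ainv e + ainv f.
    by rewrite -(aK (ainv e + ainv f)) combD // ?Ka //; apply: killed_by_p.
  have ainva j : ainv (a j) = delta_mx 0 j.
    rewrite -(aK (delta_mx 0 j)); congr ainv.
    rewrite /comb (bigD1 j) //= mxE !eqxx FpZ1 ?big1 ?addr0 //; last exact: killed_by_p.
    move=> l lj; rewrite mxE (negPf lj) andbF FpZ0 //; exact: killed_by_p.
  move=> H; rewrite -[RHS]H; first last.
  - move=> f df; have := Hu (\row_j f (a j)).
    move=> /(_ (ex_intro2 _ _ f df erefl))/matrixP/(_ 0 0).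
    by rewrite !mxE => E; rewrite -[RHS]E; apply: eq_bigr => j _; rewrite mxE mulrC.
  - by move=> s e; rewrite /v rmorph_nat.
  - by move=> e f; rewrite /v ainvD mxE Fp_natrD.
  rewrite (bigD1 i) //= big1 ?addr0 /v ?ainva ?mxE ?eqxx ?mulr1 //.
  by move=> j ji; rewrite ainva mxE eq_sym (negPf ji) andbF mulr0.
have /choice[b Hb] i : exists h : {ffun A -> kbar}, dieud h /\ row i B = \row_j h (a j).
  by have [h dh E] := SB i; exists h.
exists d, a, b; split => //; first by move=> i; case: (Hb i).
suff -> : \matrix_(i, j) b i (a j) = B by [].
by apply/matrixP => i j; have /rowP/(_ j) := (Hb i).2; rewrite !mxE.
Qed.

Variables (d : nat) (a : 'I_d -> A) (b : 'I_d -> {ffun A -> kbar}).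
Hypotheses (bija : bijective (comb (p := p) a)) (db : forall i, dieud (b i)).
Local Notation Pi := (\matrix_(i, j) b i (a j)).
Hypothesis uPi : Pi \in unitmx.

Lemma card_points : #|A| = (p ^ d)%N.
Proof. by rewrite -(bij_eq_card bija) card_mx card_Fp // mul1n. Qed.

Lemma additive_comb (f : A -> kbar) : (forall e e', f (e + e') = f e + f e') ->
  forall v : 'rV['F_p]_d, f (comb a v) = \sum_j (nat_of_ord (v 0 j))%:R * f (a j).
Proof.
move=> fD v; have f0 : f 0 = 0 by apply: (addIr (f 0)); rewrite -fD !add0r.
rewrite /comb (big_morph f fD f0); apply: eq_bigr => j _.
by rewrite /FpZ; elim: (nat_of_ord _) => [|n IH]; rewrite ?mul0r // mulrS fD IH -nat1r mulrDl mul1r.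
Qed.

Lemma additive_eq (f h : {ffun A -> kbar}) :
  (forall e e', f (e + e') = f e + f e') -> (forall e e', h (e + e') = h e + h e') ->
  (forall j, f (a j) = h (a j)) -> f = h.
Proof.
move=> fD hD fh; have [ainv aK Ka] := bija.
apply/ffunP => e; rewrite -(Ka e) !additive_comb //.
by apply: eq_bigr => j _; rewrite fh.
Qed.

Definition lin (c : 'rV[kbar]_d) : {ffun A -> kbar} := [ffun e => \sum_i c 0 i * b i e].

Lemma linD c e e' : lin c (e + e') = lin c e + lin c e'.
Proof.
rewrite !ffunE -big_split; apply: eq_bigr => i _.
by case: (db i) => -> _; rewrite mulrDr.
Qed.

Lemma lin_add c c' e : lin (c + c') e = lin c e + lin c' e.
Proof. by rewrite !ffunE -big_split; apply: eq_bigr => i _; rewrite mxE mulrDl. Qed.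

Lemma lin_scale x c e : lin (x *: c) e = x * lin c e.
Proof. by rewrite !ffunE mulr_sumr; apply: eq_bigr => i _; rewrite mxE mulrA. Qed.

Lemma lin_sub c c' e : lin (c - c') e = lin c e - lin c' e.
Proof. by rewrite lin_add -scaleN1r lin_scale mulN1r. Qed.

Lemma lin0 e : lin 0 e = 0.
Proof. by rewrite -(scale0r 0) lin_scale mul0r. Qed.

Lemma lin_row c : \row_j lin c (a j) = c *m Pi.
Proof. by apply/rowP => j; rewrite !mxE ffunE; apply: eq_bigr => i _; rewrite mxE. Qed.

Lemma lin_inj : injective lin.
Proof.
move=> c c' E; apply: (can_inj (mulmxK uPi)).
by rewrite -!lin_row E.
Qed.

Lemma lin_surj (f : {ffun A -> kbar}) : (forall e e', f (e + e') = f e + f e') ->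
  exists c, f = lin c.
Proof.
move=> fD; exists (\row_j f (a j) *m invmx Pi).
apply: additive_eq => //; first exact: linD.
move=> j; have := lin_row (\row_j f (a j) *m invmx Pi).
by rewrite mulmxKV // => /rowP/(_ j); rewrite !mxE.
Qed.

Lemma lin_dieud (c : 'rV[k]_d) : dieud (lin (map_mx iota c)).
Proof.
split=> [|s e]; first exact: linD.
rewrite !ffunE rmorph_sum; apply: eq_bigr => i _.
by case: (db i) => _ ->; rewrite rmorphM mxE gal_fix.
Qed.

(** The coordinates over [kbar] are unique, hence Galois invariant, hence in [k]. *)
Lemma dieud_lin f : dieud f -> exists c : 'rV[k]_d, f = lin (map_mx iota c).
Proof.
move=> [fD fs]; have [c Ec] := lin_surj fD.
have fixc (s : gal iota) : map_mx s c = c.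
  have us : map_mx s Pi \in unitmx by rewrite map_unitmx.
  apply: (can_inj (mulmxK us)); rewrite -map_mxM -lin_row.
  apply/rowP => j; rewrite !mxE -Ec -fs Ec ffunE; apply: eq_bigr => i _.
  by rewrite !mxE; case: (db i) => _ ->.
have /choice[c0 Hc0] i : exists x, c 0 i = iota x.
  by apply: (gal_fixed hbar pk hk) => s; rewrite -[in RHS](fixc s) mxE.
exists (\row_i c0 i); rewrite Ec; congr lin.
by apply/rowP => i; rewrite !mxE.
Qed.

Definition klin (c : 'rV[k]_d) := lin (map_mx iota c).

Lemma klin_inj : injective klin.
Proof. by move=> c c' /lin_inj/map_mx_inj; apply; exact: fmorph_inj. Qed.

Lemma klin0 : klin 0 = 0.
Proof. by apply/ffunP => e; rewrite /klin map_mx0 lin0 ffunE. Qed.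

Lemma klinD c c' : klin (c + c') = klin c + klin c'.
Proof. by apply/ffunP => e; rewrite [RHS]ffunE /klin map_mxD lin_add. Qed.

Lemma klinZ x c : dieud_scale x (klin c) = klin (x *: c).
Proof. by apply/ffunP => e; rewrite [LHS]ffunE /klin map_mxZ lin_scale. Qed.

Lemma klin_bigsum m (w : 'I_m -> 'rV_d) : \sum_i klin (w i) = klin (\sum_i w i).
Proof. exact/esym/(big_morph klin klinD klin0). Qed.

Section Endo.
Variable h : A -> A.
Hypothesis hD : forall e e', h (e + e') = h e + h e'.
Hypothesis hs : forall (s : gal iota) e, h (act s e) = act s (h e).

Lemma endo_matrix : exists H : 'M[k]_d,
  (forall c e, klin c (h e) = klin (c *m H) e) /\
  (forall c e, lin c (h e) = lin (c *m map_mx iota H) e).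
Proof.
pose bh i : {ffun A -> kbar} := [ffun e => b i (h e)].
have dbh i : dieud (bh i).
  by case: (db i) => bD bs; split=> *; rewrite !ffunE ?hD ?bD ?hs ?bs.
have /choice[r Hr] i := dieud_lin (dbh i).
have E c e : lin c (h e) = lin (c *m map_mx iota (\matrix_i r i)) e.
  rewrite !ffunE.
  have -> : \sum_i c 0 i * b i (h e) = \sum_i c 0 i * (\sum_j iota (r i 0 j) * b j e).
    apply: eq_bigr => i _; have := Hr i => /ffunP/(_ e).
    by rewrite !ffunE => ->; congr (_ * _); apply: eq_bigr => j _; rewrite mxE.
  under eq_bigr => i _ do rewrite mulr_sumr.
  rewrite exchange_big; apply: eq_bigr => j _; rewrite mxE mulr_suml.
  by apply: eq_bigr => i _; rewrite !mxE mulrA.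
exists (\matrix_i r i); split => c e //.
by rewrite /klin E map_mxM.
Qed.

(* On an F_p-basis of A and on a Dieudonne basis, h has conjugate matrices. *)
Lemma card_image_rank (H : 'M[k]_d) :
  (forall c e, lin c (h e) = lin (c *m map_mx iota H) e) ->
  #|[set h e | e : A]| = (p ^ \rank H)%N.
Proof.
move=> EH; have [ainv aK Ka] := bija.
pose D : 'M['F_p]_d := \matrix_i ainv (h (a i)).
have hcomb (v : 'rV['F_p]_d) : h (comb a v) = comb a (v *m D).
  have h0 : h 0 = 0 by apply: (addIr (h 0)); rewrite -hD !add0r.
  have kA := @killed_by_p _ _ _ _ A.
  rewrite /comb (big_morph h hD h0).
  have -> : \sum_i FpZ ((v *m D) 0 i) (a i) = comb a (\sum_i v 0 i *: row i D).
    by rewrite -mulmx_sum_row.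
  rewrite (big_morph (comb a) (combD pp kA a) (comb0 pp kA a)).
  apply: eq_bigr => i _; rewrite (combZ pp kA) rowK Ka /FpZ.
  by elim: (nat_of_ord _) => [|n IH]; rewrite ?mulr0n // !mulrS hD IH.
pose f (x : 'F_p) : kbar := (nat_of_ord x)%:R.
have fB : zmod_morphism f.
  move=> x y; apply: (addIr (f y)); rewrite subrK -Fp_natrD; congr f.
  by rewrite subrK.
have fM : monoid_morphism f.
  split; first by rewrite -[RHS](Fp_natr_mod 1) -(val_Fp_nat pp).
  move=> x y; have -> : x * y = (nat_of_ord x * nat_of_ord y)%:R.
    by rewrite natrM !natr_Zp.
  by rewrite /f val_Fp_nat // Fp_natr_mod natrM.
pose fr : {rmorphism 'F_p -> kbar} := HB.pack f
  (GRing.isZmodMorphism.Build _ _ f fB) (GRing.isMonoidMorphism.Build _ _ f fM).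
(* Both sides have the entries [b i (h (a j))], computed in the two bases. *)
have E : map_mx iota H *m Pi = Pi *m (map_mx fr D)^T.
  apply/matrixP => i j.
  have : (\row_j lin (delta_mx 0 i) (h (a j))) 0 j = (map_mx iota H *m Pi) i j.
    rewrite mxE EH; have /rowP/(_ j) := lin_row (delta_mx 0 i *m map_mx iota H).
    by rewrite mxE => ->; rewrite -mulmxA -rowE mxE.
  move=> <-; rewrite !mxE.
  have -> : h (a j) = comb (p := p) a (row j D) by rewrite rowK Ka.
  rewrite additive_comb; last exact: linD.
  apply: eq_bigr => l _; have /rowP/(_ l) := lin_row (delta_mx 0 i).
  rewrite mxE => ->; rewrite -rowE !mxE mulrC; congr (_ * _).
have rk : \rank H = \rank D.
  rewrite -(mxrank_map iota H) -(mxrankMfree (map_mx iota H) (B := Pi)); last first.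
    by rewrite row_free_unit.
  rewrite E -mxrank_tr trmx_mul trmxK mxrankMfree ?mxrank_map //.
  by rewrite row_free_unit unitmx_tr.
have -> : [set h e | e : A] = [set comb a v | v in rowg D].
  apply/setP => e; apply/imsetP/imsetP => -[x Hx ->].
    by exists (ainv x *m D); rewrite ?inE ?submxMl // -hcomb Ka.
  move: Hx; rewrite inE => /submxP[v ->].
  by exists (comb a v); rewrite ?inE ?hcomb.
rewrite card_imset; last exact: bij_inj.
by rewrite card_rowg card_Fp // rk.
Qed.

End Endo.
End Basis.
End DieudonneBasis.

(** * Jordan blocks of a nilpotent matrix *)

Section MatrixPowers.
Variables (F : fieldType) (d : nat) (D : 'M[F]_d).

Definition mpow n := iter n (mulmx D) 1%:M.

Lemma mpowS n : mpow n.+1 = D *m mpow n. Proof. by []. Qed.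

Lemma mpowSr n : mpow n.+1 = mpow n *m D.
Proof.
elim: n => [|n IH]; first by rewrite /mpow /= mulmx1 mul1mx.
by rewrite mpowS {1}IH mulmxA -mpowS.
Qed.

Lemma mpow_add m n : mpow (m + n) = mpow m *m mpow n.
Proof.
elim: m => [|m IH]; first by rewrite /= mul1mx.
by rewrite addSn mpowS IH mulmxA -mpowS.
Qed.

(* The number of Jordan blocks of D of size greater than i. *)
Definition layer i := \rank (mpow i :&: kermx D)%MS.

Lemma rank_layer i : (\rank (mpow i.+1) + layer i = \rank (mpow i))%N.
Proof. by rewrite mpowSr mxrank_mul_ker. Qed.

Lemma layer_decr i j : (i <= j)%N -> (layer j <= layer i)%N.
Proof.
move=> ij; apply/mxrankS/capmxS => //.
by rewrite -(subnK ij) mpow_add submxMl.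
Qed.

Variable p : nat.
Hypotheses (p0 : (0 < p)%N) (Dp : mpow p = 0).

Lemma layer_last : layer p.-1 = \rank (mpow p.-1).
Proof. by rewrite -(rank_layer p.-1) prednK // Dp mxrank0. Qed.

Lemma layer_sum : d = (\sum_(i < p) layer i)%N.
Proof.
suff H n : (\rank (mpow n) + \sum_(i < n) layer i = d)%N.
  by rewrite -{1}(H p) Dp mxrank0.
elim: n => [|n IH]; first by rewrite big_ord0 addn0 mxrank1.
by rewrite big_ord_recr addnCA rank_layer addnC.
Qed.

(** The power [p.-1] has one dimension for each block of size [p], the largest possible size. *)
Lemma rank_last_le : (p * \rank (mpow p.-1) <= d)%N.
Proof.
rewrite [leqRHS]layer_sum -layer_last -[p in (p * _)%N]card_ord -sum_nat_const.
by apply: leq_sum => i _; apply: layer_decr; have := ltn_ord i; lia.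
Qed.

(** There are r + 1 blocks, of which r have size p. The kernel is not inside the image, so some
    block has size 1, and it is the remaining one. *)
Lemma almost_free (r : nat) : \rank (mpow p.-1) = r -> \rank (kermx D) = r.+1 ->
  ~~ (kermx D <= D)%MS -> (1 < p)%N -> d = (p * r).+1.
Proof.
move=> rN rK nKD p1.
have l0 : layer 0 = r.+1.
  by rewrite -rK /layer /= cap1mx.
have l1 : (layer 1 <= r)%N.
  rewrite -ltnS -rK /layer; have -> : mpow 1 = D by rewrite /mpow /= mulmx1.
  rewrite ltn_neqAle mxrankS ?capmxSr // andbT; apply: contra nKD => /eqP E.
  have := mxrank_leqif_sup (capmxSr D (kermx D)).
  move=> /leqifP; rewrite E; case: ifP => [+ _|_]; last by rewrite ltnn.
  by rewrite sub_capmx => /andP[].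
have li i : (0 < i < p)%N -> layer i = r.
  move=> /andP[i0 ip]; apply/eqP; rewrite eqn_leq.
  rewrite (leq_trans (layer_decr i0) l1) -[leqLHS]rN -layer_last.
  by apply: layer_decr; lia.
rewrite {1}layer_sum; case: p p1 li => // q p1 li.
rewrite big_ord_recl l0 (eq_bigr (fun=> r)) => [|i _].
  by rewrite sum_nat_const card_ord mulSn.
by apply: li; rewrite /= ltnS ltn_ord.
Qed.

Lemma mpow_poly (G : 'M[F]_d) n : D = G - 1%:M ->
  exists a : nat -> F, a n = 1 /\
    mpow n = \sum_(j < n.+1) a j *: iter j (mulmx G) 1%:M.
Proof.
move=> E; elim: n => [|n [a [an IH]]].
  by exists (fun=> 1); rewrite big_ord1 scale1r.
exists (fun j => (if j == 0%N then 0 else a j.-1) - (if j == n.+1 then 0 else a j)).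
rewrite /= eqxx subr0; split => //.
under eq_bigr => j _ do rewrite scalerBl.
rewrite sumrB [X in _ = X - _]big_ord_recl [X in _ = _ - X]big_ord_recr /=.
rewrite eqxx !scale0r add0r addr0 {1}E mulmxBl mul1mx IH mulmx_sumr.
congr (_ - _); apply: eq_bigr => j _.
  by rewrite -scalemxAr.
by rewrite ltn_eqF.
Qed.

End MatrixPowers.

(** * Free modules over the group algebra *)

Section Families.
Variables (F : fieldType) (d : nat) (I : finType) (v : I -> 'rV[F]_d).

Definition fam := \matrix_(i < #|I|) v (enum_val i).

Lemma fam_mul (u : 'rV[F]_#|I|) : u *m fam = \sum_i u 0 (enum_rank i) *: v i.
Proof.
rewrite mulmx_sum_row (reindex (@enum_rank I)) /=; last exact/onW_bij/enum_rank_bij.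
by apply: eq_bigr => i _; rewrite rowK !enum_rankK.
Qed.

Definition coefs (c : I -> F) : 'rV_#|I| := \row_i c (enum_val i).

Lemma coefsE c i : coefs c 0 (enum_rank i) = c i.
Proof. by rewrite mxE enum_rankK. Qed.

Lemma fam_coefs (c : I -> F) : coefs c *m fam = \sum_i c i *: v i.
Proof. by rewrite fam_mul; apply: eq_bigr => i _; rewrite coefsE. Qed.

Lemma fam_free : (forall c : I -> F, \sum_i c i *: v i = 0 -> forall i, c i = 0) ->
  row_free fam.
Proof.
move=> H; apply: inj_row_free => u; rewrite fam_mul => /H u0.
by apply/rowP => i; have := u0 (enum_val i); rewrite enum_valK mxE.
Qed.

Lemma fam_freeP (c : I -> F) : row_free fam -> \sum_i c i *: v i = 0 -> forall i, c i = 0.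
Proof.
move=> fr; rewrite -fam_coefs -[RHS](mul0mx _ fam) => /(row_free_inj fr)/rowP H i.
by have := H (enum_rank i); rewrite coefsE mxE.
Qed.

Lemma fam_full : (forall w, exists c : I -> F, w = \sum_i c i *: v i) -> row_full fam.
Proof.
move=> H; rewrite -sub1mx; apply/row_subP => i.
have [c ->] := H (row i 1%:M); rewrite -fam_coefs; exact: submxMl.
Qed.

Lemma fam_fullP w : row_full fam -> exists c : I -> F, w = \sum_i c i *: v i.
Proof.
move=> fu; have /submxP[u ->] : (w <= fam)%MS by apply: submx_full.
by exists (fun i => u 0 (enum_rank i)); rewrite fam_mul.
Qed.

Lemma fam_square : #|I| = d -> row_free fam = row_full fam.
Proof. by rewrite /row_free /row_full; move: (\rank _) => n ->. Qed.

Lemma fam_basis_card : row_free fam -> row_full fam -> #|I| = d.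
Proof. by rewrite /row_free /row_full; move: (\rank _) => n /eqP <- /eqP. Qed.

End Families.

Section FreeModules.
Variables (F : fieldType) (d p : nat) (G : 'M[F]_d).
Hypothesis p0 : (0 < p)%N.
Local Notation D := (G - 1%:M).
Hypothesis Dp : mpow D p = 0.
Local Notation fG b := (fam (fun t : 'I__ * 'I_p => b t.1 *m mpow G t.2)).

(** In [mpow D p.-1] the power [p.-1] of [G] has coefficient 1, so the images of the basis elements
    under it are independent. *)
Lemma free_rank r (b : 'I_r -> 'rV[F]_d) : row_free (fG b) -> row_full (fG b) ->
  (p * \rank (mpow D p.-1))%N = d.
Proof.
move=> fr fu; have := fam_basis_card fr fu; rewrite card_prod !card_ord => rd.
apply/eqP; rewrite eqn_leq rank_last_le //= -[leqLHS]rd mulnC leq_mul2l.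
apply/orP; right; have [a [a1 Ea]] := mpow_poly p.-1 (erefl D).
pose B := \matrix_i b i.
have : row_free (B *m mpow D p.-1).
  apply: inj_row_free => u; rewrite Ea mulmxA mulmx_sumr => E.
  apply/rowP => i; rewrite mxE.
  have Ep : (p.-1.+1 = p)%N by rewrite prednK.
  have H : \sum_(t : 'I_r * 'I_p) (u 0 t.1 * a t.2) *: (b t.1 *m mpow G t.2) = 0.
    rewrite -(pair_bigA _ (fun (i : 'I_r) (j : 'I_p) => (u 0 i * a j) *: (b i *m mpow G j))) exchange_big /=.
    rewrite -[RHS]E; move: (p.-1.+1) Ep => q Eq; subst q; apply: eq_bigr => j _.
    rewrite -[RHS]scalemxAr -mulmxA mulmx_sum_row scaler_sumr; apply: eq_bigr => l _.
    by rewrite row_mul rowK scalerA mulrC.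
  have lp : (p.-1 < p)%N by rewrite prednK.
  have := fam_freeP (c := fun t : 'I_r * 'I_p => u 0 t.1 * a t.2) fr H (i, Ordinal lp).
  by rewrite /= a1 mulr1.
by move=> /eqP {1}<-; apply: mxrankM_maxr.
Qed.

(** Preimages of a basis of the image of [mpow D p.-1] are free generators. *)
Lemma rank_free : (p * \rank (mpow D p.-1))%N = d ->
  exists r (b : 'I_r -> 'rV[F]_d), row_free (fG b) /\ row_full (fG b).
Proof.
move=> rd; set N := mpow D p.-1 in rd; set r := \rank N in rd.
have /submxP[B EB] : (row_base N <= N)%MS by rewrite eq_row_base.
exists r, (fun i => row i B).
have cardI : #|{: 'I_r * 'I_p}| = d by rewrite card_prod !card_ord mulnC.
suff fu : row_full (fG (fun i => row i B)) by rewrite fam_square.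
have frD : row_free (fam (fun t : 'I_r * 'I_p => row t.1 B *m mpow D t.2)).
  apply: fam_free => c E.
  (* By induction on [j]: multiplying the relation by the power [p.-1 - j] of [D] kills the higher
     terms and turns those of index [j] into basis vectors of the image of [N]. *)
  suff H s : forall i (j : 'I_p), (j < s)%N -> c (i, j) = 0 by move=> [i j]; apply: (H p).
  elim: s => // s IH i j; rewrite ltnS leq_eqVlt => /orP[/eqP js|/IH//].
  have : \sum_l c (l, j) *: (row l B *m N) = 0.
    have E' : \sum_l \sum_(j' < p) (c (l, j') *: (row l B *m mpow D j')) *m
        mpow D (p.-1 - j) = 0.
      rewrite -[RHS](mul0mx _ (mpow D (p.-1 - j))) -[in RHS]E mulmx_suml pair_bigA.
      by apply: eq_bigr => -[].
    rewrite -[RHS]E'.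
    apply: eq_bigr => l _; rewrite (bigD1 j) //= big1 ?addr0 => [|j' jj].
      rewrite -scalemxAl -mulmxA -mpow_add subnKC //.
      by have := ltn_ord j; lia.
    rewrite -scalemxAl -mulmxA -mpow_add; have [lt|ge] := ltnP j' s.
      by rewrite IH ?scale0r.
    have jj' : (nat_of_ord j' != j) by apply: contra jj => /eqP jE; apply/eqP/val_inj.
    have -> : (j' + (p.-1 - j) = p + (j' - j.+1))%N.
      by have := ltn_ord j; move: jj' ge; rewrite js => ?; lia.
    by rewrite mpow_add Dp mul0mx mulmx0 scaler0.
  move=> H; have fb := row_base_free N; rewrite -/r EB in fb.
  have : (\row_l c (l, j)) *m (B *m N) = 0.
    rewrite mulmx_sum_row -[RHS]H; apply: eq_bigr => l _.
    by rewrite mxE row_mul.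
  rewrite -[RHS](mul0mx _ (B *m N)) => /(row_free_inj fb)/rowP/(_ i).
  by rewrite !mxE.
rewrite fam_square // in frD.
(* Powers of [D] are combinations of powers of [G], so spanning passes from the first family to the
   second. *)
have inspan (w : 'rV[F]_d) : (w <= fG (fun i => row i B))%MS.
  have [c ->] := fam_fullP w frD; apply: summx_sub => -[i j] _; apply: scalemx_sub.
  have [a [_ ->]] := mpow_poly j (erefl D).
  rewrite mulmx_sumr; apply: summx_sub => l _; rewrite -scalemxAr; apply: scalemx_sub.
  have lp : (l < p)%N by have := ltn_ord l; have := ltn_ord j; lia.
  have -> : row (i, j).1 B *m iter l (mulmx G) 1%:M
     = row (enum_rank (i, Ordinal lp)) (fG (fun i => row i B)).
    by rewrite rowK enum_rankK.
  exact: row_sub.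
by rewrite -sub1mx; apply/row_subP => i.
Qed.

End FreeModules.

(** * Freeness as a condition on orders *)

Section GModel.
Variables (k : fieldType) (kbar : closedFieldType) (iota : {rmorphism k -> kbar}).
Variables (p : nat) (pk : p \in [pchar k]) (hk : perfect_char k p).
Hypothesis hbar : forall z : kbar, algebraic_over iota z.
Let pp : prime p := pcharf_prime pk.
Let p0 : (0 < p)%N := prime_gt0 pp.

Lemma delta_iterD (J : gGrp iota p) n (e e' : J) :
  iter n (@delta _ _ _ _ J) (e + e') = iter n (@delta _ _ _ _ J) e + iter n (@delta _ _ _ _ J) e'.
Proof. exact: (iter_difD (et_add (gam J))). Qed.

Lemma delta_iter_p (J : gGrp iota p) (e : J) : iter p (@delta _ _ _ _ J) e = 0.
Proof.
apply: (iter_dif_p (et_add (gam J)) pp); first exact: killed_by_p.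
exact: gam_order.
Qed.

(** On groups killed by p, delta^(p-1) is the norm 1 + gamma + ... + gamma^(p-1). *)
Definition norm_image (J : gGrp iota p) : {set J} :=
  [set iter p.-1 (@delta _ _ _ _ J) e | e : J].

Section Model.
Variable J : gGrp iota p.
Variables (d : nat) (a : 'I_d -> J) (b : 'I_d -> {ffun J -> kbar}).
Hypotheses (bija : bijective (comb (p := p) a)) (db : forall i, dieud (b i)).
Hypothesis uPi : (\matrix_(i, j) b i (a j)) \in unitmx.
Local Notation lin := (lin b).
Local Notation klin := (klin b).
Variable G : 'M[k]_d.
Hypothesis klinG : forall c e, klin c (gam J e) = klin (c *m G) e.
Hypothesis linG : forall c e, lin c (gam J e) = lin (c *m map_mx iota G) e.
Local Notation D := (G - 1%:M).
Local Notation dl := (@delta _ _ _ _ J).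

Lemma lin_delta c e : lin c (dl e) = lin (c *m map_mx iota D) e.
Proof.
rewrite map_mxB map_mx1 mulmxBr mulmx1 lin_sub -linG /delta.
rewrite (linD db); congr (_ + _); apply: (addIr (lin c e)).
by rewrite -(linD db) !addNr -[in LHS](subrr e); apply: (addIr (lin c e));
   rewrite add0r -(linD db) subrK.
Qed.

Lemma lin_delta_iter n c e : lin c (iter n dl e) = lin (c *m map_mx iota (mpow D n)) e.
Proof.
elim: n c => [|n IH] c; first by rewrite map_mx1 mulmx1.
by rewrite iterS lin_delta IH mpowS map_mxM mulmxA.
Qed.

Lemma klin_delta_iter n c e : klin c (iter n dl e) = klin (c *m mpow D n) e.
Proof. by rewrite /klin lin_delta_iter -map_mxM. Qed.

Lemma klin_gam_iter n c e : klin c (iter n (gam J) e) = klin (c *m mpow G n) e.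
Proof.
elim: n c => [|n IH] c; first by rewrite mulmx1.
by rewrite iterS klinG IH mpowS mulmxA.
Qed.

Lemma mpow_delta_p : mpow D p = 0.
Proof.
apply/row_matrixP => i; rewrite row0; apply: (klin_inj uPi).
apply/ffunP => e; rewrite rowE -klin_delta_iter delta_iter_p.
rewrite /klin map_mx0 lin0; apply: (addIr (lin (map_mx iota (delta_mx 0 i)) 0)).
by rewrite -(linD db) !add0r.
Qed.

Lemma card_delta_iter n : #|[set iter n dl e | e : J]| = (p ^ \rank (mpow D n))%N.
Proof.
exact: (card_image_rank pk bija db uPi (@delta_iterD J n) (lin_delta_iter n)).
Qed.

Lemma klin_sum (I : finType) (c : I -> k) (v : I -> 'rV[k]_d) e :
  klin (\sum_i c i *: v i) e = \sum_i iota (c i) * klin (v i) e.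
Proof.
rewrite /klin -[RHS]/(\sum_i iota (c i) * lin (map_mx iota (v i)) e).
elim/big_rec2: _ => [|i x y _ <-]; first by rewrite map_mx0 lin0.
by rewrite map_mxD map_mxZ lin_add lin_scale.
Qed.

Lemma klin_group_sum r (be : 'I_r -> 'rV[k]_d) (c : 'M[k]_(r, p)) e :
  \sum_(i < r) \sum_(j < p) iota (c i j) * klin (be i) (iter j (gam J) e)
  = klin (\sum_(t : 'I_r * 'I_p) c t.1 t.2 *: (be t.1 *m mpow G t.2)) e.
Proof.
rewrite klin_sum pair_bigA /=; apply: eq_bigr => t _.
by rewrite klin_gam_iter.
Qed.

Lemma gfree_model : gfree J <-> (p * \rank (mpow D p.-1))%N = d.
Proof.
split.
  move=> [r [bb [dbb Hb]]].
  have /choice[be Hbe] i := dieud_lin pk hk hbar bija db uPi (dbb i).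
  have K (c : 'M[k]_(r, p)) e :
      \sum_(i < r) \sum_(j < p) iota (c i j) * bb i (iter j (gam J) e)
      = klin (\sum_(t : 'I_r * 'I_p) c t.1 t.2 *: (be t.1 *m mpow G t.2)) e.
    rewrite -klin_group_sum; apply: eq_bigr => i _; apply: eq_bigr => j _.
    by rewrite Hbe.
  apply: (free_rank (b := be) p0 mpow_delta_p).
    apply: fam_free => c Hc [i j].
    have [c0 [_ Hu]] := Hb 0 (dieud0 J).
    have e1 := Hu 0; have e2 := Hu (\matrix_(i, j) c (i, j)).
    suff : (\matrix_(i, j) c (i, j) : 'M[k]_(r, p)) = 0.
      by move/matrixP/(_ i j); rewrite !mxE.
    rewrite -e2 ?e1 // => e; rewrite K.
      rewrite big1 => [|t _]; last by rewrite mxE scale0r.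
      by rewrite klin0.
    rewrite (eq_bigr (fun t => c t *: (be t.1 *m mpow G t.2))).
      by rewrite Hc klin0.
    by move=> [i' j'] _; rewrite mxE.
  apply: fam_full => w.
  have [c [Hc _]] := Hb _ (lin_dieud db w).
  exists (fun t => c t.1 t.2); apply: (klin_inj uPi); apply/ffunP => e.
  by rewrite -K -Hc.
move=> rd; have [r [be [fr fu]]] := rank_free p0 mpow_delta_p rd.
exists r, (fun i => klin (be i)); split; first by move=> i; apply: lin_dieud.
have K := klin_group_sum be.
move=> f df; have [w Ew] := dieud_lin pk hk hbar bija db uPi df.
have [c Ec] := fam_fullP w fu.
exists (\matrix_(i, j) c (i, j)); split.
  move=> e; rewrite K Ew -[lin _]/(klin w); congr (klin _ e); rewrite Ec.
  by apply: eq_bigr => -[i j] _; rewrite mxE.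
move=> c' Hc'; apply/matrixP => i j; rewrite mxE; apply/eqP; rewrite -subr_eq0; apply/eqP.
apply: (fam_freeP (c := fun t => c t - c' t.1 t.2) fr _ (i, j)).
under eq_bigr => t _ do rewrite scalerBl.
rewrite sumrB -Ec; apply/eqP; rewrite subr_eq0; apply/eqP.
apply: (klin_inj uPi); apply/ffunP => e.
by rewrite -K -Hc' Ew.
Qed.

Lemma gfree_card_model : gfree J <-> (#|norm_image J| ^ p)%N = #|J|.
Proof.
rewrite gfree_model card_delta_iter (card_points pk bija) // -expnM [(_ * p)%N]mulnC.
by split=> [->//|/eqP]; rewrite eqn_exp2l ?prime_gt1 // => /eqP.
Qed.

End Model.

Lemma g_model (J : gGrp iota p) : exists d (a : 'I_d -> J) (b : 'I_d -> {ffun J -> kbar})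
    (G : 'M[k]_d),
  [/\ bijective (comb (p := p) a), forall i, dieud (b i),
      (\matrix_(i, j) b i (a j)) \in unitmx,
      forall c e, klin b c (gam J e) = klin b (c *m G) e
    & forall c e, lin b c (gam J e) = lin b (c *m map_mx iota G) e].
Proof.
have [d [a [b [bija db uPi]]]] := dieudonne_basis pk hbar J.
have [G [H1 H2]] := endo_matrix pk hk hbar bija db uPi (et_add (gam J))
  (fun s e => et_act (gam J) s e).
by exists d, a, b, G.
Qed.

Lemma gfreeP (J : gGrp iota p) : gfree J <-> (#|norm_image J| ^ p)%N = #|J|.
Proof.
have [d [a [b [G [bija db uPi H1 H2]]]]] := g_model J.
exact: (gfree_card_model bija db uPi H1 H2).
Qed.

End GModel.

(** * Subobjects and quotients *)

Lemma card_ker_im (A B : finZmodType) (h : A -> B) :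
  (forall x y, h (x + y) = h x + h y) ->
  (#|[set x | (h x == 0)%R]| * #|[set h x | x : A]|)%N = #|A|.
Proof.
move=> hD; have h0 : h 0 = 0 by apply: (addIr (h 0)); rewrite -hD !add0r.
rewrite -[RHS]sum1_card (partition_big_imset h) /= mulnC.
rewrite -sum_nat_const; apply: eq_bigr => _ /imsetP[x _ ->].
rewrite sum1dep_card -[LHS](card_imset _ (addrI x)).
apply: eq_card => z; rewrite [in RHS]inE.
apply/imsetP/eqP => [[y]|hz].
  by rewrite inE => /eqP hy ->; rewrite hD hy addr0.
exists (z - x); last by rewrite addrC subrK.
by rewrite inE; apply/eqP/(addIr (h x)); rewrite -hD subrK add0r.
Qed.

Section Subquotients.
Variables (k : fieldType) (kbar : closedFieldType) (iota : {rmorphism k -> kbar}).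
Variables (p : nat) (J : gGrp iota p) (S : {set J}).
Hypotheses (S0 : 0 \in S) (SB : forall x y, x \in S -> y \in S -> x - y \in S).
Hypotheses (Sact : forall s x, x \in S -> act s x \in S).
Hypotheses (Sgam : forall x, x \in S -> gam J x \in S).

Let SN x : x \in S -> - x \in S.
Proof. by move=> Sx; rewrite -[- x]add0r; apply: SB. Qed.

Let SD x y : x \in S -> y \in S -> x + y \in S.
Proof. by move=> Sx Sy; rewrite -[y]opprK; apply: SB => //; apply: SN. Qed.

Lemma sub_gGrp : exists (K : gGrp iota p) (i : etHom K J),
  [/\ gequiv i, injective i & forall x, x \in S <-> exists y, i y = x].
Proof.
pose T := {x : J | x \in S}.
pose sub x (Sx : x \in S) : T := exist _ x Sx.
pose add (x y : T) : T := sub _ (SD (valP x) (valP y)).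
pose zero : T := sub _ S0.
pose opp (x : T) : T := sub _ (SN (valP x)).
have addA : associative add by move=> x y z; apply: val_inj; rewrite /= addrA.
have addC : commutative add by move=> x y; apply: val_inj; rewrite /= addrC.
have add0 : left_id zero add by move=> x; apply: val_inj; rewrite /= add0r.
have addN : left_inverse zero opp add by move=> x; apply: val_inj; rewrite /= addNr.
pose Z : finZmodType := HB.pack T (GRing.isZmodule.Build T addA addC add0 addN).
have valD (x y : Z) : val (x + y) = val x + val y by [].
have val0 : val (0 : Z) = 0 by [].
pose actK (s : gal iota) (x : Z) : Z := sub _ (Sact s (valP x)).
have a1 s x y : actK s (x + y) = actK s x + actK s y.
  by apply: val_inj; rewrite valD /= act_add.
have a2 (s : gal iota) : s =1 id -> forall e, actK s e = e.
  by move=> s1 e; apply: val_inj; rewrite /= act_id.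
have a3 (s t u : gal iota) : u =1 s \o t -> forall e, actK u e = actK s (actK t e).
  by move=> H e; apply: val_inj; rewrite /= (act_comp H).
have a4 (e : Z) : exists S0 : seq kbar, forall s t : gal iota,
    {in S0, s =1 t} -> actK s e = actK t e.
  have [S1 H] := act_cont (val e); exists S1 => s t st.
  by apply: val_inj; rewrite /= (H s t).
have a5 (e : Z) : e *+ p = 0.
  have H n : val (e *+ n) = val e *+ n by elim: n => // n IH; rewrite !mulrS valD IH.
  by apply: val_inj; rewrite H killed_by_p.
pose E := EtGrp a1 a2 a3 a4 a5.
pose gamK (x : E) : E := sub _ (Sgam (valP x)).
have g1 (x y : E) : gamK (x + y) = gamK x + gamK y.
  by apply: val_inj; rewrite valD /= et_add.
have g2 s (x : E) : gamK (act s x) = act s (gamK x).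
  by apply: val_inj; rewrite /= et_act.
have g3 (x : E) : iter p (EtHom g1 g2) x = x.
  have H n : val (iter n (EtHom g1 g2) x) = iter n (gam J) (val x).
    by elim: n => // n IH; rewrite !iterS -IH.
  by apply: val_inj; rewrite H gam_order.
exists (GGrp g3), (@EtHom _ _ _ _ E J val valD (fun _ _ => erefl)).
split => // x; split=> [Sx|[y <-]]; last exact: (valP (y : T)).
by exists (sub _ Sx : E).
Qed.

(** A canonical element of each coset, so that the quotient is carried by a finite subtype of
    [J]. *)
Definition coset_rep (x : J) : J := odflt x [pick y | y - x \in S].

Lemma coset_repP x : coset_rep x - x \in S.
Proof.
by rewrite /coset_rep; case: pickP => [y //|/(_ x)]; rewrite /= subrr S0.
Qed.

Lemma coset_rep_eq x y : x - y \in S -> coset_rep x = coset_rep y.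
Proof.
move=> xy; rewrite /coset_rep.
rewrite (eq_pick (_ : (fun z => z - x \in S) =1 (fun z => z - y \in S))).
  by case: pickP => // /(_ y); rewrite subrr S0.
move=> z; apply/idP/idP => H.
  by have := SD H xy; rewrite addrA subrK.
by have := SB H xy; rewrite opprB addrA subrK.
Qed.

Lemma coset_rep_idem x : coset_rep (coset_rep x) == coset_rep x.
Proof. exact/eqP/coset_rep_eq/coset_repP. Qed.

Lemma quot_gGrp : exists (Q : gGrp iota p) (q : etHom J Q),
  [/\ gequiv q, forall c, exists e, q e = c & forall e, q e = 0 <-> e \in S].
Proof.
pose T := {x : J | coset_rep x == x}.
pose mk x : T := exist (fun x => coset_rep x == x) _ (coset_rep_idem x).
have mkE x y : x - y \in S -> mk x = mk y.
  by move=> H; apply: val_inj; apply: coset_rep_eq.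
have mkval (x : T) : mk (val x) = x by apply: val_inj; apply/eqP/(valP x).
have mkS x : val (mk x) - x \in S by apply: coset_repP.
pose add (x y : T) : T := mk (val x + val y).
have mkD x y : add (mk x) (mk y) = mk (x + y).
  by apply: mkE; rewrite opprD addrACA; apply: SD.
pose opp (x : T) : T := mk (- val x).
have surj (x : T) : exists y, x = mk y by exists (val x).
have addA : associative add.
  move=> x y z; have [x' ->] := surj x; have [y' ->] := surj y; have [z' ->] := surj z.
  by rewrite !mkD addrA.
have addC : commutative add by move=> x y; rewrite /add addrC.
have add0 : left_id (mk 0) add.
  by move=> x; have [x' ->] := surj x; rewrite mkD add0r.
have addN : left_inverse (mk 0) opp add.
  by move=> x; rewrite -{2}(mkval x) mkD addNr.
pose Z : finZmodType := HB.pack T (GRing.isZmodule.Build T addA addC add0 addN).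
have mkDZ x y : (mk (x + y) : Z) = (mk x : Z) + (mk y : Z) by rewrite -mkD.
have mk0 : (mk 0 : Z) = 0 by [].
pose actK (s : gal iota) (x : Z) : Z := mk (act s (val x)).
have mka s x : actK s (mk x) = mk (act s x).
  by apply: mkE; rewrite -actN -act_add; apply: Sact.
have a1 s x y : actK s (x + y) = actK s x + actK s y.
  have [x' ->] := surj x; have [y' ->] := surj y.
  by rewrite -mkDZ !mka act_add mkDZ.
have a2 (s : gal iota) : s =1 id -> forall e, actK s e = e.
  by move=> s1 e; have [e' ->] := surj e; rewrite mka act_id.
have a3 (s t u : gal iota) : u =1 s \o t -> forall e, actK u e = actK s (actK t e).
  by move=> H e; have [e' ->] := surj e; rewrite !mka (act_comp H).
have a4 (e : Z) : exists S0 : seq kbar, forall s t : gal iota,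
    {in S0, s =1 t} -> actK s e = actK t e.
  have [S1 H] := act_cont (val e); exists S1 => s t st.
  by rewrite /actK (H s t).
have a5 (e : Z) : e *+ p = 0.
  have [e' ->] := surj e.
  have H n : (mk e' : Z) *+ n = mk (e' *+ n) by elim: n => // n IH; rewrite !mulrS mkDZ IH.
  by rewrite H killed_by_p.
pose E := EtGrp a1 a2 a3 a4 a5.
pose gamK (x : E) : E := mk (gam J (val x)).
have mkg x : gamK (mk x) = mk (gam J x).
  by apply: mkE; rewrite -etN -et_add; apply: Sgam.
have g1 (x y : E) : gamK (x + y) = gamK x + gamK y.
  have [x' ->] := surj x; have [y' ->] := surj y.
  by rewrite -[_ + _]mkDZ !mkg et_add mkDZ.
have g2 s (x : E) : gamK (act s x) = act s (gamK x).
  by have [x' ->] := surj x; rewrite -[act s _]/(actK s _) mka !mkg et_act -mka.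
have g3 (x : E) : iter p (EtHom g1 g2) x = x.
  have [x' ->] := surj x.
  have H n : iter n (EtHom g1 g2) (mk x') = mk (iter n (gam J) x').
    by elim: n => // n IH; rewrite !iterS IH /= mkg.
  by rewrite H gam_order.
have q2 s e : (mk (act s e) : E) = act s (mk e : E) by rewrite -mka.
exists (GGrp g3), (@EtHom _ _ _ _ J E mk mkDZ q2); split.
- by move=> e; rewrite /= mkg.
- by move=> c; have [e ->] := surj c; exists e.
move=> e; rewrite -[q in q = _]/(mk e : Z) -mk0; split=> [H|Se].
  have := coset_repP 0; rewrite -[coset_rep 0]/(val (mk 0)) -H subr0 => H1.
  by have := SB H1 (mkS e); rewrite opprB addrC subrK.
by apply: mkE; rewrite subr0.
Qed.

End Subquotients.

(** * The order of J_Y[p]_et *)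

Section DeuringShafarevich.
Variables (k : fieldType) (p : nat) (pk : p \in [pchar k]) (hk : perfect_char k p).
Variables (kbar : closedFieldType) (iota : {rmorphism k -> kbar}).
Hypothesis hbar : forall z : kbar, algebraic_over iota z.
Variables (X Y : curve k) (pi : galois_cover p X Y).
Variables (eta : cochain X) (heta : torsor_class pi eta).
Variables (JX : etGrp iota p) (thX : {ffun JX -> kbar} -> cochain X).
Hypothesis hJX : is_jac_et thX.
Variables (JY : gGrp iota p) (thY : {ffun JY -> kbar} -> cochain Y).
Hypothesis hJY : is_jac_et_G pi thY.
Variables (s : etHom JX (Zp_et iota pk)) (hs : is_canonical_surj eta thX s).
Local Notation dl := (@delta _ _ _ _ JY).

Let pp : prime p := pcharf_prime pk.
Let p0 : (0 < p)%N := prime_gt0 pp.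

Lemma coh_sum (Z : curve k) (I : finType) (A B : I -> place Z -> Z) :
  (forall i, coh (A i) (B i)) ->
  coh (fun P => \sum_i A i P) (fun P => \sum_i B i P).
Proof.
move=> /choice[h H]; exists (\sum_i h i) => P.
rewrite -sumrB -sumrB; by apply: vring_sum => i _; apply: H.
Qed.

Definition eta_fun : {ffun JX -> kbar} := [ffun e => (nat_of_ord (s e))%:R].

Lemma dieud_eta : dieud eta_fun.
Proof.
split=> [e e'|t e]; rewrite !ffunE; last by rewrite et_act rmorph_nat.
by rewrite et_add -(Fp_natrD iota pk).
Qed.

Lemma eta_fun_eq0 : eta_fun = 0 -> forall e, s e = 0.
Proof.
move=> /ffunP H e; have := H e; rewrite !ffunE => /eqP.
rewrite -(dvdn_pcharf (pcharkbar iota pk)) => d.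
have lt : (s e < p)%N by rewrite -[X in (_ < X)%N](card_Fp pp) card_ord ltn_ord.
apply: val_inj => /=; case: (posnP (nat_of_ord (s e))) => // s0.
by have := dvdn_leq s0 d; rewrite leqNgt lt.
Qed.

Section Lift.
Variable r : place Y -> place X.
Hypothesis Hr : forall Q, lies_over (cpi pi) Q (r Q).

(** Pulling back to Y kills [eta], so a relation among the [h i] modulo [eta] becomes one among the
    [f i], whose repartitions detect classes by [tau_inj]. *)
Lemma lift_independent n (f : 'I_n -> {ffun JY -> kbar}) (h : 'I_n -> {ffun JX -> kbar})
    (u : 'I_n -> k) (x : k) :
  (forall i, dieud (f i)) -> (forall i, dieud (h i)) ->
  (forall i, coh (thY (f i)).2 (pullf pi r (thX (h i)).2)) ->
  \sum_i dieud_scale (u i) (h i) + dieud_scale x eta_fun = 0 ->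
  \sum_i dieud_scale (u i) (f i) = 0.
Proof.
move=> df dh fh E; apply: (tau_inj pk hJY.1).
  by apply: dieud_sum => i; apply: dieudZ.
apply: coh_trans (tau_sum hJY.1 _ (fun i => dieudZ (u i) (df i))) _.
have H1 := coh_sum (fun i => tauZ hJY.1 (u i) (df i)).
apply: coh_trans H1 _; have H2 := coh_sum (fun i => coh_scale (u i) (fh i)).
apply: coh_trans H2 _.
have ds : dieud (\sum_i dieud_scale (u i) (h i)).
  by apply: dieud_sum => i; apply: dieudZ.
have H3 := tauD hJX ds (dieudZ x dieud_eta); rewrite E in H3.
have H4 := coh_trans (coh_sym (tau0 hJX)) H3.
have H5 := coh_trans (tau_sum hJX (index_enum _) (fun i => dieudZ (u i) (dh i)))
  (coh_sum (fun i => tauZ hJX (u i) (dh i))).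
have H6 := coh_trans (tauZ hJX x dieud_eta) (coh_scale x (cohom_coh hs)).
have H7 := coh_pull Hr (coh_trans H4 (coh_add H5 H6)).
apply: coh_sym; have H8 := coh_scale x (pull_eta heta Hr).
have H9 := coh_sub H7 (coh_sym H8).
move: H9; congr coh; apply/funext => Q; rewrite /pullf; first by rewrite rmorph0 mulr0 subr0.
rewrite rmorphD rmorphM cpi_cst addrK rmorph_sum; apply: eq_bigr => i _.
by rewrite rmorphM cpi_cst.
Qed.

End Lift.

Lemma invariant_not_dif d (a : 'I_d -> JY) (b : 'I_d -> {ffun JY -> kbar}) (G : 'M[k]_d) r :
  bijective (comb (p := p) a) -> (forall i, dieud (b i)) ->
  (\matrix_(i, j) b i (a j)) \in unitmx ->
  (forall c e, klin b c (gam JY e) = klin b (c *m G) e) ->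
  \rank (kermx (G - 1%:M)) = r.+1 -> #|[set e | s e == 0]| = (p ^ r)%N ->
  ~~ (kermx (G - 1%:M) <= G - 1%:M)%MS.
Proof.
move=> bija db uPi klinG rK cs; apply/negP => sub.
case: (heta) => _ _ [y [gy Hy]].
have /choice[rs Hrs] := fun Q => restrict_place pk gy Q.
have inv c : (c <= kermx (G - 1%:M))%MS -> dieud_comp (gam JY) (klin b c) = klin b c.
  move=> /sub_kermxP; rewrite mulmxBr mulmx1 => /eqP; rewrite subr_eq0 => /eqP E.
  by apply/ffunP => e; rewrite ffunE klinG E.
have Hd f : dieud f -> dieud_comp (gam JY) f = f ->
    exists2 x, repartition x & coh (thY f).2 (pullf pi rs x).
  move=> df ff; have [c Ec] := dieud_lin pk hk hbar bija db uPi df.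
  rewrite -[lin _ _]/(klin b c) in Ec.
  have cK : (c <= kermx (G - 1%:M))%MS.
    apply/sub_kermxP; rewrite mulmxBr mulmx1; apply/eqP; rewrite subr_eq0; apply/eqP.
    by apply: (klin_inj uPi); apply/ffunP => e; rewrite -klinG -Ec -{2}ff ffunE.
  have /submxP[w Ew] := submx_trans cK sub.
  apply: (invariant_descent pk heta hJY Hrs df (lin_dieud db w) ff).
  apply/ffunP => e; rewrite ffunE [RHS]ffunE.
  rewrite -[lin _ _]/(klin b w) klinG Ec Ew mulmxBr mulmx1.
  by rewrite /klin map_mxB lin_sub subrK.
pose f i := klin b (row i (row_base (kermx (G - 1%:M)))).
have df i : dieud (f i) by apply: lin_dieud.
have ff i : dieud_comp (gam JY) (f i) = f i.
  by apply: inv; apply: submx_trans (row_sub _ _) _; rewrite eq_row_base.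
have /choice[h Hh] i : exists h, dieud h /\ coh (thY (f i)).2 (pullf pi rs (thX h).2).
  by have [h dh H] := invariant_lift pk hk heta hJX hJY Hrs Hd (df i) (ff i); exists h.
have dh i : dieud (h i) by case: (Hh i).
have [dX [aX [bX [bijX dbX uX]]]] := dieudonne_basis pk hbar JX.
have /choice[c Hc] i : exists c, h i = klin bX c.
  exact: (dieud_lin pk hk hbar bijX dbX uX (dh i)).
have [ce Ece] := dieud_lin pk hk hbar bijX dbX uX dieud_eta.
rewrite -[lin _ _]/(klin bX ce) in Ece.
pose C := \matrix_i c i.
(* The lifts stay independent modulo [eta], because their pull backs are independent. *)
have key (u : 'rV_(\rank (kermx (G - 1%:M)))) (x : k) :
    u *m C + x *: ce = 0 -> u = 0.
  move=> E.
  have E1 : \sum_i dieud_scale (u 0 i) (h i) + dieud_scale x eta_fun = 0.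
    rewrite (eq_bigr (fun i => klin bX (u 0 i *: c i))); last first.
      by move=> i _; rewrite Hc klinZ.
    rewrite Ece klinZ klin_bigsum -klinD.
    have -> : \sum_i u 0 i *: c i = u *m C.
      by rewrite mulmx_sum_row; apply: eq_bigr => i _; rewrite rowK.
    by rewrite E klin0.
  have := lift_independent Hrs df dh (fun i => (Hh i).2) E1.
  rewrite (eq_bigr (fun i => klin b (u 0 i *: row i (row_base (kermx (G - 1%:M)))))).
    rewrite klin_bigsum -mulmx_sum_row => E2; apply: (row_free_inj (row_base_free _)).
    by rewrite mul0mx; apply: (klin_inj uPi); rewrite E2 klin0.
  by move=> i _; rewrite klinZ.
have frC : row_free C.
  apply: inj_row_free => u uC; apply: (key u 0).
  by rewrite uC scale0r addr0.
have cardX := card_points pk bijX.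
have kerim := card_ker_im (et_add s); rewrite cs cardX in kerim.
(* If [s] is zero, M(J_X[p]_et) has dimension [r], too small for the r + 1 lifts. Otherwise [eta] is
   nonzero and makes r + 2 independent classes, while the dimension is at most r + 1. *)
have [s0|ns0] := pselect (forall e, s e = 0).
  have Es : #|[set e | s e == 0]| = #|JX| by apply: eq_card => e; rewrite inE s0 eqxx.
  have : (p ^ dX)%N = (p ^ r)%N by rewrite -cardX -cs Es.
  move=> /eqP; rewrite eqn_exp2l ?prime_gt1 // => /eqP dXr.
  have : (r.+1 <= dX)%N by rewrite -rK -(eqP frC) rank_leq_col.
  by rewrite dXr ltnn.
have frC' : row_free (col_mx C ce).
  apply: inj_row_free => u; rewrite -[u]hsubmxK mul_row_col.
  rewrite [rsubmx u]mx11_scalar mul_scalar_mx => E.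
  have u0 := key _ _ E; rewrite u0 mul0mx add0r in E.
  have [x0|x0] := eqVneq (rsubmx u 0 0) 0.
    by rewrite u0 x0 raddf0 row_mx0.
  move/eqP: E; rewrite scaler_eq0 (negPf x0) /= => /eqP ce0.
  by exfalso; apply: ns0; apply: eta_fun_eq0; rewrite Ece ce0 klin0.
have le : (r.+2 <= dX)%N.
  by rewrite -addn1 -rK -(eqP frC') rank_leq_col.
have : (p ^ dX <= p ^ r * p)%N.
  rewrite -kerim leq_mul2l; apply/orP; right.
  by apply: leq_trans (max_card _) _; rewrite card_Fp.
by rewrite -expnSr leq_exp2l ?prime_gt1 // leqNgt le.
Qed.

Lemma card_jacobian r :
  #|[set e : JY | dl e == 0]| = (p ^ r.+1)%N -> #|norm_image JY| = (p ^ r)%N ->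
  #|[set e | s e == 0]| = (p ^ r)%N -> #|JY| = (p ^ (p * r).+1)%N.
Proof.
move=> cK cN cs; have [d [a [b [G [bija db uPi H1 H2]]]]] := g_model pk hk hbar JY.
have p1 := prime_gt1 pp.
have cJ := card_points pk bija.
have c1 := card_delta_iter pk bija db uPi H2.
have rN : \rank (mpow (G - 1%:M) p.-1) = r.
  by apply/eqP; rewrite -(eqn_exp2l _ _ p1) -(c1 p.-1) -cN.
have rK : \rank (kermx (G - 1%:M)) = r.+1.
  rewrite mxrank_ker.
  have := card_ker_im (@delta_iterD k kbar iota p JY 1).
  rewrite (c1 1%N) cJ -[iter 1 _]/dl.
  have -> : mpow (G - 1%:M) 1 = G - 1%:M by rewrite /mpow /= mulmx1.
  rewrite (_ : [set x | _] = [set e : JY | dl e == 0]) // cK -expnD.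
  by move=> /eqP; rewrite eqn_exp2l // => /eqP E; rewrite -[X in (X - _)%N]E addnK.
have nsub := invariant_not_dif bija db uPi H1 rK cs.
by rewrite cJ; congr (_ ^ _)%N; apply: (almost_free p0 (mpow_delta_p pk db uPi H2) rN rK nsub).
Qed.

End DeuringShafarevich.

(** The blocks of size [p] use up the whole dimension, so there are no others. *)
Lemma layer_free (F : fieldType) d p (D : 'M[F]_d) : (0 < p)%N -> mpow D p = 0 ->
  (p * \rank (mpow D p.-1))%N = d -> \rank (kermx D) = \rank (mpow D p.-1).
Proof.
move=> p0 Dp E; have l0 : layer D 0 = \rank (kermx D) by rewrite /layer /= cap1mx.
rewrite -l0 -(layer_last p0 Dp); apply/eqP; rewrite eqn_leq (@layer_decr _ _ D 0 _ (leq0n _)) andbT.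
have := layer_sum Dp; rewrite -[in LHS]E -(layer_last p0 Dp).
have : (\sum_(i < p.-1) layer D p.-1 <= \sum_(i < p.-1) layer D i.+1)%N.
  by apply: leq_sum => i _; apply: layer_decr; have := ltn_ord i; lia.
rewrite sum_nat_const card_ord.
case: (p) p0 => // q _ /=; rewrite big_ord_recl /= mulSn.
by move: (\sum_(i < q) _)%N (layer D 0) (layer D q) => s u v; lia.
Qed.

(** * Exact sequences of etale group schemes *)

Section EtHoms.
Variables (k : fieldType) (kbar : closedFieldType) (iota : {rmorphism k -> kbar}).
Variable p : nat.
Implicit Types A B C : etGrp iota p.

Lemma exact_card A B C (i : etHom A B) (f : etHom B C) : exact_seq i f ->
  (#|A| * #|C|)%N = #|B|.
Proof.
move=> [[ii ki] fs]; rewrite -(card_ker_im (et_add f)); congr (_ * _)%N.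
  rewrite -(card_imset predT ii); apply: eq_card => x; rewrite [RHS]inE.
  by apply/imsetP/eqP => [[n _ ->]|/ki[n <-]]; [apply/ki; exists n|exists n].
apply: eq_card => y; rewrite [LHS]inE.
by apply/esym/imsetP; have [x <-] := fs y; exists x.
Qed.

Definition et_comp A B C (g : etHom B C) (f : etHom A B) : etHom A C.
Proof.
refine (@EtHom _ _ _ _ A C (g \o f) _ _) => *; rewrite /= ?et_add //.
by rewrite !et_act.
Defined.

Lemma delta_equiv (A B : gGrp iota p) (f : etHom A B) n e : gequiv f ->
  f (iter n (@delta _ _ _ _ A) e) = iter n (@delta _ _ _ _ B) (f e).
Proof.
by move=> fe; elim: n => // n IH; rewrite !iterS -IH /delta etB fe.
Qed.

Lemma Fp_linear (pp : prime p) (V : finZmodType) (killed : forall v : V, v *+ p = 0)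
    (f : 'F_p -> V) : (forall x y, f (x + y) = f x + f y) -> forall x, f x = f 1 *+ x.
Proof.
move=> fD x; have f0 : f 0 = 0 by apply: (addIr (f 0)); rewrite -fD !add0r.
rewrite -[in LHS](natr_Zp x); elim: (nat_of_ord x) => [|n IH]; first by rewrite mulr0n.
by rewrite mulrSr fD IH mulrSr.
Qed.

Lemma image_norm (A B : gGrp iota p) (q : etHom A B) : gequiv q ->
  (forall c, exists e, q e = c) -> norm_image B = [set q x | x in norm_image A].
Proof.
move=> qe qs; apply/setP => y; apply/imsetP/imsetP => [[c _ ->]|[_ /imsetP[e _ ->] ->]].
  have [e <-] := qs c; exists (iter p.-1 (@delta _ _ _ _ A) e); first by apply/imsetP; exists e.
  by rewrite delta_equiv.
by exists (q e) => //; rewrite delta_equiv.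
Qed.

End EtHoms.

(** * Splittings, free quotients and free subgroups *)

Section Splitting.
Variables (k : fieldType) (p : nat) (pk : p \in [pchar k]) (hk : perfect_char k p).
Variables (kbar : closedFieldType) (iota : {rmorphism k -> kbar}).
Hypothesis hbar : forall z : kbar, algebraic_over iota z.
Let pp : prime p := pcharf_prime pk.
Let p0 : (0 < p)%N := prime_gt0 pp.
Let p1 : (1 < p)%N := prime_gt1 pp.
Local Notation Zp := (Zp_et iota pk).
Local Notation ZpG := (Zp_G iota pk).

Lemma card_Zp : #|Zp| = p. Proof. exact: card_Fp. Qed.

(** The norm image is contained in the kernel of delta, and by [layer_free] the two have the same
    order. *)
Lemma gfree_kernel (K : gGrp iota p) : gfree K -> forall y : K, delta y = 0 ->
  y \in norm_image K.
Proof.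
have [d [a [b [G [bija db uPi H1 H2]]]]] := g_model pk hk hbar K.
move=> /(gfree_model pk hk hbar bija db uPi H1 H2) rd y dy.
have Dp := mpow_delta_p pk db uPi H2.
have rk := layer_free p0 Dp rd.
have c1 := card_delta_iter pk bija db uPi H2.
have cK : #|[set e : K | delta e == 0]| = #|norm_image K|.
  rewrite /norm_image c1 -rk.
  have := card_ker_im (@delta_iterD k kbar iota p K 1).
  rewrite (c1 1%N) (card_points pk bija) -[iter 1 _]/(@delta _ _ _ _ K).
  have -> : mpow (G - 1%:M) 1 = G - 1%:M by rewrite /mpow /= mulmx1.
  rewrite mxrank_ker => E; have p_gt : (0 < p ^ \rank (G - 1%:M)%R)%N by rewrite expn_gt0 p0.
  apply/eqP; rewrite -(eqn_pmul2r p_gt) E -expnD subnK //.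
  exact: rank_leq_row.
have sub : norm_image K \subset [set e : K | delta e == 0].
  apply/fintype.subsetP => _ /imsetP[e _ ->]; rewrite inE -iterS prednK //.
  by rewrite delta_iter_p.
have /eqP -> : norm_image K == [set e : K | delta e == 0].
  by rewrite eqEcard sub cK leqnn.
by rewrite inE dy eqxx.
Qed.

Variables (JY : gGrp iota p) (GX : etGrp iota p).
Variables (Jker : etGrp iota p) (inJ : etHom Jker JY) (hker : is_delta_kernel inJ).
Variables (Jcok : etGrp iota p) (prJ : etHom JY Jcok) (hcok : is_delta_cokernel prJ).
Variables (a1 : etHom GX Jker) (a2 : etHom Jker Zp) (ha : exact_seq a1 a2).
Variables (b1 : etHom Zp Jcok) (b2 : etHom Jcok GX) (hb : exact_seq b1 b2).
Local Notation dl := (@delta _ _ _ _ JY).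
Local Notation N := (iter p.-1 dl).
Hypothesis hb2 : forall e : JY, inJ (a1 (b2 (prJ e))) = N e.

Lemma a1_inj : injective a1. Proof. by case: ha => [[]]. Qed.
Lemma b1_inj : injective b1. Proof. by case: hb => [[]]. Qed.
Lemma inJ_inj : injective inJ. Proof. by case: hker. Qed.

Lemma norm_imageP x : x \in norm_image JY <-> exists g, x = inJ (a1 g).
Proof.
split=> [/imsetP[e _ ->]|[g ->]]; first by exists (b2 (prJ e)).
have [c <-] := hb.2 g; have [e <-] := hcok.1 c.
by apply/imsetP; exists e.
Qed.

Lemma card_norm_image : #|norm_image JY| = #|GX|.
Proof.
rewrite -(card_imset predT (inj_comp inJ_inj a1_inj)); apply: eq_card => x.
by apply/idP/imsetP => [/norm_imageP[g ->]|[g _ ->]]; [exists g|apply/norm_imageP; exists g].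
Qed.

Lemma norm_eq0 e : N e = 0 <-> exists z, b1 z = prJ e.
Proof.
rewrite -(hb.1.2 (prJ e)) -hb2; split=> [|->]; last by rewrite !et0.
by rewrite -[X in _ = X](et0 inJ) => /inJ_inj; rewrite -(et0 a1) => /a1_inj.
Qed.

Lemma card_delta_kernel : #|[set e : JY | delta e == 0]| = (#|GX| * p)%N.
Proof.
have -> : #|[set e : JY | delta e == 0]| = #|Jker|.
  rewrite -cardsT -(card_imset _ inJ_inj); apply: eq_card => e; rewrite [LHS]inE.
  apply/eqP/imsetP => [/hker.2[n <-]|[n _ ->]]; first by exists n.
  by apply/hker.2; exists n.
by rewrite -(exact_card ha) card_Zp.
Qed.

Variable r : nat.
Hypotheses (cGX : #|GX| = (p ^ r)%N) (cJY : #|JY| = (p ^ (p * r).+1)%N).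

Lemma gfree_card_norm (K : gGrp iota p) : #|K| = (p ^ (p * r))%N ->
  gfree K <-> #|norm_image K| = (p ^ r)%N.
Proof.
move=> cK; rewrite (gfreeP pk hk hbar) cK mulnC expnM.
by split=> [/eqP|->//]; rewrite eqn_exp2r // => /eqP.
Qed.

Lemma equiv_trivial (i : etHom ZpG JY) : gequiv i -> forall c, delta (i c) = 0.
Proof. by move=> ie c; rewrite /delta -ie subrr. Qed.

Lemma card_quotient (Q : gGrp iota p) (i : etHom ZpG JY) (q : etHom JY Q) :
  exact_seq i q -> #|Q| = (p ^ (p * r))%N.
Proof.
move=> /exact_card/eqP.
by rewrite cJY card_Zp expnS eqn_pmul2l // => /eqP.
Qed.

Lemma card_subgroup (K : gGrp iota p) (i : etHom K JY) (q : etHom JY ZpG) :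
  exact_seq i q -> #|K| = (p ^ (p * r))%N.
Proof.
move=> /exact_card/eqP.
by rewrite cJY card_Zp expnSr eqn_pmul2r // => /eqP.
Qed.

Lemma section_off_norm (t : etHom Zp Jker) : (forall c, a2 (t c) = c) ->
  forall c, inJ (t c) \in norm_image JY -> c = 0.
Proof.
move=> ht c /norm_imageP[g /inJ_inj E]; rewrite -(ht c) E.
by apply/ha.1.2; exists g.
Qed.

Lemma section_equiv (t : etHom Zp Jker) :
  gequiv (et_comp inJ t : etHom ZpG JY).
Proof.
move=> c; have : delta (inJ (t c)) = 0 by apply/hker.2; exists (t c).
by move/eqP; rewrite subr_eq0 => /eqP.
Qed.

(** [JY] is divided by the image of the section. That image meets the norm image in 0 only, so the
    norm image keeps its order in the quotient. *)
Lemma split_a_quotient : splits a2 ->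
  exists (Q : gGrp iota p) (i : etHom ZpG JY) (q : etHom JY Q),
    [/\ gequiv i, gequiv q, exact_seq i q & gfree Q].
Proof.
move=> [t ht]; pose i : etHom ZpG JY := et_comp inJ t.
have ie : gequiv i := section_equiv t.
have i_inj : injective i.
  by move=> c c' /inJ_inj E; rewrite -(ht c) E ht.
pose S := [set i c | c : ZpG].
have inS c : i c \in S by apply/imsetP; exists c.
have [||||Q [q [qe qs kq]]] := @quot_gGrp _ _ _ _ JY S.
- by rewrite -(et0 i).
- by move=> _ _ /imsetP[c _ ->] /imsetP[c' _ ->]; rewrite -etB.
- by move=> s _ /imsetP[c _ ->]; rewrite -et_act.
- by move=> _ /imsetP[c _ ->]; rewrite -ie.
have ex : exact_seq i q.
  split => //; split => // e; rewrite kq.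
  by split=> [/imsetP[c _ ->]|[c <-]]; [exists c|].
exists Q, i, q; split => //; apply/(gfree_card_norm (card_quotient ex)).
rewrite (image_norm qe qs) card_in_imset ?card_norm_image //.
move=> x y /norm_imageP[g ->] /norm_imageP[g' ->] /eqP.
rewrite -subr_eq0 -etB => /eqP/kq/imsetP[c _ E].
have c0 : c = 0.
  apply: (section_off_norm ht); apply/norm_imageP; exists (g - g').
  by rewrite !etB -[inJ (t c)]/(i c) -E.
by move: E; rewrite c0 et0 => /eqP; rewrite subr_eq0 => /eqP.
Qed.

(** By freeness the norm images of [Q] and [JY] have the same order, so the latter meets the kernel
    of [q] trivially. Hence [i 1], which delta kills, is not in the norm image, and [a2] is nonzero
    on it. *)
Lemma quotient_split_a (Q : gGrp iota p) (i : etHom ZpG JY) (q : etHom JY Q) :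
  gequiv i -> gequiv q -> exact_seq i q -> gfree Q -> splits a2.
Proof.
move=> ie qe ex fQ; have [[i_inj ki] qs] := ex.
have /(gfree_card_norm (card_quotient ex)) cN := fQ.
have q_inj : {in norm_image JY &, injective q}.
  by apply/imset_injP; rewrite -(image_norm qe qs) cN card_norm_image cGX.
have /choice[tau Htau] : forall c, exists n, inJ n = i c.
  by move=> c; apply/hker.2; apply: equiv_trivial.
have tauD x y : tau (x + y) = tau x + tau y.
  by apply: inJ_inj; rewrite et_add !Htau et_add.
have a2tau x : a2 (tau x) = a2 (tau 1) * x.
  have := Fp_linear pp (@killed_by_p _ _ _ _ Zp) (f := fun x => a2 (tau x)).
  move=> -> => [|y z]; last by rewrite tauD et_add.
  by rewrite -mulr_natr natr_Zp.
have u0 : a2 (tau 1) != 0 :> 'F_p.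
  apply/eqP => /ha.1.2[g Eg].
  have i1 : i 1 \in norm_image JY by apply/norm_imageP; exists g; rewrite Eg Htau.
  have i0 : 0 \in norm_image JY by apply/norm_imageP; exists 0; rewrite !et0.
  have : i 1 = 0.
    by apply: (q_inj _ _ i1 i0); rewrite et0; apply/ki; exists 1.
  rewrite -(et0 i) => /i_inj/eqP; rewrite (oner_eq0 'F_p) //.
(* [tau] followed by [a2] is multiplication by the unit [a2 (tau 1)], which may differ from 1. *)
pose tf (c : Zp) : Jker := tau ((a2 (tau 1) : 'F_p)^-1 * (c : 'F_p)).
have tD x y : tf (x + y) = tf x + tf y by rewrite /tf mulrDr tauD.
have tA s x : tf (act s x) = act s (tf x).
  by apply: inJ_inj; rewrite et_act !Htau -et_act.
exists (EtHom tD tA) => c; rewrite /= a2tau.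
by rewrite mulrA divff ?mul1r.
Qed.

(** The section yields a retraction [rho] of [b1], and [K] is the kernel of the resulting map [q] to
    Z/pZ. *)
Lemma split_b_subgroup : splits b2 ->
  exists (K : gGrp iota p) (i : etHom K JY) (q : etHom JY ZpG),
    [/\ gequiv i, gequiv q, exact_seq i q & gfree K].
Proof.
move=> [t ht].
have /choice[rho Hrho] : forall c, exists z, b1 z = c - t (b2 c).
  by move=> c; apply/hb.1.2; rewrite etB ht subrr.
have rD x y : rho (x + y) = rho x + rho y.
  by apply: b1_inj; rewrite et_add !Hrho !et_add opprD addrACA.
have rA s x : rho (act s x) = act s (rho x).
  by apply: b1_inj; rewrite et_act !Hrho !et_act act_add actN.
have rb z : rho (b1 z) = z.
  apply: b1_inj; rewrite Hrho (_ : b2 (b1 z) = 0) ?et0 ?subr0 //.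
  by apply/hb.1.2; exists z.
pose q : etHom JY ZpG := et_comp (EtHom rD rA) prJ.
have qs c : exists e, q e = c.
  by have [e He] := hcok.1 (b1 c); exists e; rewrite /= He rb.
have qe : gequiv q.
  move=> e; rewrite -[RHS]/(q e); apply/eqP; rewrite -subr_eq0 -etB.
  have -> : q (gam JY e - e) = rho (prJ (delta e)) by [].
  rewrite (_ : prJ _ = 0); last by apply/hcok.2; exists e.
  by rewrite -(et0 b1) rb.
pose S := [set e | q e == 0].
have [||||K [i [ie i_inj iS]]] := @sub_gGrp _ _ _ _ JY S.
- by rewrite inE et0.
- by move=> x y; rewrite !inE etB => /eqP -> /eqP ->; rewrite subr0.
- by move=> s x; rewrite !inE et_act => /eqP ->.
- by move=> x; rewrite !inE qe => /eqP ->.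
have ex : exact_seq i q.
  split => //; split => // e; rewrite -iS inE.
  by split=> [->|/eqP].
exists K, i, q; split => //; apply/(gfree_card_norm (card_subgroup ex)).
rewrite -cGX -card_norm_image -(card_imset _ i_inj); apply: eq_card => x.
apply/imsetP/imsetP => [[_ /imsetP[y _ ->] ->]|[e _ ->]].
  by exists (i y) => //; rewrite delta_equiv.
(* [e] is moved into the kernel of [q] by subtracting an element with the same image under [q] that
   the norm kills. *)
have [e0 He0] := hcok.1 (b1 (q e)).
have Ne0 : N e0 = 0 by apply/norm_eq0; exists (q e).
have /iS[y Ey] : e - e0 \in S by rewrite inE etB [q e0]/= He0 rb subrr.
exists (iter p.-1 (@delta _ _ _ _ K) y); first by apply/imsetP; exists y.
rewrite delta_equiv // Ey.
have := delta_iterD p.-1 (e - e0) e0; rewrite subrK => ->.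
by rewrite Ne0 addr0.
Qed.

Lemma subgroup_split_b (K : gGrp iota p) (i : etHom K JY) (q : etHom JY ZpG) :
  gequiv i -> gequiv q -> exact_seq i q -> gfree K -> splits b2.
Proof.
move=> ie qe ex fK; have [[i_inj ki] qs] := ex; have cK := card_subgroup ex.
have /(gfree_card_norm cK) cN := fK.
have q_delta e : q (delta e) = 0 by rewrite etB qe subrr.
(* Otherwise the kernel of the norm on [JY] lies in [K]; the norm images having equal orders, [JY]
   and [K] would have the same order. *)
have [e0 Ne0 qe0] : exists2 e, N e = 0 & q e != 0.
  apply: contrapT => H.
  have kerJ := card_ker_im (@delta_iterD k kbar iota p JY p.-1).
  have kerK := card_ker_im (@delta_iterD k kbar iota p K p.-1).
  rewrite -/(norm_image _) in kerJ; rewrite -/(norm_image _) in kerK.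
  have E : #|[set x : JY | N x == 0]| = #|[set x : K | iter p.-1 (@delta _ _ _ _ K) x == 0]|.
    rewrite -(card_imset _ i_inj); apply: eq_card => x; rewrite inE.
    apply/eqP/imsetP => [Nx|[y]].
      have /ki[y Ey] : q x = 0.
        by apply/eqP; apply: contrapT => /negP qx; apply: H; exists x.
      exists y => //; rewrite inE; apply/eqP/i_inj.
      by rewrite et0 delta_equiv // Ey.
    by rewrite inE => /eqP Ny ->; rewrite -delta_equiv // Ny et0.
  have := cJY; rewrite -kerJ E card_norm_image cGX -cN kerK cK => /eqP.
  by rewrite eqn_exp2l // => /eqP; lia.
have [z0 Ez0] : exists z, b1 z = prJ e0 by apply/norm_eq0.
have /choice[lift Hlift] := hcok.1.
have qpr e e' : prJ e = prJ e' -> q e = q e'.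
  move=> /eqP; rewrite -subr_eq0 -etB => /eqP/hcok.2[x Ex].
  by apply/eqP; rewrite -subr_eq0 -etB Ex q_delta.
(* [q] kills differences, so it factors through the cokernel. There it is nonzero on the image of
   [b1], so its kernel is a complement of that image and defines the section. *)
pose kap c := q (lift c).
have kapE e : kap (prJ e) = q e by apply: qpr; rewrite Hlift.
have kapD x y : kap (x + y) = kap x + kap y.
  by rewrite -et_add; apply: qpr; rewrite et_add !Hlift.
have kapA s x : kap (act s x) = kap x.
  by rewrite -[RHS]/(act s (kap x)) -et_act; apply: qpr; rewrite et_act !Hlift.
have kapb z : kap (b1 z) = kap (b1 1) * z :> 'F_p.
  have := Fp_linear pp (@killed_by_p _ _ _ _ Zp) (f := fun x => kap (b1 x)).
  move=> -> => [|x y]; last by rewrite et_add kapD.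
  by rewrite -mulr_natr natr_Zp.
have u0 : kap (b1 1) != 0 :> 'F_p.
  by apply/eqP => E; move: qe0; rewrite -kapE -Ez0 kapb E mul0r eqxx.
have uniq x y : kap x = kap y -> b2 x = b2 y -> x = y.
  move=> kxy /eqP; rewrite -subr_eq0 -etB => /eqP/hb.1.2[z Ez].
  have E : x = b1 z + y by rewrite Ez subrK.
  move: kxy; rewrite E kapD -[RHS]add0r => /addIr; rewrite kapb => /eqP.
  by rewrite mulf_eq0 (negPf u0) /= => /eqP ->; rewrite et0 add0r.
have /choice[t Ht] : forall g, exists x, kap x = 0 /\ b2 x = g.
  move=> g; have [c <-] := hb.2 g.
  pose z : 'F_p := (kap c : 'F_p) / (kap (b1 1) : 'F_p).
  exists (c - b1 z); split; last first.
    by rewrite etB (_ : b2 (b1 z) = 0) ?subr0 //; apply/hb.1.2; exists z.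
  apply: (addIr (kap (b1 z))); rewrite -kapD subrK add0r kapb /z.
  by rewrite mulrCA divff ?mulr1.
have tD x y : t (x + y) = t x + t y.
  by apply: uniq; rewrite ?kapD ?et_add ?(Ht _).1 ?(Ht _).2 ?addr0.
have tA s x : t (act s x) = act s (t x).
  by apply: uniq; rewrite ?kapA ?et_act ?(Ht _).1 ?(Ht _).2.
by exists (EtHom tD tA) => g; rewrite /= (Ht _).2.
Qed.

Lemma split_direct_sum : splits a2 -> splits b2 ->
  exists (K : gGrp iota p) (i : etHom ZpG JY) (j : etHom K JY),
    is_direct_sum i j /\ gfree K.
Proof.
move=> [t ht] /split_b_subgroup[K [j [q [je qe ex fK]]]].
have [[j_inj kj] qs] := ex; have cK := card_subgroup ex.
pose i : etHom ZpG JY := et_comp inJ t.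
have ie : gequiv i := section_equiv t.
have i_inj : injective i by move=> c c' /inJ_inj E; rewrite -(ht c) E ht.
exists K, i, j; split => //; split => //.
apply: inj_card_bij; last by rewrite card_prod card_Zp cK cJY expnS.
(* A common element is killed by delta, so by freeness it is a norm from [K], hence lies in the norm
   image of [JY], which the section avoids. *)
have key c y : i c = j y -> c = 0.
  move=> E; have dy : delta y = 0.
    apply: j_inj; rewrite et0; have := delta_equiv 1 y je => /= ->.
    by rewrite -E; apply: equiv_trivial.
  apply: (section_off_norm ht).
  have /imsetP[y' _ Ey] := gfree_kernel fK dy.
  apply/imsetP; exists (j y') => //.
  by rewrite -delta_equiv // -Ey -E.
move=> [c y] [c' y'] /= E.
have E1 : i (c - c') = j (y' - y).
  rewrite !etB; apply/eqP; rewrite subr_eq addrAC eq_sym subr_eq; apply/eqP.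
  by rewrite addrC -E addrC.
have /eqP := key _ _ E1; rewrite subr_eq0 => /eqP cc.
by move: E; rewrite cc => /addrI/j_inj ->.
Qed.

(** The two projections of the direct sum give the exact sequences to which [quotient_split_a] and
    [subgroup_split_b] apply. *)
Lemma direct_sum_split (K : gGrp iota p) (i : etHom ZpG JY) (j : etHom K JY) :
  is_direct_sum i j -> gfree K -> splits a2 /\ splits b2.
Proof.
move=> [ie je [psi psiK Kpsi]] fK.
have psiD x y : psi (x + y) = ((psi x).1 + (psi y).1, (psi x).2 + (psi y).2).
  apply: (can_inj psiK); rewrite Kpsi /= !et_add addrACA.
  by congr (_ + _); rewrite -[LHS]Kpsi.
have psiA s x : psi (act s x) = (act s (psi x).1, act s (psi x).2).
  apply: (can_inj psiK); rewrite Kpsi -[in LHS](Kpsi x).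
  by rewrite act_add -!et_act.
have psiG x : psi (gam JY x) = (gam ZpG (psi x).1, gam K (psi x).2).
  apply: (can_inj psiK); rewrite Kpsi -[in LHS](Kpsi x).
  by rewrite et_add -ie -je.
have D1 x y : (psi (x + y)).1 = (psi x).1 + (psi y).1 by rewrite psiD.
have D2 x y : (psi (x + y)).2 = (psi x).2 + (psi y).2 by rewrite psiD.
have A1 s x : (psi (act s x)).1 = act s (psi x).1 by rewrite psiA.
have A2 s x : (psi (act s x)).2 = act s (psi x).2 by rewrite psiA.
pose q1 : etHom JY ZpG := @EtHom _ _ _ _ JY ZpG _ D1 A1.
pose q2 : etHom JY K := @EtHom _ _ _ _ JY K _ D2 A2.
have psi_i c : psi (i c) = (c, 0) by rewrite -[RHS]psiK /= et0 addr0.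
have psi_j y : psi (j y) = (0, y) by rewrite -[RHS]psiK /= et0 add0r.
split.
  apply: (quotient_split_a (i := i) (q := q2)) => //.
    by move=> e; rewrite /= psiG.
  split; last by move=> y; exists (j y); rewrite /= psi_j.
  split.
    by move=> c c' /(congr1 psi); rewrite !psi_i => -[].
  move=> x; split=> [/= x2|[c <-]]; last by rewrite /= psi_i.
  by exists (psi x).1; rewrite -[RHS]Kpsi /= x2 et0 addr0.
apply: (subgroup_split_b (i := j) (q := q1)) => //.
  by move=> e; rewrite /= psiG.
split; last by move=> c; exists (i c); rewrite /= psi_i.
split.
  by move=> y y' /(congr1 psi); rewrite !psi_j => -[].
move=> x; split=> [/= x1|[y <-]]; last by rewrite /= psi_j.
by exists (psi x).2; rewrite -[RHS]Kpsi /= x1 et0 add0r.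
Qed.

End Splitting.

Theorem proposition1p6
  (k : fieldType) (p : nat) (pk : p \in [pchar k]) (hk : perfect_char k p)
  (kbar : closedFieldType) (iota : {rmorphism k -> kbar})
  (hbar : forall z : kbar, algebraic_over iota z)
  (X Y : curve k) (pi : galois_cover p X Y)
  (* the class of the cover in H^1_dR(X) *)
  (eta : cochain X) (heta : torsor_class pi eta)
  (* J_X[p]_et, J_Y[p]_et and the pull back *)
  (JX : etGrp iota p) (thX : {ffun JX -> kbar} -> cochain X)
  (hJX : is_jac_et thX)
  (JY : gGrp iota p) (thY : {ffun JY -> kbar} -> cochain Y)
  (hJY : is_jac_et_G pi thY)
  (pb : etHom JX JY) (hpb : is_pullback pi thX thY pb)
  (* G_{X,et} is the kernel of the canonical surjection *)
  (s : etHom JX (Zp_et iota pk)) (hs : is_canonical_surj eta thX s)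
  (GX : etGrp iota p) (iX : etHom GX JX) (hGX : is_kernel iX s)
  (* J_Y[p]_et[delta] and J_Y[p]_et / delta *)
  (Jker : etGrp iota p) (inJ : etHom Jker JY) (hker : is_delta_kernel inJ)
  (Jcok : etGrp iota p) (prJ : etHom JY Jcok) (hcok : is_delta_cokernel prJ)
  (* sequence (a): transport through pi^* : J_X[p]_et -> J_Y[p]_et[delta] *)
  (pbk : etHom JX Jker) (hpbk : forall e, inJ (pbk e) = pb e)
  (a1 : etHom GX Jker) (ha1 : forall g, a1 g = pbk (iX g))
  (a2 : etHom Jker (Zp_et iota pk)) (ha2 : forall e, a2 (pbk e) = s e)
  (ha : exact_seq a1 a2)
  (* sequence (b): delta ^ (p - 1) as a map onto G_{X,et} *)
  (b2 : etHom Jcok GX)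
  (hb2 : forall e : JY, inJ (a1 (b2 (prJ e))) = iter p.-1 (@delta _ _ _ _ JY) e)
  (b1 : etHom (Zp_et iota pk) Jcok) (hb : exact_seq b1 b2) :
  (splits a2 <->
     exists (Q : gGrp iota p) (i : etHom (Zp_G iota pk) JY) (q : etHom JY Q),
       [/\ gequiv i, gequiv q, exact_seq i q & gfree Q]) /\
  (splits b2 <->
     exists (K : gGrp iota p) (i : etHom K JY) (q : etHom JY (Zp_G iota pk)),
       [/\ gequiv i, gequiv q, exact_seq i q & gfree K]) /\
  ((splits a2 /\ splits b2) <->
     exists (K : gGrp iota p) (i : etHom (Zp_G iota pk) JY) (j : etHom K JY),
       is_direct_sum i j /\ gfree K).
Proof.
(* [r] is the rank of G_{X,et} over F_p; all other orders are expressed through it. *)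
have [r [aX [_ [bijX _ _]]]] := dieudonne_basis pk hbar GX.
have cGX := card_points pk bijX.
have cN := card_norm_image hker hcok ha hb hb2.
have cK := card_delta_kernel hker ha.
have cs : #|[set e | s e == 0]| = (p ^ r)%N.
  rewrite -cGX -(card_imset predT hGX.1); apply: eq_card => e; rewrite inE.
  apply/eqP/imsetP => [/hGX.2[g <-]|[g _ ->]]; first by exists g.
  by apply/hGX.2; exists g.
have cJY : #|JY| = (p ^ (p * r).+1)%N.
  apply: (card_jacobian hk hbar heta hJX hJY hs) => //; last by rewrite cN cGX.
  by rewrite cK cGX expnSr.
split; [|split].
- split; first exact: (split_a_quotient hk hbar hker hcok ha hb hb2 cGX cJY).
  by move=> [Q [i [q [ie qe ex fQ]]]];
    apply: (quotient_split_a hk hbar hker hcok ha hb hb2 cGX cJY ie qe ex fQ).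
- split; first exact: (split_b_subgroup hk hbar hker hcok ha hb hb2 cGX cJY).
  by move=> [K [i [q [ie qe ex fK]]]];
    apply: (subgroup_split_b hk hbar hker hcok ha hb hb2 cGX cJY ie qe ex fK).
- split.
    by move=> [sa sb]; apply: (split_direct_sum hk hbar hker hcok ha hb hb2 cGX cJY sa sb).
  by move=> [K [i [j [ds fK]]]];
    apply: (direct_sum_split hk hbar hker hcok ha hb hb2 cGX cJY ds fK).
Qed.
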